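(* Unless the Strong Exponential Time Hypothesis (SETH) fails, for any constant $k\ge 3$ and any constant $\varepsilon>0$ there is no algorithm that solves $k$-LCIS in time $O(n^{k-\varepsilon})$.
   Context: $k$-LCIS problem: given $k$ integer sequences $X_1,\dots,X_k$ each of length at most $n$, determine the length of the longest sequence $Z$ that is strictly increasing and is a subsequence of each $X_i$, $i\in\{1,\dots,k\}$. SETH: there is no $\varepsilon>0$ such that for all $d\ge 3$ there is an $O(2^{(1-\varepsilon)N})$ time algorithm for $d$-SAT on $N$ variables. *)

(* Defs.v *)
From mathcomp Require Import all_boot.
From Stdlib Require Import Reals.

Set Implicit Arguments.
Unset Strict Implicit.
Unset Printing Implicit Defensive.

(* Model of computation: a logarithmic-cost RAM.                            *)
(* Registers are indexed by nat and hold nat; every instruction costs 1     *)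
(* plus the bit lengths of all register addresses and values it touches.    *)
(* (This is within polylogarithmic factors of the word-RAM, which does not  *)
(* affect statements of the form O(n^(k-eps)) or O(2^((1-eps)N)).)          *)

Inductive instr : Type :=
| CONST of nat & nat
| ADD   of nat & nat & nat
| SUB   of nat & nat & nat    (* SUB i j l   : R[i] := R[j] - R[l] (trunc)*)
| LOAD  of nat & nat
| STORE of nat & nat
| JZ    of nat & nat
| HALT.

Definition program := seq instr.
Definition regs := nat -> nat.

Definition bitlen (x : nat) : nat := (Nat.log2 x).+1.

Definition upd (r : regs) (i v : nat) : regs :=
  fun k => if k == i then v else r k.

Definition step (P : program) (pc : nat) (r : regs) : option (nat * regs * nat) :=
  if pc >= size P then None else
  match nth HALT P pc with
  | CONST i c => Some (pc.+1, upd r i c, 1 + bitlen i + bitlen c)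
  | ADD i j l => Some (pc.+1, upd r i (r j + r l),
                       1 + bitlen i + bitlen j + bitlen l + bitlen (r j) + bitlen (r l))
  | SUB i j l => Some (pc.+1, upd r i (r j - r l),
                       1 + bitlen i + bitlen j + bitlen l + bitlen (r j) + bitlen (r l))
  | LOAD i j => Some (pc.+1, upd r i (r (r j)),
                      1 + bitlen i + bitlen j + bitlen (r j) + bitlen (r (r j)))
  | STORE i j => Some (pc.+1, upd r (r i) (r j),
                       1 + bitlen i + bitlen (r i) + bitlen j + bitlen (r j))
  | JZ i t => Some (if r i == 0 then t else pc.+1, r, 1 + bitlen i + bitlen (r i))
  | HALT => None
  end.

Fixpoint exec (P : program) (fuel pc : nat) (r : regs) (acc : nat)
  : option (regs * nat) :=
  match step P pc r with
  | None => Some (r, acc)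
  | Some (pc', r', c) =>
      match fuel with
      | 0 => None
      | f.+1 => exec P f pc' r' (acc + c)
      end
  end.

Definition init_regs (inp : seq nat) : regs :=
  fun k => if k == 0 then size inp
           else if k <= size inp then nth 0 inp k.-1 else 0.

Definition runs_within (P : program) (inp : seq nat) (T : R) (out : nat) : Prop :=
  exists (fuel : nat) (r : regs) (cost : nat),
    exec P fuel 0 (init_regs inp) 0 = Some (r, cost) /\
    (INR cost <= T)%R /\ r 0 = out.

Definition literal := (nat * bool)%type.
Definition clause := seq literal.
Definition cnf := seq clause.

Definition is_dcnf (d N : nat) (f : cnf) : Prop :=
  all (fun c => (size c <= d) && all (fun l => l.1 < N) c) f.

Definition satisfiable (f : cnf) : Prop :=
  exists a : nat -> bool, all (fun c => has (fun l => a l.1 == l.2) c) f.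

Definition encode_clause (c : clause) : seq nat :=
  size c :: [seq (l.1).*2 + nat_of_bool l.2 | l <- c].
Definition encode_cnf (N : nat) (f : cnf) : seq nat :=
  N :: size f :: flatten [seq encode_clause c | c <- f].

Definition solves_dSAT_in_time (d : nat) (eps : R) (P : program) : Prop :=
  exists (C : R) (c : nat), forall (N : nat) (f : cnf),
    is_dcnf d N f ->
    exists out : nat,
      runs_within P (encode_cnf N f)
        (C * Rpower 2 ((1 - eps) * INR N) * INR (size (encode_cnf N f)).+1 ^ c)%R
        out /\
      (out = 1 <-> satisfiable f) /\ (out = 0 <-> ~ satisfiable f).

Definition SETH : Prop :=
  ~ exists eps : R, (0 < eps)%R /\
      forall d : nat, 3 <= d -> exists P : program, solves_dSAT_in_time d eps P.

Definition common_incr_subseq (Xs : seq (seq nat)) (Z : seq nat) : Prop :=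
  sorted ltn Z /\ all (fun X => subseq Z X) Xs.

Definition is_LCIS_length (Xs : seq (seq nat)) (L : nat) : Prop :=
  (exists Z, common_incr_subseq Xs Z /\ size Z = L) /\
  (forall Z, common_incr_subseq Xs Z -> size Z <= L).

Definition max_len (Xs : seq (seq nat)) : nat := \max_(X <- Xs) size X.

(* A k-LCIS instance: k sequences of length at most n = max_len, with
   entries (w.l.o.g., by order-preserving coordinate compression) in
   [0, k*n), so that each entry fits in an O(log n)-bit word. *)
Definition LCIS_instance (k : nat) (Xs : seq (seq nat)) : Prop :=
  size Xs = k /\ all (fun X => all (fun x => x < k * max_len Xs) X) Xs.

Definition encode_LCIS (Xs : seq (seq nat)) : seq nat :=
  flatten [seq size X :: X | X <- Xs].

Definition solves_kLCIS_in_time (k : nat) (eps : R) (P : program) : Prop :=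
  exists C : R, forall Xs : seq (seq nat),
    LCIS_instance k Xs ->
    exists out : nat,
      runs_within P (encode_LCIS Xs)
        (C * Rpower (INR (max_len Xs).+1) (INR k - eps))%R out /\
      is_LCIS_length Xs out.

(* Main.v *)
(** The variables of a formula with m clauses are split into k blocks of ell = O(N / k), and
    sequence t lists a gadget for each of the 2 ^ ell assignments of block t. A gadget
    contributes at most one symbol per clause to a common increasing subsequence, and does so
    exactly when one of the k chosen assignments satisfies the clause. Separators force a common
    increasing subsequence to use one gadget per sequence: in the recursive step for bit p,
    the left half is followed by a run of large symbols and the right half preceded by a run of
    small symbols, so that either choice collects the same number c * 2 ^ p of symbols but
    cannot collect both runs, while straddling the halves loses at least c symbols. The symbols
    charged to sequence t are those congruent to t modulo k; they are missing from sequence t,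
    and only from it, at the outer ends of the two halves. Hence the LCIS has length
    [threshold] if and only if the formula is satisfiable, and an O(n ^ (k - eps)) algorithm on
    sequences of length 2 ^ (N / k) times a polynomial decides satisfiability in time
    2 ^ ((1 - eps / k) * N) times a polynomial. On the RAM, the reduction is written in a small
    structured language, and the LCIS program then runs in a shifted copy of the memory. *)

Require Import Defs.
From mathcomp Require Import all_boot.
From Stdlib Require Import Reals Lra Lia.
From mathcomp Require Import all_boot zify.

Set Implicit Arguments.
Unset Strict Implicit.
Unset Printing Implicit Defensive.
(* [all_boot] takes the key [%R] for [ring_scope]. *)
Delimit Scope R_scope with R.

(** * The separated sequences *)

(** The weight [c = k * size f] is the largest number of symbols a gadget can hold. A solution that
    fails to single out a leaf in one sequence loses [c] symbols, and the gadgets cannot make that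
    up; this fixes the scale of all runs. Removing one residue class only makes the [k] choices
    independent: the upper bound splits into one bound per class.

    Three obstacles shape the machine half. First, [N] is a single input cell and is not bounded by
    the input length, so factors polynomial in [N] must be paid from the exponential saving; half of
    the gain [Rmin eps 1 / k] goes there, whence [2 * INR k] in the final constant. Second, the RAM
    has no stack, so the recursion is replaced by a binary counter over the assignments, whose
    carries emit the runs between neighbouring leaves. Third, the LCIS program is unknown: it may
    use any register and expects zeros outside its input. A shifted memory offers it fresh zero
    cells, at the price of a factor [bitlen V] for longer addresses. *)

Definition lev (k t : nat) (full : bool) (a n : nat) : seq nat :=
  [seq v <- iota a n | full || (v %% k != t)].

(* Taking the symbols of class [t] in [top - 2 W, top - W) amounts to choosing bit 1 at this
   level, those in [top + W, top + 2 W) to choosing bit 0. *)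
Fixpoint sep (k c top : nat) (g : seq bool -> seq nat) (t p : nat) (hs : seq bool)
    : seq nat :=
  if p is q.+1 then
    let W := k * (c * 2 ^ q) in
    lev k t false (top - W.*2) W ++ sep k c top g t q (false :: hs)
      ++ lev k t true (top + W) W ++ lev k t true (top - W.*2) W
      ++ sep k c top g t q (true :: hs) ++ lev k t false (top + W) W
  else g hs.

(** Literals of foreign variables count as false, so a clause holds under the joined assignment
    exactly when [csat] holds for some block. *)
Definition litval (ell t : nat) (bs : seq bool) (l : literal) : bool :=
  (t * ell <= l.1 < t.+1 * ell) && (nth false bs (l.1 - t * ell) == l.2).

Definition csat (ell t : nat) (bs : seq bool) (cl : clause) : bool :=
  has (litval ell t bs) cl.

(** The symbols of a clause are listed in decreasing order, so an increasing sequence takes at most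
    one. When [k] divides [base], the symbol [base + s] can be missing only from sequence [s];
    choosing it names [s] as a block that satisfies the clause. *)
Fixpoint gadget (k t : nat) (sat : clause -> bool) (base : nat) (f : cnf) : seq nat :=
  if f is cl :: f' then
    [seq v <- rev (iota base k) | sat cl || (v %% k != t)]
      ++ gadget k t sat (base + k) f'
  else [::].

(** [top] is the reach of the outermost runs: they start at 0 and end at [2 * top], so that no
    subtraction in [sep] truncates. *)
Definition lcis_seq (k ell : nat) (f : cnf) (t : nat) : seq nat :=
  let c := k * size f in
  let top := k * (c * 2 ^ ell) in
  sep k c top (fun bs => gadget k t (csat ell t bs) top f) t ell [::].

(** Each class yields [c * 2 ^ p] symbols at every level [p < ell], a geometric sum, and each clause
    yields one more. *)
Definition threshold (k ell : nat) (f : cnf) : nat :=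
  k * (k * size f * (2 ^ ell).-1) + size f.

(** * Increasing lists and counting by residue *)

Lemma sorted_lt_cat (s1 s2 : seq nat) :
  sorted ltn (s1 ++ s2) ->
  [/\ sorted ltn s1, sorted ltn s2 & {in s1 & s2, forall x y, x < y}].
Proof.
rewrite !(sorted_pairwise ltn_trans) pairwise_cat => /and3P[/allrelP H -> ->].
by split.
Qed.

Lemma cat_sorted_lt (s1 s2 : seq nat) :
  sorted ltn s1 -> sorted ltn s2 -> {in s1 & s2, forall x y, x < y} ->
  sorted ltn (s1 ++ s2).
Proof.
rewrite !(sorted_pairwise ltn_trans) pairwise_cat => -> -> H.
by rewrite !andbT; apply/allrelP.
Qed.

Lemma subseq_cat_inv (T : eqType) (Z A B : seq T) :
  subseq Z (A ++ B) -> exists Z1 Z2, [/\ Z = Z1 ++ Z2, subseq Z1 A & subseq Z2 B].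
Proof.
case/subseqP => m sm ->.
exists (mask (take (size A) m) A), (mask (drop (size A) m) B); split.
- rewrite -mask_cat ?cat_take_drop // size_take sm size_cat.
  by case: ltnP => //; lia.
- exact: mask_subseq.
- exact: mask_subseq.
Qed.

Lemma filter_nil (T : eqType) (a : pred T) (s : seq T) :
  {in s, forall x, ~~ a x} -> filter a s = [::].
Proof.
by move=> H; rewrite -(filter_pred0 s); apply: eq_in_filter => x /H /negbTE.
Qed.

Lemma count_modn k (f : nat -> bool) a b n :
  a = b %[mod k] -> count (fun v => f (v %% k)) (iota a n) = count (fun v => f (v %% k)) (iota b n).
Proof.
elim: n a b => //= n IH a b ab.
by rewrite ab (IH a.+1 b.+1) // -addn1 -[b.+1]addn1 -modnDml ab modnDml.
Qed.

Lemma count_class k t a n :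
  t < k -> k %| a -> count (fun v => v %% k == t) (iota a (k * n)) = n.
Proof.
move=> tk ka; rewrite (@count_modn k (fun x => x == t) a 0); last first.
  by rewrite mod0n; apply/eqP.
elim: n => [|n IH]; first by rewrite muln0.
rewrite mulnSr iotaD count_cat IH add0n (@count_modn k (fun x => x == t) _ 0); last first.
  by rewrite mod0n modnMr.
rewrite -addn1; congr addn.
have /eq_in_count -> : {in iota 0 k, (fun v => v %% k == t) =1 pred1 t}.
  by move=> v; rewrite mem_iota => /andP[_ vk] /=; rewrite modn_small.
by rewrite count_uniq_mem ?iota_uniq // mem_iota tk.
Qed.

Lemma sum_count_class k (a : pred nat) (Z : seq nat) : 0 < k ->
  count a Z = \sum_(t < k) count (fun v => (v %% k == t) && a v) Z.
Proof.
move=> k0; elim: Z => [|z Z IH] /=; first by rewrite big1.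
rewrite big_split /= -IH; congr addn.
rewrite (bigD1 (Ordinal (ltn_pmod z k0))) //= eqxx /= big1 ?addn0 // => i ni.
suff -> : (z %% k == i) = false by [].
by apply: contraNF ni => /eqP e; apply/eqP/val_inj.
Qed.

(** * Upper bound for the separators of one residue class *)

Section UpperBound.

Variables (k c top t : nat) (g : seq bool -> seq nat).
Hypotheses (k_gt0 : 0 < k) (t_lt_k : t < k) (k_dvd_top : k %| top).

(** The window from [top] to the start of the lowest upper run; it contains all gadget symbols and
    no separator. *)
Definition mid : pred nat := fun v => top <= v < top + k * c.

Hypothesis g_mid : forall bs, all mid (g bs).

Definition run (a n : nat) := [seq v <- iota a n | v %% k == t].

(** What remains of [sep] when only separators of class [t] are kept: the outer runs vanish, and the
    inner two meet in the order large, small, so that an increasing sequence uses at most one of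
    them. *)
Fixpoint class_sep (p : nat) (hs : seq bool) : seq nat :=
  if p is q.+1 then
    let W := k * (c * 2 ^ q) in
    class_sep q (false :: hs) ++ run (top + W) W ++ run (top - W.*2) W
      ++ class_sep q (true :: hs)
  else g hs.

(** This confines both halves to distance [W] from [top], while the runs around them lie at distance
    at least [W]; every comparison between runs and halves rests on it. *)
Lemma sep_range p hs v : k * (c * 2 ^ p) <= top ->
  v \in sep k c top g t p hs ->
  (top - k * (c * 2 ^ p) <= v < top + k * (c * 2 ^ p)) /\ (mid v -> exists bs, v \in g bs).
Proof.
clear t_lt_k k_dvd_top; elim: p hs => [|q IH] hs /=.
  rewrite expn0 muln1 => ktop vg; move/allP: (g_mid hs) => /(_ _ vg) Hv; split; last by exists hs.
  by move: Hv; rewrite /mid; lia.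
rewrite expnS; have : 0 < 2 ^ q by rewrite expn_gt0.
have Hc x : 0 < x -> k * c <= k * (c * x) by move=> x0; rewrite leq_mul2l leq_pmulr ?orbT.
move=> /Hc; set W := k * (c * 2 ^ q) => HW.
have -> : k * (c * (2 * 2 ^ q)) = W.*2 by rewrite /W; lia.
move=> ktop; have ktop' : W <= top by lia.
have lev_in full a n : v \in lev k t full a n -> a <= v < a + n.
  by rewrite mem_filter mem_iota => /andP[].
have {}IH b : v \in sep k c top g t q (b :: hs) ->
    top - W.*2 <= v < top + W.*2 /\ (mid v -> exists bs, v \in g bs).
  by move=> /(IH _ ktop')[H1 H2]; split=> //; rewrite -/W in H1; lia.
have out : (v < top) || (top + W <= v) -> mid v -> exists bs, v \in g bs.
  by rewrite /mid; lia.
rewrite !mem_cat => /or4P[/lev_in H|/IH //|/lev_in H|].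
- by split; [lia|apply: out; lia].
- by split; [lia|apply: out; lia].
case/or3P => [/lev_in H|/IH //|/lev_in H].
- by split; [lia|apply: out; lia].
- by split; [lia|apply: out; lia].
Qed.

Lemma class_sep_range p hs v : k * (c * 2 ^ p) <= top ->
  v \in class_sep p hs -> top - k * (c * 2 ^ p) <= v < top + k * (c * 2 ^ p).
Proof.
clear t_lt_k k_dvd_top; elim: p hs => [|q IH] hs /=.
  by rewrite expn0 muln1 => ktop vg; move/allP: (g_mid hs) => /(_ _ vg); rewrite /mid; lia.
rewrite expnS; set W := k * (c * 2 ^ q).
have -> : k * (c * (2 * 2 ^ q)) = W.*2 by rewrite /W; lia.
move=> ktop; have ktop' : W <= top by lia.
have run_in a n : v \in run a n -> a <= v < a + n.
  by rewrite mem_filter mem_iota => /andP[].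
rewrite !mem_cat => /or4P[/(IH _ ktop') H|/run_in H|/run_in H|/(IH _ ktop') H];
  rewrite -/W in H; lia.
Qed.

(** Restriction to one class replaces the [k] interacting sequences by [k] separate single-sequence
    bounds. *)
Lemma filter_sep p hs : k * (c * 2 ^ p) <= top ->
  [seq v <- sep k c top g t p hs | (v %% k == t) || mid v] = class_sep p hs.
Proof.
clear t_lt_k k_dvd_top; elim: p hs => [|q IH] hs /=.
  move=> _; apply/all_filterP/allP => v vg.
  by move/allP: (g_mid hs) => /(_ _ vg) ->; rewrite orbT.
rewrite expnS; have : 0 < 2 ^ q by rewrite expn_gt0.
have Hc x : 0 < x -> k * c <= k * (c * x) by move=> x0; rewrite leq_mul2l leq_pmulr ?orbT.
move=> /Hc; set W := k * (c * 2 ^ q) => HW.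
have -> : k * (c * (2 * 2 ^ q)) = W.*2 by rewrite /W; lia.
move=> ktop; have ktop' : W <= top by lia.
have lev_false a n : (forall v, v \in iota a n -> ~~ mid v) ->
    [seq v <- lev k t false a n | (v %% k == t) || mid v] = [::].
  by move=> H; rewrite -filter_predI; apply: filter_nil => v /H /=; case: eqP; case: mid.
have lev_true a n : (forall v, v \in iota a n -> ~~ mid v) ->
    [seq v <- lev k t true a n | (v %% k == t) || mid v] = run a n.
  move=> H; rewrite -filter_predI; apply: eq_in_filter.
  by move=> v /H /=; case: eqP; case: mid.
rewrite !filter_cat !IH // !lev_false ?lev_true ?cats0 //.
all: by move=> v; rewrite mem_iota /mid; lia.
Qed.

(* A nonempty part of either level run pins the rest of the sequence to one of the two
   halves; using neither run forfeits [c] symbols. *)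
Lemma class_sep_bound p hs Z : k * (c * 2 ^ p) <= top ->
  sorted ltn Z -> subseq Z (class_sep p hs) ->
  count (predC mid) Z + c <= c * 2 ^ p /\
  (count (predC mid) Z + c.*2 <= c * 2 ^ p \/
   exists bs, size bs = p /\ subseq (filter mid Z) (g (bs ++ hs))).
Proof.
elim: p hs Z => [|q IH] hs Z /=.
  move=> _ _ ZX; have aZ : all mid Z.
    by apply/allP => z /(mem_subseq ZX) zg; move/allP: (g_mid hs) => /(_ _ zg).
  have -> : count (predC mid) Z = 0.
    by apply/eqP; rewrite -leqn0 leqNgt -has_count has_predC aZ.
  rewrite expn0 muln1; split=> //; right; exists [::]; split=> //.
  by move/all_filterP: aZ => ->.
rewrite expnS; have : 0 < 2 ^ q by rewrite expn_gt0.
have Hc x : 0 < x -> k * c <= k * (c * x) by move=> x0; rewrite leq_mul2l leq_pmulr ?orbT.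
move=> /Hc; set W := k * (c * 2 ^ q) => HW.
have -> : k * (c * (2 * 2 ^ q)) = W.*2 by rewrite /W; lia.
move=> ktop; have ktop' : W <= top by lia.
move=> sZ /subseq_cat_inv[z1 [zr [EZ s1 /subseq_cat_inv[zq [zr' [Er sq
  /subseq_cat_inv[zp [z2 [Er' sp s2]]]]]]]]]; subst zr' zr Z.
have [sz1 sr H1] := sorted_lt_cat sZ.
have [szq sr' Hq] := sorted_lt_cat sr.
have [szp sz2 Hp] := sorted_lt_cat sr'.
have run_in a n v : v \in run a n -> a <= v < a + n.
  by rewrite mem_filter mem_iota => /andP[].
have dvdW n : k %| n * W by rewrite /W mulnCA dvdn_mulr.
have Cq : count (predC mid) zq <= c * 2 ^ q.
  apply: (leq_trans (count_size _ _)); apply: (leq_trans (size_subseq sq)).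
  rewrite size_filter count_class // dvdn_addr //.
  by rewrite -[W]mul1n.
have Cp : count (predC mid) zp <= c * 2 ^ q.
  apply: (leq_trans (count_size _ _)); apply: (leq_trans (size_subseq sp)).
  by rewrite size_filter count_class // dvdn_sub // -mul2n.
have fnil z a n : subseq z (run a n) -> (a + n <= top) || (top + k * c <= a) -> filter mid z = [::].
  move=> zs an; apply: filter_nil => v.
  move=> /(mem_subseq zs)/run_in; rewrite /= /mid; clear -an; lia.
have fq : filter mid zq = [::] by apply: fnil sq _; clear -HW; lia.
have fp : filter mid zp = [::] by apply: fnil sp _; clear -HW ktop; lia.
have [L1 A1] := IH _ _ ktop' sz1 s1.
have [L2 A2] := IH _ _ ktop' sz2 s2.
have E2 : c * (2 * 2 ^ q) = (c * 2 ^ q).*2 by rewrite mulnCA mul2n.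
rewrite !count_cat !filter_cat fq fp /= E2.
(* If the upper run is used, nothing after it can be: the lower run and the right half hold only
   smaller symbols. *)
case: zq sq Cq fq H1 Hq sZ sr szq => [|v zq] sq Cq fq H1 Hq sZ sr szq /=; last first.
  have vq : top + W <= v by have := run_in _ _ _ (mem_subseq sq (mem_head _ _)); clear; lia.
  have -> : zp = [::].
    case: zp sp {Cp szp sr' Hp fp H1 sZ sr} Hq => // u zp sp Hq.
    have := run_in _ _ _ (mem_subseq sp (mem_head _ _)).
    have := Hq v u (mem_head _ _); rewrite mem_cat mem_head => /(_ isT).
    clear -vq HW ktop; lia.
  have -> : z2 = [::].
    case: z2 s2 {sz2 L2 A2 sr' Hp H1 sZ sr} Hq => // u z2 s2 Hq.
    have := class_sep_range ktop' (mem_subseq s2 (mem_head _ _)).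
    have := Hq v u (mem_head _ _); rewrite mem_cat mem_head orbT => /(_ isT).
    rewrite -/W; clear -vq HW ktop; lia.
  rewrite /= in Cq *; split; first by clear -L1 L2 Cq Cp; lia.
  case: A1 => [A1|[bs [Sbs Abs]]]; [left; clear -A1 Cq; lia|right].
  (* Bits are listed from level 0 upwards, so the choice at level [q] goes to the end of [bs], next
     to [hs]. *)
  by exists (rcons bs false); rewrite size_rcons Sbs cat_rcons cats0.
(* If the lower run is used, nothing before it can be: the left half holds only larger symbols. *)
case: zp sp Cp fp H1 Hq Hp sZ sr sr' szp => [|v zp] sp Cp fp H1 Hq Hp sZ sr sr' szp /=; last first.
  have vp : v < top - W by have := run_in _ _ _ (mem_subseq sp (mem_head _ _)); clear -ktop HW; lia.
  have -> : z1 = [::].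
    case: z1 s1 {sz1 L1 A1 sr' Hp sZ sr} H1 => // u z1 s1 H1.
    have := class_sep_range ktop' (mem_subseq s1 (mem_head _ _)).
    have := H1 u v (mem_head _ _); rewrite mem_head => /(_ isT).
    rewrite -/W; clear -vp HW ktop; lia.
  rewrite /= in Cp *; split; first by clear -L1 L2 Cq Cp; lia.
  case: A2 => [A2|[bs [Sbs Abs]]]; [left; clear -A2 Cp; lia|right].
  by exists (rcons bs true); rewrite size_rcons Sbs cat_rcons.
(* With neither run in use, the bounds of the halves, each short by [c], add up to a deficit of
   [2 * c]. *)
by split; [|left]; clear -L1 L2; lia.
Qed.

End UpperBound.

(** * Clause gadgets and block assignments *)

Section Gadgets.

Variables (k ell : nat).
Hypothesis k_gt0 : 0 < k.

Lemma gadget_range t sat base f v :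
  v \in gadget k t sat base f -> base <= v < base + k * size f.
Proof.
clear k_gt0; elim: f base => //= cl f IH base; rewrite mem_cat => /orP[|/IH]; last by lia.
by rewrite mem_filter mem_rev mem_iota => /andP[_]; lia.
Qed.

Lemma sorted_subseq_rev_iota (Z : seq nat) a n :
  sorted ltn Z -> subseq Z (rev (iota a n)) -> size Z <= 1.
Proof.
case: Z => [|x [|y Z]] //= /andP[xy _] S.
have : sorted gtn (x :: y :: Z).
  apply: (subseq_sorted _ S); first by move=> u v w /=; lia.
  by rewrite rev_sorted iota_ltn_sorted.
by rewrite /= => /andP[]; lia.
Qed.

(** Only one symbol per clause fits, by the decreasing order. A used symbol [v] must occur also in
    sequence [v %% k], the one that omits it unless its own block satisfies the clause. *)
Lemma gadget_upper (sat : nat -> clause -> bool) base f Z :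
  k %| base -> sorted ltn Z ->
  (forall t, t < k -> subseq Z (gadget k t (sat t) base f)) ->
  size Z <= count (fun cl => has (fun t => sat t cl) (iota 0 k)) f.
Proof.
elim: f base Z => [|cl f IH] base Z kb sZ H /=.
  exact: size_subseq (H 0 k_gt0).
have kb' : k %| base + k by rewrite dvdn_addl.
have -> : size Z = size [seq v <- Z | v < base + k] + size [seq v <- Z | base + k <= v].
  rewrite !size_filter -(count_predC (fun v => v < base + k)); congr addn.
  by apply: eq_count => v /=; rewrite -leqNgt.
have iota_in b v : v \in [seq v <- rev (iota base k) | b v] -> base <= v < base + k.
  by rewrite mem_filter mem_rev mem_iota => /andP[_].
apply: leq_add; last first.
  apply: (IH (base + k)) => //; first by apply: sorted_filter sZ; apply: ltn_trans.
  move=> t tk; rewrite -(_ : filter (fun v => base + k <= v) (gadget k t (sat t) base (cl :: f))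
      = gadget k t (sat t) (base + k) f).
    by rewrite subseq_filter filter_all (subseq_trans (filter_subseq _ _) (H t tk)).
  rewrite filter_cat filter_nil ?cat0s; last by move=> v /iota_in; lia.
  by apply/all_filterP/allP => v /gadget_range; lia.
have H' t : t < k -> subseq [seq v <- Z | v < base + k]
    [seq v <- rev (iota base k) | sat t cl || (v %% k != t)].
  move=> tk; rewrite -(_ : filter (fun v => v < base + k) (gadget k t (sat t) base (cl :: f))
      = [seq v <- rev (iota base k) | sat t cl || (v %% k != t)]).
    by rewrite subseq_filter filter_all (subseq_trans (filter_subseq _ _) (H t tk)).
  rewrite filter_cat [X in _ ++ X]filter_nil ?cats0; last by move=> v /gadget_range; lia.
  by apply/all_filterP/allP => v /iota_in; lia.
have : size [seq v <- Z | v < base + k] <= 1.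
  apply: (@sorted_subseq_rev_iota _ base k).
    by apply: sorted_filter sZ; apply: ltn_trans.
  exact: (subseq_trans (H' _ k_gt0) (filter_subseq _ _)).
case E : [seq v <- Z | v < base + k] => [|v Z'] // S1; apply: (leq_trans S1).
suff -> : has (fun t => sat t cl) (iota 0 k) by [].
apply/hasP; exists (v %% k); first by rewrite mem_iota ltn_mod.
have := mem_subseq (H' _ (ltn_pmod v k_gt0)) (_ : v \in _).
rewrite E mem_head => /(_ isT); rewrite mem_filter eqxx orbF.
by case/andP.
Qed.

Fixpoint witness_mid (sat : nat -> clause -> bool) base (f : cnf) : seq nat :=
  if f is cl :: f' then
    base + find (fun t => sat t cl) (iota 0 k) :: witness_mid sat (base + k) f'
  else [::].

Lemma witness_midP (sat : nat -> clause -> bool) base f :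
  k %| base -> all (fun cl => has (fun t => sat t cl) (iota 0 k)) f ->
  [/\ sorted ltn (witness_mid sat base f), size (witness_mid sat base f) = size f
    & forall t, t < k -> subseq (witness_mid sat base f) (gadget k t (sat t) base f)].
Proof.
elim: f base => [|cl f IH] base //= kb /andP[Hcl Hf].
have kb' : k %| base + k by rewrite dvdn_addl.
have [IH1 IH2 IH3] := IH _ kb' Hf.
set s := find _ _; have sk : s < k by move: Hcl; rewrite has_find size_iota.
split.
- rewrite (path_sortedE ltn_trans) IH1 andbT.
  apply/allP => v /(mem_subseq (IH3 _ k_gt0))/gadget_range; lia.
- by rewrite IH2.
move=> t tk; rewrite -cat1s; apply: cat_subseq; last exact: IH3.
rewrite sub1seq mem_filter mem_rev mem_iota leq_addr ltn_add2l sk !andbT.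
(* Only sequence [s] itself could omit the symbol of class [s], and block [s] satisfies the clause
   by the choice of [s]. *)
case: eqP => [E|]; last by rewrite orbT.
have := nth_find 0 Hcl; rewrite -/s nth_iota // add0n.
move/dvdnP: kb E => [q ->]; rewrite modnMDl modn_small // => <- -> //.
Qed.

Definition bits_of (a : nat -> bool) t := [seq a (t * ell + q) | q <- iota 0 ell].

(** The blocks partition the variables, so the assignments glue: variable [v] is bit [v %% ell] of
    block [v %/ ell]. *)
Lemma sat_bits (bs : nat -> seq bool) f :
  0 < ell ->
  all (fun cl => has (fun t => csat ell t (bs t) cl) (iota 0 k)) f ->
  satisfiable f.
Proof.
clear k_gt0; move=> ell0 /allP H; exists (fun v => nth false (bs (v %/ ell)) (v %% ell)).
apply/allP => cl clf; case/hasP: (H _ clf) => t _ /hasP[[v b] lcl /andP[/= Hl /eqP Hb]].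
apply/hasP; exists (v, b) => //=.
have [u Ev] : exists u, v = t * ell + u by exists (v - t * ell); rewrite subnKC //; case/andP: Hl.
have lt : u < ell by move: Hl; rewrite Ev mulSn; lia.
by rewrite -Hb Ev divnMDl // divn_small // addn0 modnMDl modn_small // addKn.
Qed.

Lemma bits_sat (a : nat -> bool) N f d :
  0 < ell -> N <= k * ell -> is_dcnf d N f ->
  all (fun cl => has (fun l => a l.1 == l.2) cl) f ->
  all (fun cl => has (fun t => csat ell t (bits_of a t) cl) (iota 0 k)) f.
Proof.
move=> ell0 Nk /allP df /allP H; apply/allP => cl clf.
have /andP[_ /allP Hl] := df _ clf.
case/hasP: (H _ clf) => -[v b] lcl Hal; apply/hasP; exists (v %/ ell).
  rewrite mem_iota /= add0n ltn_divLR //; exact: leq_trans (Hl _ lcl) Nk.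
apply/hasP; exists (v, b) => //; apply/andP; split; rewrite /=.
  by rewrite leq_divM ltn_ceil.
have -> : v - v %/ ell * ell = v %% ell by rewrite {1}(divn_eq v ell) addKn.
by rewrite (nth_map 0) ?size_iota ?ltn_mod // nth_iota ?ltn_mod // add0n -divn_eq.
Qed.

End Gadgets.

(** * The common subsequence given by a satisfying assignment *)

Section Witness.

Variables (k c top ell m : nat) (g : nat -> seq bool -> seq nat) (z : seq nat).
Variable (bit : nat -> nat -> bool).
Hypotheses (k_gt0 : 0 < k) (k_dvd_top : k %| top).
Hypotheses (z_sorted : sorted ltn z) (z_size : size z = m).
Hypothesis z_range : {in z, forall v, top <= v < top + k * c}.
Hypothesis z_sub :
  forall t, t < k -> subseq z (g t [seq bit t q | q <- iota 0 ell]).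

Fixpoint witness (p : nat) : seq nat :=
  if p is q.+1 then
    let W := k * (c * 2 ^ q) in
    [seq v <- iota (top - W.*2) W | bit (v %% k) q] ++ witness q
      ++ [seq v <- iota (top + W) W | ~~ bit (v %% k) q]
  else z.

(** The two runs of a level have the same residues, so the complementary filters together keep
    [k * (c * 2 ^ q)] symbols, whatever the bits are. *)
Lemma size_witness p : k * (c * 2 ^ p) <= top ->
  size (witness p) = k * (c * (2 ^ p).-1) + m.
Proof.
clear z_sorted z_range z_sub; elim: p => [|q IH] /=; first by rewrite muln0 muln0.
rewrite expnS => H; rewrite !size_cat !size_filter IH; last by lia.
have -> : count (fun v => ~~ bit (v %% k) q) (iota (top + k * (c * 2 ^ q)) (k * (c * 2 ^ q)))
    = count (fun v => ~~ bit (v %% k) q) (iota (top - (k * (c * 2 ^ q)).*2) (k * (c * 2 ^ q))).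
  apply: (@count_modn k (fun x => ~~ bit x q)); apply/eqP.
  rewrite eqn_mod_dvd; last by lia.
  set W := k * (c * 2 ^ q); have -> : top + W - (top - W.*2) = 3 * W by rewrite /W; lia.
  by rewrite dvdn_mull // dvdn_mulr.
set s := iota (_ - _) _.
have : count (fun v => bit (v %% k) q) s + count (fun v => ~~ bit (v %% k) q) s = k * (c * 2 ^ q).
  by rewrite -[RHS](size_iota (top - (k * (c * 2 ^ q)).*2)) -(count_predC (fun v => bit (v %% k) q)).
move: (count _ s) (count _ s) => x1 x2.
have : 0 < 2 ^ q by rewrite expn_gt0.
case: (2 ^ q) => // y _; rewrite succnK; have -> : (2 * y.+1).-1 = y + y.+1 by lia.
by rewrite !mulnDr; lia.
Qed.

Lemma sorted_witness p : k * (c * 2 ^ p) <= top ->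
  sorted ltn (witness p) /\
  {in witness p, forall v, top - k * (c * 2 ^ p) <= v < top + k * (c * 2 ^ p)}.
Proof.
clear k_dvd_top z_size z_sub; elim: p => [|q IH] /=.
  by rewrite muln1 => H; split=> // v /z_range; lia.
rewrite expnS; set W := k * (c * 2 ^ q).
have -> : k * (c * (2 * 2 ^ q)) = W.*2 by rewrite /W; lia.
move=> H; have [|IH1 IH2] := IH; first by rewrite -/W; lia.
have fi b a n v : v \in [seq v <- iota a n | b v] -> a <= v < a + n.
  by rewrite mem_filter mem_iota => /andP[].
have so b a n : sorted ltn [seq v <- iota a n | b v].
  by apply: sorted_filter (iota_ltn_sorted _ _); apply: ltn_trans.
split; last first.
  by move=> v; rewrite !mem_cat => /or3P[/fi|/IH2|/fi]; rewrite -?/W; lia.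
apply: cat_sorted_lt => //; first apply: cat_sorted_lt => //.
  by move=> u v /IH2 + /fi; rewrite -/W; lia.
by move=> u v /fi + ; rewrite mem_cat => + /orP[/IH2|/fi]; rewrite -?/W; lia.
Qed.

(** With bit 1, sequence [t] goes through its full lower run and its thinned upper run; the symbols
    of class [t] missing from the latter are those that the witness took from the lower run instead.
    Bit 0 is symmetric. *)
Lemma subseq_witness t p : t < k -> p <= ell ->
  subseq (witness p) (sep k c top (g t) t p [seq bit t q | q <- iota p (ell - p)]).
Proof.
clear k_dvd_top z_range z_sorted z_size; move=> tk; elim: p => [|q IH] /= pl; first by rewrite subn0; apply: z_sub.
have {IH} := IH (ltnW pl).
have -> : ell - q = (ell - q.+1).+1 by lia.
set hs := [seq bit t q | q <- iota q.+1 _]; rewrite /= -/hs.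
have subE b a n : b t = false ->
    subseq [seq v <- iota a n | b (v %% k)] (lev k t false a n).
  move=> bt; rewrite subseq_filter filter_subseq andbT; apply/allP => v.
  by rewrite mem_filter => /andP[+ _]; apply: contraTneq => ->; rewrite bt.
have subF b a n : subseq [seq v <- iota a n | b (v %% k)] (lev k t true a n).
  by rewrite /lev filter_predT filter_subseq.
case E: (bit t q) => IH.
- apply: subseq_trans (suffix_subseq _ _); apply: subseq_trans (suffix_subseq _ _).
  apply: subseq_trans (suffix_subseq _ _).
  apply: cat_subseq; first exact: (subF (fun x => bit x q)).
  apply: cat_subseq => //.
  by apply: (subE (fun x => ~~ bit x q)); rewrite E.
- apply: cat_subseq; first exact: (subE (fun x => bit x q)).
  apply: cat_subseq => //.
  apply: subseq_trans (prefix_subseq _ _).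
  exact: (subF (fun x => ~~ bit x q)).
Qed.

End Witness.

(** Only [k] choices are made, so induction suffices and no choice axiom enters. *)
Lemma finite_choice (T : Type) (x0 : T) (P : nat -> T -> Prop) k :
  (forall t, t < k -> exists x, P t x) -> exists F, forall t, t < k -> P t (F t).
Proof.
elim: k => [|k IH] H; first by exists (fun=> x0).
have [|F HF] := IH; first by move=> t tk; apply: H; apply: ltnW.
have [x Hx] := H k (ltnSn k).
exists (fun t => if t == k then x else F t) => t; case: eqP => [-> //|/eqP tk].
by rewrite ltnS leq_eqVlt (negbTE tk) /=; apply: HF.
Qed.

(** * The instance: size, validity, correctness *)

Definition lcis_instance (k ell : nat) (f : cnf) : seq (seq nat) :=
  [seq lcis_seq k ell f t | t <- iota 0 k].

Lemma size_gadget k t sat base f : size (gadget k t sat base f) <= k * size f.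
Proof.
elim: f base => //= cl f IH base; rewrite size_cat mulnS leq_add // size_filter.
by apply: leq_trans (count_size _ _) _; rewrite size_rev size_iota.
Qed.

(** One level down there are twice as many nodes with runs half as long, so every level contributes
    [2 ^ p * (2 * (k * c))]; the length is [2 ^ p] up to a factor linear in [p]. *)
Lemma size_sep k c top g t G p hs : (forall bs, size (g bs) <= G) ->
  size (sep k c top g t p hs) <= 2 ^ p * (G + p * (2 * (k * c))).
Proof.
move=> HG; elim: p hs => [|q IH] hs /=; first by rewrite addn0 mul1n.
have L full a n : size (lev k t full a n) <= n.
  by rewrite size_filter; apply: leq_trans (count_size _ _) _; rewrite size_iota.
rewrite !size_cat expnS mulSn.
have := IH (false :: hs); have := IH (true :: hs).
move: (2 ^ q) L => x L.
have := L false (top - (k * (c * x)).*2) (k * (c * x)).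
have := L true (top - (k * (c * x)).*2) (k * (c * x)).
have := L false (top + (k * (c * x))) (k * (c * x)).
have := L true (top + (k * (c * x))) (k * (c * x)).
have -> : 2 * x * (G + (2 * (k * c) + q * (2 * (k * c))))
  = 2 * (x * (G + q * (2 * (k * c)))) + 4 * (k * (c * x)) by lia.
clear; lia.
Qed.

Lemma size_lcis_seq k ell f t :
  size (lcis_seq k ell f t) <= 2 ^ ell * (k * size f * (1 + 2 * k * ell)).
Proof.
apply: leq_trans.
  by apply: size_sep => bs; apply: size_gadget.
by rewrite leq_mul2l; apply/orP; right; lia.
Qed.

Section Correctness.

Variables (k ell d N : nat) (f : cnf).
Hypotheses (k_ge3 : 3 <= k) (ell_gt0 : 0 < ell) (N_le : N <= k * ell).
Hypothesis f_dcnf : is_dcnf d N f.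

Let k_gt0 : 0 < k. Proof. exact: leq_trans k_ge3. Qed.
Let c := k * size f.
Let top := k * (c * 2 ^ ell).
Let gad t bs := gadget k t (csat ell t bs) top f.
Let k_dvd_top : k %| top. Proof. exact: dvdn_mulr. Qed.

Lemma gad_mid t bs : all (mid k c top) (gad t bs).
Proof.
apply/allP => v /gadget_range /andP[H1 H2]; rewrite /mid H1 /=.
by apply: leq_trans H2 _; rewrite leq_add2l leq_pmull.
Qed.

Lemma lcis_instance_valid : LCIS_instance k (lcis_instance k ell f).
Proof.
split; first by rewrite size_map size_iota.
rewrite all_map; apply/allP => t; rewrite mem_iota => /andP[_ tk].
apply/allP => v vX.
have := sep_range k_gt0 (gad_mid t) (leqnn _) vX => -[+ _]; rewrite -/top => vr.
(* The two full runs of the outermost level have length [top / 2] each, whereas all symbols are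
   below [2 * top]. *)
have : top <= max_len (lcis_instance k ell f).
  rewrite /max_len /lcis_instance big_map.
  apply: leq_trans (leq_bigmax_seq _ _ isT); last by rewrite mem_iota; apply: tk.
  rewrite /lcis_seq /top -/c; case: (ell) ell_gt0 => // q _ /=; rewrite !size_cat expnS.
  rewrite /lev /= !filter_predT !size_iota; clear; lia.
move=> H; apply: (@leq_trans (2 * top)); first by move: vr; clear; lia.
by apply: leq_mul => //; apply: leq_trans k_ge3.
Qed.

Lemma lcis_complete L :
  is_LCIS_length (lcis_instance k ell f) L -> satisfiable f -> threshold k ell f <= L.
Proof.
move=> [_ HL] [a Ha].
have Hs := bits_sat ell_gt0 N_le f_dcnf Ha.
have [w1 w2 w3] := witness_midP k_gt0 k_dvd_top Hs.
set z := witness_mid _ _ _ _ in w1 w2 w3.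
have zr : {in z, forall v, top <= v < top + k * c}.
  by move=> v /(mem_subseq (w3 _ k_gt0)) vg; move/allP: (gad_mid 0 (bits_of ell a 0)); apply.
have W1 := size_witness (fun t q => a (t * ell + q)) k_gt0 k_dvd_top w2 (leqnn top).
have [W2 _] := sorted_witness (fun t q => a (t * ell + q)) k_gt0 w1 zr (leqnn top).
rewrite /threshold -/c -W1; apply: HL; split=> //.
rewrite all_map; apply/allP => t; rewrite mem_iota => /andP[_ tk] /=.
have := subseq_witness c top k_gt0 (g := gad) w3 tk (leqnn ell).
by rewrite subnn.
Qed.

(** Count by classes: each class gives at most [c * (2 ^ ell).-1] separators, and the gadgets give
    at most [c] symbols. One class without a singled-out leaf costs another [c], which leaves the
    total below the threshold by at least [size f]. *)
Lemma lcis_sound L :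
  is_LCIS_length (lcis_instance k ell f) L -> threshold k ell f <= L -> satisfiable f.
Proof.
move=> [[Z [[sZ HZ] <-]] _]; rewrite /threshold -/c => HL.
have [f0|f_gt0] := posnP (size f).
  by exists (fun=> true); rewrite (size0nil f0).
have {}HZ t : t < k -> subseq Z (lcis_seq k ell f t).
  by move=> tk; move: HZ; rewrite all_map => /allP/(_ t); rewrite mem_iota; apply.
(* Gadget symbols of all classes are kept, so that the leaves found for different [t] contain the
   same sequence. *)
pose cls t := [seq v <- Z | (v %% k == t) || mid k c top v].
have n_cls t : count (predC (mid k c top)) (cls t)
    = count (fun v => (v %% k == t) && predC (mid k c top) v) Z.
  rewrite count_filter; apply: eq_count => v /=.
  by case: (mid k c top v); case: (v %% k == t).
have m_cls t : filter (mid k c top) (cls t) = filter (mid k c top) Z.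
  by rewrite -filter_predI; apply: eq_filter => v /=; case: (mid k c top v); rewrite ?orbT.
have B t : t < k -> count (predC (mid k c top)) (cls t) + c <= c * 2 ^ ell /\
    (count (predC (mid k c top)) (cls t) + c.*2 <= c * 2 ^ ell \/
     exists bs, size bs = ell /\ subseq (filter (mid k c top) Z) (gad t bs)).
  move=> tk.
  have sc : sorted ltn (cls t) by apply: sorted_filter sZ; apply: ltn_trans.
  have ss : subseq (cls t) (class_sep k c top t (gad t) ell [::]).
    rewrite -(filter_sep t k_gt0 (gad_mid t)) ?leqnn //.
    by rewrite subseq_filter filter_all (subseq_trans (filter_subseq _ _) (HZ t tk)).
  have [L1 L2] := class_sep_bound k_gt0 tk k_dvd_top (gad_mid t) (leqnn top) sc ss.
  split=> //; case: L2 => [|[bs [s1 s2]]]; first by left.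
  by right; exists bs; rewrite -{1}(m_cls t) -[bs]cats0; split=> //; rewrite cats0.
(* Gadget symbols lie in [[top, top + c)], and an increasing sequence takes each value at most
   once. *)
have n_mid : count (mid k c top) Z <= c.
  rewrite -size_filter; apply: (@leq_trans (size (iota top c))); last by rewrite size_iota.
  apply: uniq_leq_size.
    by apply/filter_uniq/(sorted_uniq ltn_trans ltnn).
  move=> v; rewrite mem_filter mem_iota => /andP[vm vZ].
  have vX := mem_subseq (HZ 0 k_gt0) vZ.
  have [_ /(_ vm) [bs /gadget_range]] := sep_range k_gt0 (gad_mid 0) (leqnn _) vX.
  by rewrite -/c.
have sizeZ : size Z = \sum_(t < k) count (predC (mid k c top)) (cls t) + count (mid k c top) Z.
  rewrite -(count_predC (mid k c top)) addnC; congr addn.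
  by rewrite (@sum_count_class k) //; apply: eq_bigr => t _; rewrite n_cls.
have c2 : c * (2 ^ ell).-1 + c = c * 2 ^ ell by rewrite -mulnSr prednK // expn_gt0.
have sum_const : \sum_(t < k) c * (2 ^ ell).-1 = k * (c * (2 ^ ell).-1).
  by rewrite sum_nat_const card_ord.
have B1 t : t < k -> count (predC (mid k c top)) (cls t) <= c * (2 ^ ell).-1.
  by move=> /B[H _]; rewrite -(leq_add2r c) c2.
have all_good t : t < k -> exists bs, subseq (filter (mid k c top) Z) (gad t bs).
  move=> tk; case: (B t tk) => _ [H|[bs [_ ?]]]; last by exists bs.
  exfalso; move: HL; rewrite sizeZ -sum_const !(bigD1 (Ordinal tk) isT) /=.
  have := @leq_sum _ (index_enum 'I_k) (fun i => i != Ordinal tk)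
    (fun t => count (predC (mid k c top)) (cls t)) (fun=> c * (2 ^ ell).-1)
    (fun i _ => B1 i (ltn_ord i)).
  rewrite /=; move: H n_mid f_gt0; rewrite -c2; move: (\sum_(i < k | _) _) (\sum_(i < k | _) _). clear; lia.
have [bs Hbs] := finite_choice [::] all_good.
have sm : sorted ltn (filter (mid k c top) Z) by apply: sorted_filter sZ; apply: ltn_trans.
have U := gadget_upper k_gt0 (sat := fun t => csat ell t (bs t)) k_dvd_top sm Hbs.
apply: (sat_bits (k := k) (bs := bs) ell_gt0).
(* The separators supply no more than their share of the threshold, so the gadgets supply [size f]
   symbols, one for every clause. *)
rewrite all_count eqn_leq count_size /=; move: HL U; rewrite sizeZ size_filter.
have : \sum_(t < k) count (predC (mid k c top)) (cls t) <= \sum_(t < k) c * (2 ^ ell).-1.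
  by apply: leq_sum => i _; apply: B1.
rewrite sum_const; clear; lia.
Qed.

End Correctness.

(** * A structured language over the RAM *)

Inductive cmd : Type :=
| Skip
| Atom of instr
| Seq of cmd & cmd
| If of nat & cmd & cmd
| While of nat & cmd.

Definition cseq (cs : seq cmd) : cmd := foldr Seq Skip cs.
Definition atoms (is_ : seq instr) : cmd := cseq (map Atom is_).

Fixpoint csize (c : cmd) : nat :=
  match c with
  | Skip => 0
  | Atom _ => 1
  | Seq c1 c2 => csize c1 + csize c2
  | If _ c1 c2 => csize c1 + csize c2 + 2
  | While _ c => csize c + 2
  end.

(* Register 0 holds 0 while compiled code runs, so that [JZ 0 _] is an unconditional jump. *)
Fixpoint compile (o : nat) (c : cmd) : program :=
  match c with
  | Skip => [::]
  | Atom i => [:: i]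
  | Seq c1 c2 => compile o c1 ++ compile (o + csize c1) c2
  | If x c1 c2 =>
      JZ x (o + csize c1 + 2) :: compile o.+1 c1
        ++ JZ 0 (o + csize c1 + 2 + csize c2) :: compile (o + csize c1 + 2) c2
  | While x c => JZ x (o + csize c + 2) :: compile o.+1 c ++ [:: JZ 0 o]
  end.

Definition aexec (i : instr) (r : regs) : regs :=
  match i with
  | CONST i c => upd r i c
  | ADD i j l => upd r i (r j + r l)
  | SUB i j l => upd r i (r j - r l)
  | LOAD i j => upd r i (r (r j))
  | STORE i j => upd r (r i) (r j)
  | _ => r
  end.

(* Registers below [nscal] are addressed statically; [STORE] only reaches those above. *)
Notation nscal := 32.

Definition aok (Bd : nat) (i : instr) (r : regs) : bool :=
  match i with
  | CONST _ c => c <= Bd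
  | ADD _ j l => r j + r l <= Bd
  | STORE i _ => nscal <= r i
  | JZ _ _ | HALT => false
  | _ => true
  end.

Definition ascal (i : instr) : bool :=
  match i with
  | CONST i _ => i < nscal
  | ADD i j l | SUB i j l => (i < nscal) && (j < nscal) && (l < nscal)
  | LOAD i j | STORE i j => (i < nscal) && (j < nscal)
  | JZ _ _ | HALT => false
  end.

(** Unlike [ascal], this excludes 0 as a target: compiled code relies on register 0 staying 0,
    whereas the prelude writes to it. *)
Definition awf (i : instr) : bool :=
  match i with
  | CONST i _ => 0 < i < nscal
  | ADD i j l | SUB i j l => (0 < i < nscal) && (j < nscal) && (l < nscal)
  | LOAD i j => (0 < i < nscal) && (j < nscal)
  | STORE i j => (i < nscal) && (j < nscal)
  | JZ _ _ | HALT => false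
  end.

Definition awrites (i : instr) (x : nat) : bool :=
  match i with
  | CONST i _ | ADD i _ _ | SUB i _ _ | LOAD i _ => x == i
  | _ => false
  end.

Fixpoint wf (c : cmd) : bool :=
  match c with
  | Skip => true
  | Atom i => awf i
  | Seq c1 c2 => wf c1 && wf c2
  | If x c1 c2 => (x < nscal) && wf c1 && wf c2
  | While x c => (x < nscal) && wf c
  end.

Fixpoint writes (c : cmd) (x : nat) : bool :=
  match c with
  | Skip => false
  | Atom i => awrites i x
  | Seq c1 c2 | If _ c1 c2 => writes c1 x || writes c2 x
  | While _ c => writes c x
  end.

(** [Bd] bounds all computed values, so that it is enough to count instructions. The count includes
    the jumps inserted by [compile]: two around a first branch or a loop body, one otherwise. *)
Inductive ev (Bd : nat) : cmd -> regs -> regs -> nat -> Prop :=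
| ev_skip r : ev Bd Skip r r 0
| ev_atom i r : aok Bd i r -> ev Bd (Atom i) r (aexec i r) 1
| ev_seq c1 c2 r r1 r2 n1 n2 :
    ev Bd c1 r r1 n1 -> ev Bd c2 r1 r2 n2 -> ev Bd (Seq c1 c2) r r2 (n1 + n2)
| ev_ift x c1 c2 r r' n :
    r x != 0 -> ev Bd c1 r r' n -> ev Bd (If x c1 c2) r r' n.+2
| ev_iff x c1 c2 r r' n :
    r x = 0 -> ev Bd c2 r r' n -> ev Bd (If x c1 c2) r r' n.+1
| ev_while0 x c r : r x = 0 -> ev Bd (While x c) r r 1
| ev_whileS x c r r1 r2 n1 n2 :
    r x != 0 -> ev Bd c r r1 n1 -> ev Bd (While x c) r1 r2 n2 ->
    ev Bd (While x c) r r2 (n1.+2 + n2).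

(** * Compiled code follows the semantics *)

Inductive star (P : program) : nat -> regs -> nat -> nat -> regs -> Prop :=
| star_refl pc r : star P pc r 0 pc r
| star_step pc r pc1 r1 c1 pc2 r2 c2 :
    step P pc r = Some (pc1, r1, c1) -> star P pc1 r1 c2 pc2 r2 ->
    star P pc r (c1 + c2) pc2 r2.

Lemma star_trans P pc r c1 pc1 r1 c2 pc2 r2 :
  star P pc r c1 pc1 r1 -> star P pc1 r1 c2 pc2 r2 -> star P pc r (c1 + c2) pc2 r2.
Proof.
elim=> [//|pc' r' pc1' r1' d1 pc2' r2' d2 S _ IH] /IH H.
by rewrite -addnA; apply: star_step H.
Qed.

Lemma star1 P pc r pc1 r1 c1 :
  step P pc r = Some (pc1, r1, c1) -> star P pc r c1 pc1 r1.
Proof. by move=> H; rewrite -[c1]addn0; apply: star_step H (star_refl _ _ _). Qed.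

Lemma star_exec P pc r c pc' r' acc : step P pc' r' = None ->
  star P pc r c pc' r' -> exists fuel, exec P fuel pc r acc = Some (r', acc + c).
Proof.
move=> H S; elim: S acc H => [pc0 r0|pc0 r0 pc1 r1 c1 pc2 r2 c2 S _ IH] acc H.
  by exists 0; rewrite /= H addn0.
by have [fuel E] := IH (acc + c1) H; exists fuel.+1; rewrite /= S E addnA.
Qed.

Definition code_at (P : program) (o : nat) (code : program) : Prop :=
  exists pre post, P = pre ++ code ++ post /\ size pre = o.

Lemma code_at_cat P o c1 c2 :
  code_at P o (c1 ++ c2) -> code_at P o c1 /\ code_at P (o + size c1) c2.
Proof.
case=> pre [post [-> So]]; split.
  by exists pre, (c2 ++ post); rewrite -catA.
by exists (pre ++ c1), post; rewrite size_cat So -!catA.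
Qed.

Lemma code_at_cons P o i c :
  code_at P o (i :: c) -> code_at P o [:: i] /\ code_at P o.+1 c.
Proof. by rewrite -cat1s => /code_at_cat; rewrite addn1. Qed.

Lemma code_at_nth P o i : code_at P o [:: i] -> o < size P /\ nth HALT P o = i.
Proof.
case=> pre [post [-> <-]]; rewrite size_cat /= nth_cat ltnn subnn; split=> //; lia.
Qed.

Lemma size_compile o c : size (compile o c) = csize c.
Proof.
elim: c o => //= [c1 IH1 c2 IH2|x c1 IH1 c2 IH2|x c IH] o;
  by rewrite ?size_cat /= ?size_cat ?IH1 ?IH2 ?IH /=; lia.
Qed.

Lemma leq_bitlen a b : a <= b -> bitlen a <= bitlen b.
Proof. by move=> H; rewrite /bitlen; have := Nat.log2_le_mono a b; lia. Qed.

Lemma bitlen_scal i : i < nscal -> bitlen i <= 5.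
Proof. by move=> H; apply: (@leq_trans (bitlen 31)) => //; apply: leq_bitlen. Qed.

Definition acost (i : instr) (r : regs) : nat :=
  match i with
  | CONST i c => 1 + bitlen i + bitlen c
  | ADD i j l | SUB i j l =>
      1 + bitlen i + bitlen j + bitlen l + bitlen (r j) + bitlen (r l)
  | LOAD i j => 1 + bitlen i + bitlen j + bitlen (r j) + bitlen (r (r j))
  | STORE i j => 1 + bitlen i + bitlen (r i) + bitlen j + bitlen (r j)
  | _ => 0
  end.

(** One unit for the instruction, at most three static addresses of 5 bits, and two values or
    computed addresses bounded by [Bd]. *)
Definition tau (Bd : nat) : nat := 16 + 2 * bitlen Bd.

Section CompileCorrect.

Variable Bd : nat.

Lemma aexec_bounded i r : aok Bd i r -> (forall a, r a <= Bd) ->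
  forall a, aexec i r a <= Bd.
Proof.
case: i => [i c|i j l|i j l|i j|i j|i t|] //= H Hr a; rewrite /upd; case: eqP => // _.
by apply: leq_trans (leq_subr _ _) (Hr j).
Qed.

Lemma ev_bounded c r r' n : ev Bd c r r' n -> (forall a, r a <= Bd) ->
  forall a, r' a <= Bd.
Proof.
elim=> // {c r r' n}.
- exact: aexec_bounded.
- by move=> c1 c2 r r1 r2 n1 n2 _ IH1 _ IH2 /IH1.
- by move=> x c r r1 r2 n1 n2 _ _ IH1 _ IH2 /IH1.
Qed.

Lemma ev_frame c r r' n i : ev Bd c r r' n -> i < nscal -> ~~ writes c i -> r' i = r i.
Proof.
move=> E i32; elim: E => //= {c r r' n}.
- case=> [j c|j a b|j a b|j a|j a|j t|] r //= H; rewrite /upd; case: eqP => //.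
  by move=> E; move: H; rewrite -E; lia.
- by move=> c1 c2 r r1 r2 n1 n2 _ IH1 _ IH2 /norP[/IH1 <- /IH2 <-].
- by move=> x c1 c2 r r1 n _ _ IH /norP[/IH <- _].
- by move=> x c1 c2 r r1 n _ _ IH /norP[_ /IH <-].
- by move=> x c r r1 r2 n1 n2 _ _ IH1 _ IH2 H; rewrite IH2 // IH1.
Qed.

Lemma acost_le i r : ascal i -> (forall a, r a <= Bd) -> aok Bd i r -> acost i r <= tau Bd.
Proof.
move=> W Hr Ha; rewrite /tau.
have L a : bitlen (r a) <= bitlen Bd by exact: leq_bitlen.
case: i W Ha => [i c|i j l|i j l|i j|i j|//|//] /= W Ha.
- move/bitlen_scal: W; move: (leq_bitlen Ha); clear; lia.
- case/andP: W => /andP[/bitlen_scal Wi /bitlen_scal Wj] /bitlen_scal.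
  move: (L j) (L l) Wi Wj; clear; lia.
- case/andP: W => /andP[/bitlen_scal Wi /bitlen_scal Wj] /bitlen_scal.
  move: (L j) (L l) Wi Wj; clear; lia.
- case/andP: W => /bitlen_scal Wi /bitlen_scal.
  move: (L j) (L (r j)) Wi; clear; lia.
- case/andP: W => /bitlen_scal Wi /bitlen_scal.
  move: (L j) (L i) Wi; clear; lia.
Qed.

Lemma awf_scal i : awf i -> ascal i.
Proof.
case: i => //= i.
- by move=> _ /andP[].
- by move=> j l /andP[/andP[/andP[_ -> ->] ->]].
- by move=> j l /andP[/andP[/andP[_ -> ->] ->]].
- by move=> j /andP[/andP[_ -> ->]].
Qed.

Lemma step_atom P o i r : code_at P o [:: i] -> awf i -> (forall a, r a <= Bd) ->
  aok Bd i r -> exists c, c <= tau Bd /\ step P o r = Some (o.+1, aexec i r, c).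
Proof.
move=> /code_at_nth[o1 o2] W Hr Ha; exists (acost i r).
split; first exact: acost_le (awf_scal W) Hr Ha.
by rewrite /step leqNgt o1 /= o2; case: i W {o2 Ha}.
Qed.

Lemma step_JZ P o x t r : code_at P o [:: JZ x t] -> x < nscal -> (forall a, r a <= Bd) ->
  exists c, c <= tau Bd /\ step P o r = Some (if r x == 0 then t else o.+1, r, c).
Proof.
move=> /code_at_nth[o1 o2] W Hr; rewrite /step leqNgt o1 /= o2 /tau.
eexists; split; last by [].
move: (bitlen_scal W) (leq_bitlen (Hr x)); clear; lia.
Qed.

Lemma compile_correct P c r r' n o : ev Bd c r r' n -> wf c ->
  (forall a, r a <= Bd) -> r 0 = 0 -> code_at P o (compile o c) ->
  exists cost, cost <= n * tau Bd /\ star P o r cost (o + csize c) r'.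
Proof.
(* This keeps [JZ 0] an unconditional jump throughout. *)
have wf0 d : wf d -> ~~ writes d 0.
  elim: d => //= [[]//=|d1 IH1 d2 IH2|x d1 IH1 d2 IH2|x d IH].
  - by case=> // i _ /andP[].
  - by case=> // i _ _ /andP[/andP[/andP[]]].
  - by case=> // i _ _ /andP[/andP[/andP[]]].
  - by case=> // i _ /andP[/andP[]].
  - by case/andP => /IH1 /negbTE -> /IH2 /negbTE ->.
  - by case/andP => /andP[_ /IH1 /negbTE ->] /IH2 /negbTE ->.
  - by case/andP => _ /IH.
move=> E; elim: E o => {c r r' n} /=.
- by move=> r o _ _ _ _; exists 0; rewrite addn0; split=> //; apply: star_refl.
- move=> i r Ha o W Hr _ C; have [c [Hc /star1 S]] := step_atom C W Hr Ha.
  by exists c; rewrite mul1n addn1.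
- move=> c1 c2 r r1 r2 n1 n2 E1 IH1 E2 IH2 o /andP[W1 W2] Hr r0 /code_at_cat[C1].
  rewrite size_compile => C2.
  have [d1 [H1 S1]] := IH1 _ W1 Hr r0 C1.
  have r10 : r1 0 = 0 by rewrite (ev_frame E1) // wf0.
  have [d2 [H2 S2]] := IH2 _ W2 (ev_bounded E1 Hr) r10 C2.
  exists (d1 + d2); rewrite addnA mulnDl leq_add //; split=> //.
  exact: star_trans S1 S2.
- move=> x c1 c2 r r' n rx E IH o /andP[/andP[Wx W1] W2] Hr r0.
  move=> /code_at_cons[/step_JZ/(_ Wx Hr)[c0 [Hc0 J0]]].
  move=> /code_at_cat[C1]; rewrite size_compile => /code_at_cons[C2 _].
  have [d1 [H1 S1]] := IH _ W1 Hr r0 C1.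
  have r10 : r' 0 = 0 by rewrite (ev_frame E) // wf0.
  have [c3 [Hc3 J3]] := step_JZ C2 isT (ev_bounded E Hr).
  rewrite (negbTE rx) in J0; rewrite r10 eqxx in J3.
  exists (c0 + (d1 + c3)); split; first by rewrite -[n.+2]addn2 mulnDl; lia.
  apply: star_step J0 _; apply: star_trans S1 _.
  have -> : o + (csize c1 + csize c2 + 2) = o + csize c1 + 2 + csize c2 by lia.
  exact: star1.
- move=> x c1 c2 r r' n rx E IH o /andP[/andP[Wx W1] W2] Hr r0.
  move=> /code_at_cons[/step_JZ/(_ Wx Hr)[c0 [Hc0 J0]]].
  move=> /code_at_cat[_]; rewrite size_compile => /code_at_cons[_ C2].
  have eo : (o.+1 + csize c1).+1 = o + csize c1 + 2 by lia.
  rewrite eo in C2; have [d1 [H1 S1]] := IH _ W2 Hr r0 C2.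
  rewrite rx eqxx in J0.
  exists (c0 + d1); split; first by rewrite -[n.+1]addn1 mulnDl; lia.
  have -> : o + (csize c1 + csize c2 + 2) = o + csize c1 + 2 + csize c2 by lia.
  exact: star_step J0 _.
- move=> x c r rx o /andP[Wx W] Hr r0 /code_at_cons[/step_JZ/(_ Wx Hr)[c0 [Hc0 J0]] _].
  exists c0; split; first by lia.
  by rewrite rx eqxx in J0; apply: star1; rewrite J0 addnA.
- move=> x c r r1 r2 n1 n2 rx E1 IH1 E2 IH2 o W Hr r0 C.
  have /andP[Wx W1] := W; have := C.
  move=> /code_at_cons[/step_JZ/(_ Wx Hr)[c0 [Hc0 J0]]].
  move=> /code_at_cat[C1]; rewrite size_compile => C2.
  have [d1 [H1 S1]] := IH1 _ W1 Hr r0 C1.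
  have r10 : r1 0 = 0 by rewrite (ev_frame E1) // wf0.
  have [c3 [Hc3 J3]] := step_JZ C2 isT (ev_bounded E1 Hr).
  have [d2 [H2 S2]] := IH2 _ W (ev_bounded E1 Hr) r10 C.
  rewrite (negbTE rx) in J0; rewrite r10 eqxx in J3.
  exists (c0 + (d1 + (c3 + d2))); split; first by rewrite -[n1.+2]addn2 !mulnDl; lia.
  apply: star_step J0 _; apply: star_trans S1 _; exact: star_step J3 _.
Qed.

End CompileCorrect.

(** * Total-correctness rules with step counts *)

Definition wp (Bd : nat) (c : cmd) (Q : regs -> nat -> Prop) (r : regs) : Prop :=
  exists r' n, ev Bd c r r' n /\ Q r' n.

Section WeakestPrecondition.

Variable Bd : nat.
Implicit Types (Q : regs -> nat -> Prop) (r : regs).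

Lemma wp_skip Q r : Q r 0 -> wp Bd Skip Q r.
Proof. by move=> H; exists r, 0; split=> //; apply: ev_skip. Qed.

Lemma wp_atom i Q r : aok Bd i r -> Q (aexec i r) 1 -> wp Bd (Atom i) Q r.
Proof. by move=> H1 H2; exists (aexec i r), 1; split=> //; apply: ev_atom. Qed.

Lemma wp_seq c1 c2 Q r :
  wp Bd c1 (fun r1 n1 => wp Bd c2 (fun r2 n2 => Q r2 (n1 + n2)) r1) r ->
  wp Bd (Seq c1 c2) Q r.
Proof.
case=> r1 [n1 [E1 [r2 [n2 [E2 H]]]]]; exists r2, (n1 + n2); split=> //.
exact: ev_seq E1 E2.
Qed.

(** Each use also hands over the frame, so specifications can be silent about static registers that
    a fragment leaves alone. *)
Lemma wp_conseq c Q Q' r : wp Bd c Q r ->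
  (forall r' n, (forall i, i < nscal -> ~~ writes c i -> r' i = r i) ->
     Q r' n -> Q' r' n) -> wp Bd c Q' r.
Proof.
case=> r' [n [E HQ]] H; exists r', n; split=> //; apply: H => // i i32 W.
exact: ev_frame E i32 W.
Qed.

Lemma wp_if x c1 c2 Q r :
  (r x != 0 -> wp Bd c1 (fun r' n => Q r' n.+2) r) ->
  (r x = 0 -> wp Bd c2 (fun r' n => Q r' n.+1) r) -> wp Bd (If x c1 c2) Q r.
Proof.
move=> H1 H2; case: (eqVneq (r x) 0) => [rx|rx].
  by have [r' [n [E HQ]]] := H2 rx; exists r', n.+1; split=> //; apply: ev_iff.
by have [r' [n [E HQ]]] := H1 rx; exists r', n.+2; split=> //; apply: ev_ift.
Qed.

(* [Inv j r a]: [j] iterations remain and [a] steps have been spent so far. *)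
Lemma wp_while x c (Inv : nat -> regs -> nat -> Prop) n Q r :
  (forall j r a, j < n -> Inv j.+1 r a ->
     r x != 0 /\ wp Bd c (fun r' m => Inv j r' (a + m.+2)) r) ->
  (forall r a, Inv 0 r a -> r x = 0) ->
  Inv n r 0 -> (forall r' m, Inv 0 r' m -> Q r' m.+1) -> wp Bd (While x c) Q r.
Proof.
move=> HS H0 HI HQ.
have {HI HQ} [a [HI HQ]] : exists a, Inv n r a /\ forall r' m, Inv 0 r' (a + m) -> Q r' m.+1.
  by exists 0; split.
elim: n a r Q HS HI HQ => [|n IH] a r Q HS HI HQ.
  exists r, 1; split; first by apply/ev_while0/H0/HI.
  by apply: HQ; rewrite addn0.
have [rx [r1 [n1 [E1 HI1]]]] := HS n r a (ltnSn n) HI.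
have HS' j r' a' : j < n -> Inv j.+1 r' a' ->
    r' x != 0 /\ wp Bd c (fun r'' m => Inv j r'' (a' + m.+2)) r'.
  by move=> jn; apply: HS; apply: ltnW.
have [r' m H|r2 [n2 [E2 HQ2]]] := IH (a + n1.+2) r1 (fun r' m => Q r' (n1.+2 + m)) HS' HI1.
  by rewrite addnS; apply: HQ; rewrite addnA.
by exists r2, (n1.+2 + n2); split=> //; apply: ev_whileS E1 E2.
Qed.

(** An unfinished run of a loop. Such runs concatenate, which lets the loop over the assignments be
    treated by induction on the binary tree instead of through a counting invariant. *)
Inductive iters (x : nat) (c : cmd) : nat -> regs -> regs -> Prop :=
| iters_nil r : iters x c 0 r r
| iters_cons r r1 r2 n1 n2 : r x != 0 -> ev Bd c r r1 n1 -> iters x c n2 r1 r2 ->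
    iters x c (n1.+2 + n2) r r2.

Lemma iters_cat x c a b r r1 r2 :
  iters x c a r r1 -> iters x c b r1 r2 -> iters x c (a + b) r r2.
Proof.
elim=> // {a}r' r1' r2' n1 n2 rx E _ IH /IH H.
by rewrite -addnA; apply: iters_cons H.
Qed.

Lemma iters_while x c a r r1 Q :
  iters x c a r r1 -> wp Bd (While x c) (fun r' n => Q r' (a + n)) r1 ->
  wp Bd (While x c) Q r.
Proof.
move=> I; elim: I Q => {a r r1} [//|r r1 r2 n1 n2 rx E _ IH] Q H.
have [|r3 [n3 [E3 HQ]]] := IH (fun r' n => Q r' (n1.+2 + n)).
  case: H => r' [n [H1 H2]]; exists r', n; split=> //; by rewrite addnA.
by exists r3, (n1.+2 + n3); split=> //; apply: ev_whileS E E3.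
Qed.

End WeakestPrecondition.

(** * Straight-line code and bit lengths *)

Definition is_atom (i : instr) : bool :=
  match i with JZ _ _ | HALT => false | _ => true end.

Definition run_atoms (is_ : seq instr) (r : regs) : regs := foldl (fun r i => aexec i r) r is_.

Fixpoint atoms_cost (is_ : seq instr) (r : regs) : nat :=
  if is_ is i :: is' then acost i r + atoms_cost is' (aexec i r) else 0.

Lemma star_atoms P o is_ r : code_at P o is_ -> all is_atom is_ ->
  star P o r (atoms_cost is_ r) (o + size is_) (run_atoms is_ r).
Proof.
elim: is_ o r => [|i is_ IH] o r /=; first by rewrite addn0 => _ _; apply: star_refl.
move=> /code_at_cons[/code_at_nth[o1 o2] C] /andP[A As].
rewrite addnS -addSn; apply: star_step (IH _ _ C As).
by rewrite /step leqNgt o1 /= o2; case: i A {o2 C}.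
Qed.

Fixpoint aoks (Bd : nat) (is_ : seq instr) (r : regs) : bool :=
  if is_ is i :: is' then aok Bd i r && aoks Bd is' (aexec i r) else true.

Lemma aoks_cat Bd is1 is2 r :
  aoks Bd (is1 ++ is2) r = aoks Bd is1 r && aoks Bd is2 (run_atoms is1 r).
Proof. by elim: is1 r => //= i is1 IH r; rewrite IH andbA. Qed.

Lemma run_atoms_cat is1 is2 r : run_atoms (is1 ++ is2) r = run_atoms is2 (run_atoms is1 r).
Proof. exact: foldl_cat. Qed.

Lemma atoms_cost_le Bd is_ r : all ascal is_ -> aoks Bd is_ r -> (forall a, r a <= Bd) ->
  atoms_cost is_ r <= size is_ * tau Bd /\ forall a, run_atoms is_ r a <= Bd.
Proof.
elim: is_ r => [|i is_ IH] r //= /andP[W Ws] /andP[Ha Has] Hr.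
have [H1 H2] := IH _ Ws Has (aexec_bounded Ha Hr).
by split=> //; rewrite mulSn leq_add // acost_le.
Qed.

Lemma bitlen_le x e : 0 < e -> x < 2 ^ e -> bitlen x <= e.
Proof.
move=> e0 xe; rewrite /bitlen; case: x xe => [|x] xe; first by rewrite /=.
have /Nat.log2_lt_pow2 H : (0 < x.+1)%coq_nat by lia.
suff : (Nat.log2 x.+1 < e)%coq_nat by lia.
apply/H; suff -> : Nat.pow 2 e = 2 ^ e by lia.
by elim: (e) => // n IH; rewrite expnS /= IH; lia.
Qed.

Lemma ltn_bitlen x : x < 2 ^ bitlen x.
Proof.
have powE n : Nat.pow 2 n = 2 ^ n by elim: n => // n IH; rewrite expnS /= IH; lia.
rewrite /bitlen -powE; case: x => [|x]; first by rewrite powE.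
by have := Nat.log2_spec x.+1; lia.
Qed.

Lemma bitlen_add a b : bitlen (a + b) <= bitlen a + bitlen b.
Proof.
apply: bitlen_le => //; have := ltn_bitlen a; have := ltn_bitlen b.
rewrite expnD; rewrite /bitlen !expnS.
have := expn_gt0 2 (Nat.log2 a); have := expn_gt0 2 (Nat.log2 b).
move: (2 ^ _) (2 ^ _) => x y /=; nia.
Qed.

Lemma bitlen_sub a b : bitlen (a - b) <= bitlen a.
Proof. by apply: leq_bitlen; apply: leq_subr. Qed.

Arguments bitlen : simpl never.

(** * Simulation in a shifted memory *)

Section Simulation.

Variables (P Q : program) (o V : nat).

(* The registers of [P] live at addresses [V], [V + 1], ...; register 8 holds [V], and
   registers 16, 17, 18 are scratch. Each instruction of [P] becomes ten instructions. *)
Definition addr (i : nat) : seq instr := [:: CONST 16 i; ADD 16 16 8].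

(** Every target past the end stops [P]; all of them are sent to the end of the translated code. *)
Definition sim_target (t : nat) : nat := o + 10 * minn t (size P).

(** Ten is the length of the longest translations, those of [ADD] and [SUB]; padding to a common
    length makes jump targets linear in the source position. *)
Definition sim_instr (i : instr) : seq instr :=
  let code := match i with
    | CONST i c => CONST 17 c :: addr i ++ [:: STORE 16 17]
    | ADD i j l => addr j ++ LOAD 17 16 :: addr l ++ LOAD 18 16 :: ADD 17 17 18
                     :: addr i ++ [:: STORE 16 17]
    | SUB i j l => addr j ++ LOAD 17 16 :: addr l ++ LOAD 18 16 :: SUB 17 17 18
                     :: addr i ++ [:: STORE 16 17]
    | LOAD i j => addr j ++ [:: LOAD 17 16; ADD 17 17 8; LOAD 17 17]
                    ++ addr i ++ [:: STORE 16 17]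
    | STORE i j => addr j ++ LOAD 17 16 :: addr i
                     ++ [:: LOAD 16 16; ADD 16 16 8; STORE 16 17]
    | JZ i t => addr i ++ [:: LOAD 17 16; JZ 17 (sim_target t)]
    | HALT => [:: JZ 0 (sim_target (size P))]
    end in
  code ++ nseq (10 - size code) (CONST 16 0).

Definition sim_code : program := flatten [seq sim_instr i | i <- P].

Lemma size_sim_instr i : size (sim_instr i) = 10.
Proof. by case: i. Qed.

Lemma size_sim_code : size sim_code = 10 * size P.
Proof.
rewrite size_flatten /shape -map_comp (eq_map (_ : _ =1 fun=> 10)) //; last first.
  by move=> i; rewrite /= size_sim_instr.
by elim: (P) => //= i l ->; lia.
Qed.

Hypotheses (V_ge : nscal <= V) (Q_code : code_at Q o sim_code).

(** Register 27 is included because it holds the threshold for the final comparison. *)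
Definition sim_rel (s0 r s : regs) : Prop :=
  [/\ forall a, s (V + a) = r a, s 8 = V, s 0 = 0 & s 27 = s0 27].

Lemma sim_code_at pc : pc < size P -> code_at Q (o + 10 * pc) (sim_instr (nth HALT P pc)).
Proof.
case: Q_code => pre [post [-> <-]] pcP.
exists (pre ++ flatten [seq sim_instr i | i <- take pc P]),
  (flatten [seq sim_instr i | i <- drop pc.+1 P] ++ post); split.
  rewrite /sim_code -{1}(cat_take_drop pc P) (drop_nth HALT) //.
  by rewrite map_cat flatten_cat /= -!catA.
rewrite size_cat size_flatten /shape -map_comp (eq_map (_ : _ =1 fun=> 10)); last first.
  by move=> i; rewrite /= size_sim_instr.
congr addn; rewrite -[in RHS](_ : size (take pc P) = pc); last by rewrite size_take pcP.
by elim: (take pc P) => //= i l ->; lia.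
Qed.

Let VE a x : x < nscal -> (V + a == x) = false. Proof. lia. Qed.
Let VE' a x : x < nscal -> (x == V + a) = false. Proof. lia. Qed.
Let VA a : a + V = V + a. Proof. exact: addnC. Qed.

(** An address [V + i] costs at most [bitlen V] bits beyond those paid for [i]; both counts are
    positive, so the sum is at most a product, which adds up over a run. *)
Lemma leq_mul_bits v c x : 0 < v -> 0 < c -> x <= 150 + 50 * v + 50 * c -> x <= 250 * (v * c).
Proof. by move=> v0 c0 H; apply: leq_trans H _; nia. Qed.

Lemma sim_step s0 pc r pc' r' c s : step P pc r = Some (pc', r', c) -> sim_rel s0 r s ->
  exists s' c', [/\ star Q (sim_target pc) s c' (sim_target pc') s', sim_rel s0 r' s'
    & c' <= 250 * (bitlen V * c)].
Proof.
rewrite /step; case: leqP => // pcP.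
have := sim_code_at pcP.
have Epc : sim_target pc = o + 10 * pc by rewrite /sim_target (minn_idPl (ltnW pcP)).
have Epc1 : sim_target pc.+1 = o + 10 * pc + 10.
  by rewrite /sim_target (minn_idPl pcP) mulnS; lia.
have v0 : 0 < bitlen V by [].
have B0 : bitlen 0 = 1 by []. have B8 : bitlen 8 = 4 by []. have B16 : bitlen 16 = 5 by [].
have B17 : bitlen 17 = 5 by []. have B18 : bitlen 18 = 5 by [].
rewrite Epc; case: nth => [i x|i j l|i j l|i j|i j|i t|] // C [<- <- <-] [sV s8 s0E s27];
  rewrite ?Epc1.
- exists (run_atoms (sim_instr (CONST i x)) s), (atoms_cost (sim_instr (CONST i x)) s).
  split; first exact: star_atoms.
    by rewrite /= /upd /=; split=> [a|||]; rewrite ?s8 ?VA ?eqn_add2l ?VE ?VE' ?sV.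
  apply: leq_mul_bits => //; rewrite /= /upd /= s8 ?VA ?B0 ?B8 ?B16 ?B17 ?B18.
  move: (bitlen_add V i); clear; lia.
- exists (run_atoms (sim_instr (ADD i j l)) s), (atoms_cost (sim_instr (ADD i j l)) s).
  split; first exact: star_atoms.
    rewrite /= /upd /= !(s8, VA, VE, VE') //.
    by split=> [a|||]; rewrite ?s8 ?VA ?eqn_add2l ?VE ?VE' ?sV.
  apply: leq_mul_bits => //; rewrite /= /upd /= !(s8, VA, VE, VE') // !sV ?B0 ?B8 ?B16 ?B17 ?B18.
  move: (bitlen_add V i) (bitlen_add V j) (bitlen_add V l) (bitlen_add (r j) (r l)); clear; lia.
- exists (run_atoms (sim_instr (SUB i j l)) s), (atoms_cost (sim_instr (SUB i j l)) s).
  split; first exact: star_atoms.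
    rewrite /= /upd /= !(s8, VA, VE, VE') //.
    by split=> [a|||]; rewrite ?s8 ?VA ?eqn_add2l ?VE ?VE' ?sV.
  apply: leq_mul_bits => //; rewrite /= /upd /= !(s8, VA, VE, VE') // !sV ?B0 ?B8 ?B16 ?B17 ?B18.
  move: (bitlen_add V i) (bitlen_add V j) (bitlen_add V l) (bitlen_sub (r j) (r l)); clear; lia.
- exists (run_atoms (sim_instr (LOAD i j)) s), (atoms_cost (sim_instr (LOAD i j)) s).
  split; first exact: star_atoms.
    rewrite /= /upd /= !(s8, VA, VE, VE', sV) //.
    by split=> [a|||]; rewrite ?s8 ?VA ?eqn_add2l ?VE ?VE' ?sV.
  apply: leq_mul_bits => //; rewrite /= /upd /= !(s8, VA, VE, VE', sV) // ?B0 ?B8 ?B16 ?B17 ?B18.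
  move: (bitlen_add V i) (bitlen_add V j) (bitlen_add V (r j)); clear; lia.
- exists (run_atoms (sim_instr (STORE i j)) s), (atoms_cost (sim_instr (STORE i j)) s).
  split; first exact: star_atoms.
    rewrite /= /upd /= !(s8, VA, VE, VE', sV) //.
    by split=> [a|||]; rewrite ?s8 ?VA ?eqn_add2l ?VE ?VE' ?sV.
  apply: leq_mul_bits => //; rewrite /= /upd /= !(s8, VA, VE, VE', sV) // ?B0 ?B8 ?B16 ?B17 ?B18.
  move: (bitlen_add V i) (bitlen_add V j) (bitlen_add V (r i)); clear; lia.
(* The translated jump is the fourth instruction; if it is not taken, the six padding instructions
   are still executed. *)
- set is1 := [:: CONST 16 i; ADD 16 16 8; LOAD 17 16].
  have {C} [C1 C2] : code_at Q (o + 10 * pc) is1 /\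
      code_at Q (o + 10 * pc + 3) (JZ 17 (sim_target t) :: nseq 6 (CONST 16 0)).
    exact: (code_at_cat (c1 := is1)) C.
  have [C3 C4] := code_at_cons C2; have [o1 o2] := code_at_nth C3.
  have S1 := star_atoms s C1 isT.
  have r17 : run_atoms is1 s 17 = r i by rewrite /= /upd /= s8 VA VE ?sV.
  have rel : sim_rel s0 r (run_atoms is1 s).
    by rewrite /= /upd /=; split=> [a|||]; rewrite ?s8 ?VA ?VE ?sV.
  have c1E : atoms_cost is1 s + (1 + bitlen 17 + bitlen (r i))
      <= 60 + 10 * bitlen V + 10 * bitlen i + 10 * bitlen (r i).
    rewrite /= /upd /= !(s8, VA, VE, sV) // B8 B16 B17.
    by move: (bitlen_add V i); clear; lia.
  move: (run_atoms is1 s) (atoms_cost is1 s) S1 r17 rel c1E => s1 d1 S1 r17 rel c1E.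
  have S2 : star Q (o + 10 * pc + 3) s1 (1 + bitlen 17 + bitlen (r i))
      (if r i == 0 then sim_target t else (o + 10 * pc + 3).+1) s1.
    by apply: star1; rewrite /step leqNgt o1 /= o2 r17.
  case: eqP S2 => [ri|ri] S2.
    exists s1, (d1 + (1 + bitlen 17 + bitlen (r i))); split=> //.
      exact: star_trans S1 S2.
    apply: leq_mul_bits => //; move: c1E; clear; lia.
  have S3 := star_atoms s1 C4 isT.
  exists (run_atoms (nseq 6 (CONST 16 0)) s1),
    (d1 + ((1 + bitlen 17 + bitlen (r i)) + atoms_cost (nseq 6 (CONST 16 0)) s1)); split=> //.
  + apply: star_trans S1 _; apply: star_trans S2 _; move: S3; rewrite size_nseq Epc1.
    by have -> : (o + 10 * pc + 3).+1 + 6 = o + 10 * pc + 10 by lia.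
  + by case: rel => R1 R2 R3 R4; rewrite /= /upd /=; split=> [a|||]; rewrite ?VE ?R1.
  + apply: leq_mul_bits => //; rewrite addnA; move: c1E.
    rewrite [atoms_cost (nseq _ _) _]/= B16 B0; clear; lia.
Qed.

Lemma sim_exec s0 fuel pc r acc r' cost s : exec P fuel pc r acc = Some (r', cost) ->
  sim_rel s0 r s ->
  exists s' c', [/\ star Q (sim_target pc) s c' (sim_target (size P)) s', sim_rel s0 r' s'
    & c' <= 250 * (bitlen V * (cost - acc)) + 20].
Proof.
(* A halted [P] is either past its end or at [HALT], which has become a jump to the end; the 20
   covers that jump. *)
have final pc0 r0 s1 : step P pc0 r0 = None -> sim_rel s0 r0 s1 ->
    exists c', star Q (sim_target pc0) s1 c' (sim_target (size P)) s1 /\ c' <= 20.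
  move=> S [_ _ z _]; case: (leqP (size P) pc0) => H.
    by exists 0; rewrite /sim_target (minn_idPr H) minnn; split=> //; apply: star_refl.
  have := sim_code_at H; move: S; rewrite /step leqNgt H /=.
  case: nth => //= _ C; have [C1 _] := code_at_cons C; have [o1 o2] := code_at_nth C1.
  exists (1 + bitlen 0 + bitlen 0); split=> //.
  rewrite {1}/sim_target (minn_idPl (ltnW H)); apply: star1.
  by rewrite /step leqNgt o1 /= o2 z.
elim: fuel pc r acc s => [|fuel IH] pc r acc s /=; case S: (step P pc r) => [[[pc1 r1] c1]|] //.
- move=> [<- <-] R; have [c' [H1 H2]] := final _ _ _ S R.
  by exists s, c'; split=> //; apply: leq_trans H2 _; rewrite leq_addl.
- move=> E R; have [s1 [d1 [S1 R1 D1]]] := sim_step S R.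
  have [s2 [d2 [S2 R2 D2]]] := IH _ _ _ _ E R1.
  exists s2, (d1 + d2); split=> //; first exact: star_trans S1 S2.
  (* The accumulator only grows, so the truncated [cost - acc] is a true difference. *)
  have ge : acc + c1 <= cost.
    elim: fuel pc1 r1 (acc + c1) {IH S S1 R1 D1 S2 R2 D2} E => [|fuel IH] pc1 r1 a /=;
      case: step => [[[pc2 r2] c2]|] //; try by case=> _ ->.
    by move=> /IH; apply: leq_trans; rewrite leq_addr.
  apply: leq_trans (leq_add D1 D2) _; rewrite addnA leq_add2r -mulnDr leq_mul2l /=.
  by rewrite -mulnDr leq_mul2l; apply/orP; right; move: ge; clear; lia.
- move=> [<- <-] R; have [c' [H1 H2]] := final _ _ _ S R.
  by exists s, c'; split=> //; apply: leq_trans H2 _; rewrite leq_addl.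
Qed.

End Simulation.

(** * Writing the sequences *)

(* Register allocation: 0 zero, 1 one, 2 copy of the input, 4 number of clauses, 5 ell,
   6 table of c * 2 ^ p, 7 table of literal values, 8 base of the simulated memory, 9 top,
   10 literals of the current block, 11 output pointer, 12 start of the current sequence,
   13 loop flag, 14 level, 15 cell of the current variable, 27 threshold, 28 c;
   the others are temporary. *)
Definition emit_val : cmd := atoms [:: STORE 11 19; ADD 11 11 1].

(** One period of values starting at a multiple of [k]: residues are known when the code is
    generated, so the class test costs nothing at run time. *)
Definition group (t : nat) (full : bool) (a n : nat) : cmd :=
  cseq [seq if full || (s != t) then Seq emit_val (Atom (ADD 19 19 1))
            else Atom (ADD 19 19 1) | s <- iota a n].

(** A run of level [p] consists of [c * 2 ^ p] periods. As [k] is fixed, its start is reached by [k]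
    additions or [2 * k] subtractions of the table entry. *)
Definition emit_level (k t : nat) (suffix full : bool) : cmd :=
  Seq (atoms [:: ADD 17 6 14; LOAD 18 17; ADD 20 18 0; ADD 19 9 0])
    (Seq (atoms (if suffix then nseq k (ADD 19 19 18) else nseq k.*2 (SUB 19 19 18)))
      (While 20 (Seq (group t full 0 k) (Atom (SUB 20 20 1))))).

Definition emit_sym (s : nat) : cmd :=
  Seq (Atom (CONST 19 s)) (Seq (Atom (ADD 19 23 19)) emit_val).

Definition clause_emit (t : nat) (ss : seq nat) : cmd :=
  cseq [seq if s == t then If 22 (emit_sym s) Skip else emit_sym s | s <- ss].

(** The input code [v.*2 + b] of a literal is also its index in the value table, so a clause is
    evaluated by summing table entries. *)
Definition literal_loop : cmd :=
  While 25 (atoms [:: LOAD 26 21; ADD 26 26 7; LOAD 26 26; ADD 22 22 26;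
                      ADD 21 21 1; SUB 25 25 1]).

Definition emit_clause (k t : nat) : cmd :=
  Seq (Atom (LOAD 25 21)) (Seq (Atom (ADD 21 21 1)) (Seq (Atom (CONST 22 0))
    (Seq literal_loop (Seq (clause_emit t (rev (iota 0 k)))
      (atoms [:: CONST 26 k; ADD 23 23 26; SUB 24 24 1]))))).

Definition emit_gadget (k t : nat) : cmd :=
  Seq (atoms [:: ADD 24 4 0; ADD 23 9 0; ADD 21 2 1; ADD 21 21 1])
    (While 24 (emit_clause k t)).

(** The carry of a binary counter: each bit turned from 1 to 0 leaves a right half, whose closing
    run is emitted. Register 15 points to the cell of the negative literal, with the positive one
    next to it. *)
Definition carry_loop (k t : nat) : cmd :=
  While 16 (Seq (emit_level k t true false)
    (atoms [:: ADD 17 15 1; STORE 17 0; STORE 15 1; ADD 14 14 1; ADD 15 15 1; ADD 15 15 1;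
               ADD 17 15 1; LOAD 16 17])).

Definition refill_loop (k t : nat) : cmd :=
  While 14 (Seq (Atom (SUB 14 14 1)) (emit_level k t false false)).

Definition block_head (k t : nat) : cmd :=
  Seq (emit_gadget k t)
    (Seq (atoms [:: CONST 14 0; ADD 15 10 0; ADD 17 15 1; LOAD 16 17]) (carry_loop k t)).

Definition block_tail (k t : nat) : cmd :=
  Seq (emit_level k t true true)
    (Seq (atoms [:: STORE 15 0; ADD 17 15 1; STORE 17 1])
      (Seq (emit_level k t false true) (refill_loop k t))).

(** The carry stops at level 14; this equals [ell] exactly when the counter overflows, and then the
    loop flag 13 becomes 0. *)
Definition next_block (k t : nat) : cmd :=
  Seq (block_head k t) (Seq (Atom (SUB 13 5 14)) (If 13 (block_tail k t) Skip)).

Definition init_loop (k t : nat) : cmd :=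
  While 14 (Seq (atoms [:: SUB 14 14 1; SUB 15 15 1; SUB 15 15 1; STORE 15 1])
              (emit_level k t false false)).

Definition clear_loop : cmd :=
  While 20 (atoms [:: STORE 15 0; ADD 15 15 1; ADD 15 15 1; SUB 20 20 1]).

(** The length precedes the sequence but is known only afterwards: a 0 is written, its address kept
    in 12, and the cell filled at the end. Clearing the table makes the literals of this block false
    again for the next one. *)
Definition emit_sequence (k t : nat) : cmd :=
  Seq (atoms [:: ADD 12 11 0; CONST 19 0])
    (Seq emit_val
    (Seq (Atom (ADD 10 7 0))
    (Seq (atoms (nseq t.*2 (ADD 10 10 5)))
    (Seq (atoms [:: ADD 14 5 0; ADD 15 10 5; ADD 15 15 5])
    (Seq (init_loop k t)
    (Seq (Atom (CONST 13 1))
    (Seq (While 13 (next_block k t))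
    (Seq (atoms [:: ADD 15 10 0; ADD 20 5 0])
    (Seq clear_loop
      (atoms [:: SUB 17 11 12; SUB 17 17 1; STORE 12 17])))))))))).

Definition emit_all (k : nat) : cmd := cseq [seq emit_sequence k t | t <- iota 0 k].

(** * Specifications of the emitting code *)

Lemma wp_add_times Bd n x y r : x != y -> r x + n * r y <= Bd ->
  wp Bd (atoms (nseq n (ADD x x y))) (fun r' m =>
    [/\ m = n, r' x = r x + n * r y & forall i, i != x -> r' i = r i]) r.
Proof.
move=> xy; elim: n r => [|n IH] r rB; first by apply: wp_skip; rewrite addn0.
have yx : y == x = false by rewrite eq_sym (negbTE xy).
apply: wp_seq; apply: wp_atom; first by move: rB; rewrite /= mulSn; clear; lia.
apply: wp_conseq (IH _ _) _ => /=.
  by rewrite /upd eqxx yx -addnA -mulSn.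
move=> r' m _ [-> Hx Hi]; split=> //; first by rewrite Hx /upd eqxx yx -addnA -mulSn.
by move=> i ix; rewrite Hi // /upd (negbTE ix).
Qed.

Lemma wp_sub_times Bd n x y r : x != y ->
  wp Bd (atoms (nseq n (SUB x x y))) (fun r' m =>
    [/\ m = n, r' x = r x - n * r y & forall i, i != x -> r' i = r i]) r.
Proof.
move=> xy; elim: n r => [|n IH] r; first by apply: wp_skip; rewrite subn0.
have yx : y == x = false by rewrite eq_sym (negbTE xy).
apply: wp_seq; apply: wp_atom => //; apply: wp_conseq (IH _) _ => /=.
move=> r' m _ [-> Hx Hi]; split=> //; first by rewrite Hx /upd eqxx yx -subnDA -mulSn.
by move=> i ix; rewrite Hi // /upd (negbTE ix).
Qed.

Section Emission.

Variables (Bd k N ell B wb tl V c top thr A : nat) (f : cnf).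
Hypotheses (k_ge3 : 3 <= k) (B_ge : 128 <= B) (S_le : size (encode_cnf N f) <= B).
Hypotheses (wbE : wb = B + B) (tlE : tl = wb + ell) (VE : V = tl + (k * ell).*2 + 2).
Hypotheses (cE : c = k * size f) (topE : top = k * (c * 2 ^ ell)).
Hypotheses (top_Bd : top + top + B <= Bd) (A_ge : 10 * k + 40 <= A).

(** The regions follow one another: static registers, input copy, weights, literal values, simulated
    memory. The literal table extends to variable [k * ell], one past the last, because the carry
    may read it. [rep_mem] also records zeros beyond [w], which the simulated program expects. *)
Record Rep (tab : nat -> bool -> bool) (w : seq nat) (r : regs) : Prop := MkRep {
  rep0 : r 0 = 0; rep1 : r 1 = 1; rep2 : r 2 = B; rep4 : r 4 = size f;
  rep5 : r 5 = ell; rep6 : r 6 = wb; rep7 : r 7 = tl; rep8 : r 8 = V;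
  rep9 : r 9 = top; rep27 : r 27 = thr; rep11 : r 11 = V.+1 + size w;
  rep_in : forall j, j < size (encode_cnf N f) -> r (B + j) = nth 0 (encode_cnf N f) j;
  rep_w : forall p, p < ell -> r (wb + p) = c * 2 ^ p;
  rep_tab : forall v b, v <= k * ell -> r (tl + (v.*2 + nat_of_bool b)) = tab v b;
  rep_mem : forall i, r (V.+1 + i) = nth 0 w i;
  rep_V : r V = 0 }.

Definition reserved : seq nat := [:: 0; 1; 2; 4; 5; 6; 7; 8; 9; 11; 27].

Lemma Rep_agree tab w r r' : (forall i, (i \in reserved) || (nscal <= i) -> r' i = r i) ->
  Rep tab w r -> Rep tab w r'.
Proof.
move=> E [H0 H1 H2 H4 H5 H6 H7 H8 H9 H27 H11 Hin Hw Htab Hmem HV].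
have F j : nscal <= j -> r' j = r j by move=> j32; rewrite E // j32 orbT.
split; try by rewrite E.
- by move=> j jS; rewrite F ?Hin //; lia.
- by move=> p pl; rewrite F ?Hw //; lia.
- by move=> u b ul; rewrite F ?Htab //; lia.
- by move=> j; rewrite F ?Hmem //; lia.
- by rewrite F //; lia.
Qed.

Lemma Rep_scratch tab w r i v : (i < nscal) && (i \notin reserved) ->
  Rep tab w r -> Rep tab w (upd r i v).
Proof.
case/andP => i32 iR; apply: Rep_agree => j jR; rewrite /upd; case: eqP => // ji.
by move: jR; rewrite ji (negbTE iR) leqNgt i32.
Qed.

Lemma wp_set x v tab w i r (Q : regs -> nat -> Prop) : (x < nscal) && (x \notin reserved) ->
  Rep tab w r -> aexec i r = upd r x v -> aok Bd i r ->
  (forall r', Rep tab w r' -> r' x = v -> (forall y, y != x -> y < nscal -> r' y = r y) ->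
     Q r' 1) ->
  wp Bd (Atom i) Q r.
Proof.
move=> xs HR E ok H; apply: wp_atom => //; rewrite E; apply: H; first exact: Rep_scratch.
  by rewrite /upd eqxx.
by move=> y /negbTE yx _; rewrite /upd yx.
Qed.

Lemma Rep_emit tab w r v : Rep tab w r ->
  Rep tab (rcons w v) (upd (upd r (r 11) v) 11 (r 11 + 1)).
Proof.
case=> [H0 H1 H2 H4 H5 H6 H7 H8 H9 H27 H11 Hin Hw Htab Hmem HV].
have F j : j < V.+1 -> j != 11 -> upd (upd r (r 11) v) 11 (r 11 + 1) j = r j.
  move=> jV /negbTE j11; rewrite /upd j11; case: eqP => //; rewrite H11; lia.
split; try (rewrite F //; lia).
- rewrite /upd /= H11 size_rcons. lia.
- by move=> j jS; rewrite F ?Hin //; lia.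
- by move=> p pl; rewrite F ?Hw //; lia.
- by move=> u b ul; have := leq_b1 b; rewrite F ?Htab //; lia.
- move=> j; rewrite nth_rcons /upd ifN; last by lia.
  rewrite H11 eqn_add2l; case: ltngtP => // H.
  by rewrite Hmem nth_default // ltnW.
Qed.

Lemma Rep_tab tab tab' w r : (forall v b, v <= k * ell -> tab v b = tab' v b) ->
  Rep tab w r -> Rep tab' w r.
Proof.
move=> E [H0 H1 H2 H4 H5 H6 H7 H8 H9 H27 H11 Hin Hw Htab Hmem HV].
by split=> // v b vl; rewrite Htab // E.
Qed.

Lemma Rep_set_tab tab w r v b x : v <= k * ell -> Rep tab w r ->
  Rep (fun v' b' => if (v' == v) && (b' == b) then x else tab v' b') w
      (upd r (tl + (v.*2 + nat_of_bool b)) (nat_of_bool x)).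
Proof.
move=> vl [H0 H1 H2 H4 H5 H6 H7 H8 H9 H27 H11 Hin Hw Htab Hmem HV].
have F j : (j < tl) || (V <= j) ->
    upd r (tl + (v.*2 + b)) x j = r j.
  by have := leq_b1 b; rewrite /upd; case: eqP => // ->; lia.
split; try (rewrite F //; lia).
- by move=> j jS; rewrite F ?Hin //; lia.
- by move=> p pl; rewrite F ?Hw //; lia.
- move=> u b' ul; rewrite /upd eqn_add2l.
  have -> : (u.*2 + b' == v.*2 + b) = (u == v) && (b' == b).
    by case: (b'); case: (b); case: (eqVneq u v) => [->|]; rewrite ?eqxx //=; lia.
  by case: ifP => // _; rewrite Htab.
- by move=> j; rewrite F ?Hmem //; lia.
Qed.

Definition room (w : seq nat) : bool := V + size w + 2 <= Bd.

Lemma wp_emit_val tab w r v : Rep tab w r -> r 19 = v -> room (rcons w v) ->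
  wp Bd emit_val (fun r' m => Rep tab (rcons w v) r' /\ m = 2) r.
Proof.
move=> HR r19 rm; have o32 : nscal <= r 11 by rewrite (rep11 HR); lia.
apply: wp_seq; apply: wp_atom => //.
apply: wp_seq; apply: wp_atom.
  rewrite /= /upd /= ifN; last by lia.
  rewrite ifN ?(rep1 HR) ?(rep11 HR); last by lia.
  by move: rm; rewrite /room size_rcons; lia.
apply: wp_skip; split=> //.
suff -> : aexec (ADD 11 11 1) (aexec (STORE 11 19) r) = upd (upd r (r 11) v) 11 (r 11 + 1).
  exact: Rep_emit.
rewrite /= r19; congr upd; rewrite /upd ifN; last by lia.
by rewrite ifN ?(rep1 HR) //; lia.
Qed.

Lemma writes_group t full a n i : i != 11 -> i != 19 -> ~~ writes (group t full a n) i.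
Proof.
move=> /negbTE h11 /negbTE h19; rewrite /group.
by elim: n a => //= n IH a; case: ifP => _ /=; rewrite ?h11 ?h19 /= IH.
Qed.

Lemma wp_group tab t full v0 a n w r :
  k %| v0 -> a + n <= k -> Rep tab w r -> r 19 = v0 + a -> v0 + k <= Bd ->
  room (w ++ [seq v <- iota (v0 + a) n | full || (v %% k != t)]) ->
  wp Bd (group t full a n)
    (fun r' m => [/\ Rep tab (w ++ [seq v <- iota (v0 + a) n | full || (v %% k != t)]) r',
       r' 19 = v0 + a + n & m <= 3 * n]) r.
Proof.
move=> kv; elim: n a w r => [|n IH] a w r ak HR r19 vB rm.
  by apply: wp_skip; rewrite cats0 addn0.
have va : (v0 + a) %% k = a.
  by case/dvdnP: kv => q ->; rewrite modnMDl modn_small //; lia.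
have ak' : a.+1 + n <= k by rewrite addSnnS.
have inc r1 w1 : Rep tab w1 r1 -> r1 19 = v0 + a ->
    wp Bd (Atom (ADD 19 19 1)) (fun r' m => [/\ Rep tab w1 r', r' 19 = v0 + a.+1 & m = 1]) r1.
  move=> HR1 r119; apply: wp_atom; rewrite /= (rep1 HR1) r119.
    by move: ak vB; clear; lia.
  by split=> //; [apply: Rep_scratch|rewrite /upd /= addn1 addnS].
apply: wp_seq; rewrite /= va -addnS in rm *.
case E : (full || (a != t)) rm => /= rm.
- rewrite -cat_rcons in rm *.
  have rmw : room (rcons w (v0 + a)) by move: rm; rewrite /room size_cat; clear; lia.
  apply: wp_seq; apply: wp_conseq (wp_emit_val HR r19 rmw) _ => r1 n1 fr [HR1 ->].
  apply: wp_conseq (inc r1 _ HR1 _) _; first by rewrite fr.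
  move=> r2 n2 _ [HR2 r219 ->].
  apply: wp_conseq (IH _ _ _ ak' HR2 r219 vB rm) _ => r3 n3 _ [HR3 r319 Hn].
  by split=> //; [rewrite r319 -!addnA addSnnS|move: Hn; clear; lia].
- apply: wp_conseq (inc r _ HR r19) _ => r2 n2 _ [HR2 r219 ->].
  apply: wp_conseq (IH _ _ _ ak' HR2 r219 vB rm) _ => r3 n3 _ [HR3 r319 Hn].
  by split=> //; [rewrite r319 -!addnA addSnnS|move: Hn; clear; lia].
Qed.

Lemma room_cat w s : room (w ++ s) -> room w.
Proof. by rewrite /room size_cat; clear; lia. Qed.

Lemma wp_level_loop tab t full v0 n w r :
  k %| v0 -> Rep tab w r -> r 19 = v0 -> r 20 = n -> v0 + k * n <= Bd ->
  room (w ++ lev k t full v0 (k * n)) ->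
  wp Bd (While 20 (Seq (group t full 0 k) (Atom (SUB 20 20 1))))
    (fun r' m => Rep tab (w ++ lev k t full v0 (k * n)) r' /\ m <= (3 * k + 3) * n + 1) r.
Proof.
move=> kv HR r19 r20 vB rm.
pose Inv j r' a := exists i, [/\ i + j = n, Rep tab (w ++ lev k t full v0 (k * i)) r',
  r' 19 = v0 + k * i, r' 20 = j & a <= (3 * k + 3) * i].
apply: (@wp_while Bd 20 _ Inv n).
- move=> j r1 a jn [i [ij HR1 r119 r120 Ha]]; rewrite r120; split=> //.
  have Ei : lev k t full v0 (k * i.+1) = lev k t full v0 (k * i)
      ++ [seq v <- iota (v0 + k * i + 0) k | full || (v %% k != t)].
    by rewrite /lev mulnSr iotaD filter_cat addn0.
  have rm1 : room ((w ++ lev k t full v0 (k * i)) ++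
      [seq v <- iota (v0 + k * i + 0) k | full || (v %% k != t)]).
    rewrite -catA -Ei; move: rm; rewrite -ij addnS -addSn mulnDr /lev iotaD filter_cat catA.
    exact: room_cat.
  have kv1 : k %| v0 + k * i by rewrite dvdn_addr // dvdn_mulr.
  have vB1 : v0 + k * i + k <= Bd.
    apply: leq_trans vB; rewrite -addnA leq_add2l -mulnSr leq_mul2l; apply/orP; right.
    by move: ij; clear; lia.
  have r119' : r1 19 = v0 + k * i + 0 by rewrite addn0.
  apply: wp_seq; apply: wp_conseq (wp_group (a := 0) kv1 (leqnn k) HR1 r119' vB1 rm1) _.
  move=> r2 n2 fr [HR2 r219 Hn2]; apply: wp_atom => //.
  have r220 : r2 20 = j.+1 by rewrite fr ?writes_group.
  exists i.+1; split.
  + by rewrite -ij addnS.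
  + by rewrite Ei catA /=; apply: Rep_scratch.
  + by rewrite /= /upd /= r219 addn0 mulnSr addnA.
  + by rewrite /= /upd /= r220 (rep1 HR2) subn1.
  + rewrite mulnS; move: Ha Hn2; clear; lia.
- by move=> r1 a [i []].
- by exists 0; split=> //; rewrite ?muln0 ?addn0 //= cats0.
- move=> r1 m [i [+ HR1 _ _ Ha]]; rewrite addn0 => ni; subst i.
  by split=> //; rewrite addn1 ltnS.
Qed.

(** Even a thinned period keeps [k - 1] symbols, so the time for a run is proportional to its
    output. *)
Lemma size_lev_ge t full v0 n : t < k -> k %| v0 -> n <= size (lev k t full v0 (k * n)).
Proof.
move=> tk kv; rewrite size_filter.
have := count_predC (fun v => v %% k == t) (iota v0 (k * n)).
rewrite count_class // size_iota => H.
apply: (@leq_trans (count (predC (fun v => v %% k == t)) (iota v0 (k * n)))).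
  have : 2 * n <= k * n by rewrite leq_mul2r; apply/orP; right; apply: leq_trans k_ge3.
  by move: H; clear; lia.
by apply: sub_count => v /= ->; rewrite orbT.
Qed.

Definition level_seq t (suffix full : bool) p : seq nat :=
  lev k t full (if suffix then top + k * (c * 2 ^ p) else top - (k * (c * 2 ^ p)).*2)
    (k * (c * 2 ^ p)).

Lemma wp_emit_level tab t suffix full p w r :
  t < k -> p < ell -> Rep tab w r -> r 14 = p -> room (w ++ level_seq t suffix full p) ->
  wp Bd (emit_level k t suffix full)
    (fun r' m => Rep tab (w ++ level_seq t suffix full p) r'
       /\ m <= A * (1 + size (level_seq t suffix full p))) r.
Proof.
move=> tk pl HR r14 rm.
(* Two widths fit below [top] at every level, so the start of a lower run is not truncated. *)
have W2 : (k * (c * 2 ^ p)).*2 <= top.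
  rewrite topE -[ell](subnK pl) addnS expnS expnD -mul2n.
  have : 0 < 2 ^ (ell - p.+1) by rewrite expn_gt0.
  move: (2 ^ (ell - p.+1)) (2 ^ p) => x y x0.
  by rewrite ![k * _]mulnC !mulnA leq_mul2r -[2 * c]mulnC -!mulnA leq_mul2l leq_mul2l leq_pmull ?orbT.
have wp_p : r (wb + p) = c * 2 ^ p by rewrite (rep_w HR).
have cW : c * 2 ^ p <= k * (c * 2 ^ p) by rewrite leq_pmull //; apply: leq_trans k_ge3.
pose base := if suffix then top + k * (c * 2 ^ p) else top - (k * (c * 2 ^ p)).*2.
have kb : k %| base.
  by rewrite /base topE; case: (suffix); rewrite ?dvdn_addr ?dvdn_sub ?dvdn_mulr // -mul2n dvdn_mull ?dvdn_mulr.
have bB : base + k * (c * 2 ^ p) <= Bd.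
  by move: top_Bd W2; rewrite /base; case: (suffix); clear; lia.
have VB : V + 2 <= Bd by move: rm; rewrite /room; clear; lia.
apply: wp_seq.
apply: wp_seq; apply: (wp_set (x := 17) (v := wb + p) _ HR) => //=.
  - by rewrite (rep6 HR) r14.
  - by rewrite (rep6 HR) r14; move: VB pl; rewrite VE tlE; clear; lia.
move=> ra HRa ra17 fra.
apply: wp_seq; apply: (wp_set (x := 18) (v := c * 2 ^ p) _ HRa) => //=.
  by rewrite ra17 (rep_w HRa).
move=> rb HRb rb18 frb.
apply: wp_seq; apply: (wp_set (x := 20) (v := c * 2 ^ p) _ HRb) => //=.
  - by rewrite rb18 (rep0 HRb) addn0.
  - by rewrite rb18 (rep0 HRb); move: cW W2 top_Bd; clear; lia.
move=> rc HRc rc20 frc.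
apply: wp_seq; apply: (wp_set (x := 19) (v := top) _ HRc) => //=.
  - by rewrite (rep9 HRc) (rep0 HRc) addn0.
  - by rewrite (rep9 HRc) (rep0 HRc); move: top_Bd; clear; lia.
move=> r1 HR1 r119 fr1.
have r118 : r1 18 = c * 2 ^ p by rewrite fr1 // frc.
have r120 : r1 20 = c * 2 ^ p by rewrite fr1.
apply: wp_skip; apply: wp_seq.
have pre : wp Bd (atoms (if suffix then nseq k (ADD 19 19 18) else nseq k.*2 (SUB 19 19 18)))
    (fun r' m => [/\ m <= k.*2, Rep tab w r', r' 19 = base & r' 20 = c * 2 ^ p]) r1.
  have agree r' : (forall i, i != 19 -> r' i = r1 i) -> Rep tab w r'.
    move=> H; apply: (Rep_agree _ HR1) => i iR; apply: H.
    by apply: contraTneq iR => ->.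
  move: bB; rewrite /base; case: (suffix) => bB.
    apply: wp_conseq (wp_add_times (n := k) (x := 19) (y := 18) _ _) _ => //.
      by rewrite r119 r118; move: bB; clear; lia.
    move=> r' m _ [-> H19 Hi]; rewrite H19 Hi // r118 r119 r120; split=> //; last exact: agree.
    by clear; lia.
  apply: wp_conseq (wp_sub_times _ k.*2 (x := 19) (y := 18) _ _) _ => //.
  move=> r' m _ [-> H19 Hi]; rewrite H19 Hi // r118 r119 r120; split=> //; first exact: agree.
  by rewrite -!mul2n -mulnA.
apply: wp_conseq pre _ => r2 n2 _ [n2k HR2 r219 r220].
have L := wp_level_loop (t := t) (full := full) kb HR2 r219 r220 bB rm.
apply: wp_conseq L _ => r3 n3 _ [HR3 n3le].
split=> //; have := size_lev_ge full (c * 2 ^ p) tk kb.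
rewrite -[lev _ _ _ _ _]/(level_seq t suffix full p); move: (size _) => s sge.
have : (3 * k + 3) * (c * 2 ^ p) <= (3 * k + 3) * s by rewrite leq_mul2l sge orbT.
have : (10 * k + 40) * (1 + s) <= A * (1 + s) by rewrite leq_mul2r A_ge orbT.
by move: n2k n3le; clear; lia.
Qed.

(** * Emitting the gadget of an assignment *)

Lemma wp_emit_sym tab s u w r : Rep tab w r -> r 23 = u -> u + s <= Bd ->
  room (rcons w (u + s)) ->
  wp Bd (emit_sym s) (fun r' m => Rep tab (rcons w (u + s)) r' /\ m = 4) r.
Proof.
move=> HR r23 uB rm.
apply: wp_seq; apply: (wp_set (x := 19) (v := s) _ HR) => //=; first by lia.
move=> r1 HR1 r119 fr1.
apply: wp_seq; apply: (wp_set (x := 19) (v := u + s) _ HR1) => //=.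
- by rewrite r119 fr1 // r23.
- by rewrite r119 fr1 // r23.
move=> r2 HR2 r219 fr2.
by apply: wp_conseq (wp_emit_val HR2 r219 rm) _ => r3 n3 _ [HR3 ->].
Qed.

Lemma wp_clause_emit tab t (sat : bool) u ss w r :
  Rep tab w r -> r 23 = u -> (r 22 != 0) = sat -> u + k <= Bd -> all (gtn k) ss ->
  room (w ++ [seq u + s | s <- ss & sat || (s != t)]) ->
  wp Bd (clause_emit t ss) (fun r' m =>
    Rep tab (w ++ [seq u + s | s <- ss & sat || (s != t)]) r' /\ m <= 6 * size ss) r.
Proof.
move=> + + + uB; elim: ss w r => [|s ss IH] w r HR r23 r22 /=.
  by move=> _ _; apply: wp_skip; rewrite cats0.
case/andP=> sk Hss rm; apply: wp_seq.
have us : u + s <= Bd by move: sk uB; clear; lia.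
have next r1 w1 n1 : Rep tab w1 r1 -> r1 23 = u -> (r1 22 != 0) = sat ->
    room (w1 ++ [seq u + s | s <- ss & sat || (s != t)]) -> n1 <= 6 ->
    wp Bd (clause_emit t ss) (fun r' m =>
      Rep tab (w1 ++ [seq u + s | s <- ss & sat || (s != t)]) r' /\ n1 + m <= 6 * (size ss).+1) r1.
  move=> HR1 r123 r122 rm1 Hn1; apply: wp_conseq (IH _ _ HR1 r123 r122 Hss rm1) _.
  by move=> r' m _ [? ?]; split=> //; rewrite mulnS leq_add.
case: (eqVneq s t) rm => [st|st]; rewrite ?orbT ?orbF => rm.
- case: (sat) next rm r22 {IH} => next /= rm r22; apply: wp_if => r22';
    rewrite ?r22' ?(negbTE r22') // in r22.
  + move: rm; rewrite -cat_rcons => rm.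
    apply: wp_conseq (wp_emit_sym HR r23 us (room_cat rm)) _ => r1 n1 fr [HR1 ->].
    by apply: next => //; rewrite fr.
  + by apply: wp_skip; apply: next => //; rewrite r22'.
- move: rm; rewrite /= -cat_rcons => rm.
  apply: wp_conseq (wp_emit_sym HR r23 us (room_cat rm)) _ => r1 n1 fr [HR1 ->].
  by apply: next => //; rewrite fr.
Qed.

Hypothesis N_le : N <= k * ell.
Hypothesis f_lt : all (all (fun l : literal => l.1 < N)) f.

Let E := encode_cnf N f.
Hypothesis E_Bd : V + N.*2 + size E + tl + k <= Bd.

Lemma wp_literal_loop tab w cl q r :
  all (fun l : literal => l.1 < N) cl -> Rep tab w r ->
  (forall i, i < size cl -> nth 0 E (q + i)
     = ((nth (0, false) cl i).1).*2 + (nth (0, false) cl i).2) ->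
  q + size cl <= size E -> r 21 = B + q -> r 22 = 0 -> r 25 = size cl ->
  wp Bd literal_loop (fun r' m =>
    [/\ Rep tab w r', r' 21 = B + (q + size cl),
       r' 22 = count (fun l => tab l.1 l.2) cl & m = 8 * size cl + 1]) r.
Proof.
move=> Hcl HR Hin qE r21 r22 r25.
pose Inv j r' n := exists i, [/\ i + j = size cl, Rep tab w r', r' 21 = B + (q + i),
   r' 22 = count (fun l => tab l.1 l.2) (take i cl) & r' 25 = j /\ n = 8 * i].
apply: (@wp_while Bd 25 _ Inv (size cl)).
- move=> j r1 n jn [i [ij HR1 r121 r122 [r125 ->]]]; rewrite r125; split=> //.
  have il : i < size cl by move: ij; clear; lia.
  have := Hin i il; set l := nth (0, false) cl i => Hl.
  have lN : l.1 < N by have /allP := Hcl; apply; apply: mem_nth.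
  have lt : l.1 <= k * ell by apply: ltnW; apply: leq_trans lN N_le.
  have lb : nat_of_bool l.2 <= 1 by apply: leq_b1.
  apply: wp_seq; apply: (wp_set (x := 26) (v := (l.1).*2 + l.2) _ HR1) => //=.
    by rewrite r121 (rep_in HR1) ?Hl // -/E; move: qE il; clear; lia.
  move=> r2 HR2 r226 fr2.
  apply: wp_seq; apply: (wp_set (x := 26) (v := tl + ((l.1).*2 + l.2)) _ HR2) => //=.
  + by rewrite r226 (rep7 HR2) addnC.
  + by rewrite r226 (rep7 HR2); move: lN E_Bd lb; clear; lia.
  move=> r3 HR3 r326 fr3.
  apply: wp_seq; apply: (wp_set (x := 26) (v := tab l.1 l.2) _ HR3) => //=.
    by rewrite r326 (rep_tab HR3).
  move=> r4 HR4 r426 fr4.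
  have c_le : count (fun l => tab l.1 l.2) (take i cl) + tab l.1 l.2 = count (fun l => tab l.1 l.2) (take i.+1 cl).
    by rewrite (take_nth (0, false) il) -cats1 count_cat /= addn0.
  have c_le' : count (fun l => tab l.1 l.2) (take i.+1 cl) <= size cl.
    by apply: leq_trans (count_size _ _) _; rewrite size_take; case: ltnP => // /ltnW.
  apply: wp_seq; apply: (wp_set (x := 22) (v := count (fun l => tab l.1 l.2) (take i.+1 cl)) _ HR4) => //=.
  + by rewrite r426 fr4 // fr3 // fr2 // r122 c_le.
  + rewrite r426 fr4 // fr3 // fr2 // r122 c_le; move: c_le' qE E_Bd; clear; lia.
  move=> r5 HR5 r522 fr5.
  have r521 : r5 21 = B + (q + i) by rewrite fr5 // fr4 // fr3 // fr2.
  apply: wp_seq; apply: (wp_set (x := 21) (v := B + (q + i.+1)) _ HR5) => //=.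
  + by rewrite r521 (rep1 HR5) addn1 !addnS.
  + by rewrite r521 (rep1 HR5); move: qE il E_Bd; rewrite VE tlE wbE; clear; lia.
  move=> r6 HR6 r621 fr6.
  apply: wp_seq; apply: (wp_set (x := 25) (v := j) _ HR6) => //=.
    by rewrite (rep1 HR6) fr6 // fr5 // fr4 // fr3 // fr2 // r125 subn1.
  move=> r7 HR7 r725 fr7; apply: wp_skip.
  exists i.+1; split.
  + by rewrite -ij addnS.
  + by [].
  + by rewrite fr7.
  + by rewrite fr7 // fr6.
  + by split=> //; clear; lia.
- by move=> r1 n [i [_ _ _ _ []]].
- exists 0; split=> //; by rewrite ?addn0 // take0.
- move=> r1 m [i [+ HR1 r121 r122 [_ ->]]]; rewrite addn0 => il.
  by rewrite r121 r122 il take_size; split=> //; clear; lia.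
Qed.

Lemma gadget_cat t sat base f1 f2 :
  gadget k t sat base (f1 ++ f2) = gadget k t sat base f1 ++ gadget k t sat (base + k * size f1) f2.
Proof.
elim: f1 base => [|cl f1 IH] base /=; first by rewrite muln0 addn0.
by rewrite IH catA mulnS addnA.
Qed.

Lemma map_addn_filter sat t u : k %| u ->
  [seq v <- rev (iota u k) | sat || (v %% k != t)]
    = [seq u + s | s <- rev (iota 0 k) & sat || (s != t)].
Proof.
move=> ku; rewrite -{1}[u]addn0 iotaDl -map_rev filter_map; congr map.
apply: eq_in_filter => s; rewrite mem_rev mem_iota /= => sk.
by case/dvdnP: ku => q ->; rewrite modnMDl modn_small.
Qed.

Definition enc_pos i := 2 + size (flatten [seq encode_clause cl | cl <- take i f]).

Lemma enc_split i : i < size f -> exists s1 s2,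
  [/\ E = s1 ++ encode_clause (nth [::] f i) ++ s2, size s1 = enc_pos i
    & enc_pos i.+1 = enc_pos i + size (encode_clause (nth [::] f i))].
Proof.
move=> fi; exists (N :: size f :: flatten [seq encode_clause cl | cl <- take i f]),
  (flatten [seq encode_clause cl | cl <- drop i.+1 f]); split=> //.
  rewrite /E /encode_cnf -{2}(cat_take_drop i f) (drop_nth [::] fi).
  by rewrite map_cat flatten_cat.
by rewrite /enc_pos (take_nth [::] fi) map_rcons flatten_rcons size_cat addnA.
Qed.

(** The cost is charged to the input cells read, so the sum over the clauses telescopes to
    [size E]. *)
Lemma wp_emit_clause tab t sat i w r : t < k -> i < size f ->
  (forall cl, sat cl = has (fun l : literal => tab l.1 l.2) cl) ->
  Rep tab w r -> r 21 = B + enc_pos i -> r 23 = top + k * i -> r 24 = size f - i ->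
  room (w ++ [seq v <- rev (iota (top + k * i) k) | sat (nth [::] f i) || (v %% k != t)]) ->
  wp Bd (emit_clause k t) (fun r' m =>
    [/\ Rep tab (w ++ [seq v <- rev (iota (top + k * i) k) | sat (nth [::] f i) || (v %% k != t)]) r',
      r' 21 = B + enc_pos i.+1, r' 23 = top + k * i.+1, r' 24 = size f - i.+1
      & m + 2 <= A * (enc_pos i.+1 - enc_pos i)]) r.
Proof.
move=> tk fi Hsat HR r21 r23 r24 rm; set cl := nth [::] f i.
have [s1 [s2 [Es Ss1 Ep]]] := enc_split fi; rewrite -/cl in Es Ep.
have SE : size E = enc_pos i + (size cl).+1 + size s2.
  by rewrite Es !size_cat Ss1 /= size_map addnA.
have kc : k * i + k <= top.
  rewrite topE cE -mulnSr leq_mul2l; apply/orP; right.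
  have : 0 < 2 ^ ell by rewrite expn_gt0.
  have : 0 < k by apply: leq_trans k_ge3.
  by move=> k0 x0; apply: leq_trans fi _; rewrite mulnAC leq_pmull // muln_gt0 k0.
have kv : k %| top + k * i by rewrite dvdn_addr ?dvdn_mulr // topE dvdn_mulr.
rewrite (map_addn_filter _ _ kv) in rm *.
apply: wp_seq; apply: (wp_set (x := 25) (v := size cl) _ HR) => //=.
  rewrite r21 (rep_in HR) -/E; last by rewrite SE; clear; lia.
  by rewrite Es nth_cat Ss1 ltnn subnn.
move=> ra HRa ra25 fra.
have ra21 : ra 21 = B + enc_pos i by rewrite fra.
apply: wp_seq; apply: (wp_set (x := 21) (v := B + (enc_pos i).+1) _ HRa) => //=.
- by rewrite ra21 (rep1 HRa) addn1 addnS.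
- by rewrite ra21 (rep1 HRa); move: E_Bd SE; rewrite VE tlE wbE; clear; lia.
move=> rb HRb rb21 frb.
apply: wp_seq; apply: (wp_set (x := 22) (v := 0) _ HRb) => //=.
move=> rc HRc rc22 frc.
have lcl : all (fun l : literal => l.1 < N) cl.
  by move/allP: f_lt; apply; apply: mem_nth.
have Hin j : j < size cl -> nth 0 E ((enc_pos i).+1 + j)
    = ((nth (0, false) cl j).1).*2 + (nth (0, false) cl j).2.
  move=> jc; rewrite Es nth_cat Ss1 ifN; last by clear; lia.
  have -> : (enc_pos i).+1 + j - enc_pos i = j.+1 by clear; lia.
  by rewrite /= nth_cat size_map jc (nth_map (0, false)).
apply: wp_seq; apply: wp_conseq (wp_literal_loop lcl HRc Hin _ _ rc22 _) _.
- by rewrite SE; clear; lia.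
- by rewrite frc // rb21.
- by rewrite frc // frb // ra25.
move=> rd nd frd [HRd rd21 rd22 ->].
have rd23 : rd 23 = top + k * i by rewrite frd // frc // frb // fra.
have rdsat : (rd 22 != 0) = sat cl by rewrite rd22 Hsat has_count lt0n.
have uB : top + k * i + k <= Bd by move: kc top_Bd; clear; lia.
have ssk : all (gtn k) (rev (iota 0 k)).
  by apply/allP => s; rewrite mem_rev mem_iota.
apply: wp_seq; apply: wp_conseq (wp_clause_emit HRd rd23 rdsat uB ssk rm) _.
move=> re ne fre [HRe Hne].
have fre' x : x != 11 -> x != 19 -> x < nscal -> re x = rd x.
  move=> /negbTE x11 /negbTE x19 x32; apply: fre => //; rewrite /clause_emit.
  by elim: (rev _) => //= s ss IH; case: ifP => _ /=; rewrite ?x19 ?x11 /= IH.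
apply: wp_seq; apply: (wp_set (x := 26) (v := k) _ HRe) => //=.
  by move: uB; clear; lia.
move=> rf HRf rf26 frf.
have rf23 : rf 23 = top + k * i by rewrite frf // fre'.
apply: wp_seq; apply: (wp_set (x := 23) (v := top + k * i.+1) _ HRf) => //=.
- by rewrite rf23 rf26 mulnSr addnA.
- by rewrite rf23 rf26.
move=> rg HRg rg23 frg.
have rg24 : rg 24 = size f - i.
  by rewrite frg // frf // fre' // frd // frc // frb // fra.
apply: wp_seq; apply: (wp_set (x := 24) (v := size f - i.+1) _ HRg) => //=.
  by rewrite rg24 (rep1 HRg); congr upd; clear; lia.
move=> rh HRh rh24 frh; apply: wp_skip; split=> //.
- rewrite frh // frg // frf // fre' // rd21 Ep /= size_map.
  by rewrite addSnnS.
- by rewrite frh.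
- rewrite Ep /= size_map; move: Hne; rewrite size_rev size_iota.
  rewrite addKn.
  have : (10 * k + 40) * (size cl).+1 <= A * (size cl).+1 by rewrite leq_mul2r A_ge orbT.
  have : k <= k * (size cl).+1 by rewrite leq_pmulr.
  move: (size cl) => s H1 H2 H3; move: H1 H2 H3; clear; lia.
Qed.

Lemma wp_emit_gadget tab t sat w r : t < k ->
  (forall cl, sat cl = has (fun l : literal => tab l.1 l.2) cl) ->
  Rep tab w r -> room (w ++ gadget k t sat top f) ->
  wp Bd (emit_gadget k t) (fun r' m =>
    Rep tab (w ++ gadget k t sat top f) r' /\ m <= A * size E) r.
Proof.
move=> tk Hsat HR rm.
have VB : B + 2 <= Bd by move: E_Bd; rewrite VE tlE wbE; move: B_ge; clear; lia.
apply: wp_seq.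
apply: wp_seq; apply: (wp_set (x := 24) (v := size f) _ HR) => //=.
- by rewrite (rep4 HR) (rep0 HR) addn0.
- rewrite (rep4 HR) (rep0 HR) addn0.
  have : size f <= size E.
    rewrite /E /encode_cnf /=; apply: ltnW; apply: ltnW; rewrite !ltnS.
    elim: (f) => //= cl f' IH; rewrite size_cat ltnS; apply: leq_trans IH _; apply: leq_addl.
  by move: E_Bd; clear; lia.
move=> ra HRa ra24 fra.
apply: wp_seq; apply: (wp_set (x := 23) (v := top) _ HRa) => //=.
- by rewrite (rep9 HRa) (rep0 HRa) addn0.
- by rewrite (rep9 HRa) (rep0 HRa); move: top_Bd; clear; lia.
move=> rb HRb rb23 frb.
apply: wp_seq; apply: (wp_set (x := 21) (v := B + 1) _ HRb) => //=.
- by rewrite (rep2 HRb) (rep1 HRb).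
- by rewrite (rep2 HRb) (rep1 HRb); move: VB; clear; lia.
move=> rc HRc rc21 frc.
apply: wp_seq; apply: (wp_set (x := 21) (v := B + 2) _ HRc) => //=.
- by rewrite rc21 (rep1 HRc) -addnA.
- by rewrite rc21 (rep1 HRc); move: VB; clear; lia.
move=> rd HRd rd21 frd; apply: wp_skip.
have pos0 : enc_pos 0 = 2 by rewrite /enc_pos take0.
have posE : enc_pos (size f) = size E by rewrite /enc_pos take_size.
pose Inv j r' n := exists i, [/\ i + j = size f, Rep tab (w ++ gadget k t sat top (take i f)) r',
  r' 21 = B + enc_pos i /\ r' 23 = top + k * i, r' 24 = j & n <= A * (enc_pos i - 2)].
apply: (@wp_while Bd 24 _ Inv (size f)).
- move=> j r1 n jn [i [ij HR1 [r121 r123] r124 Hn]]; rewrite r124; split=> //.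
  have fi : i < size f by rewrite -ij addnS ltnS leq_addr.
  have Et : gadget k t sat top (take i.+1 f) = gadget k t sat top (take i f)
      ++ [seq v <- rev (iota (top + k * i) k) | sat (nth [::] f i) || (v %% k != t)].
    by rewrite (take_nth [::] fi) -cats1 gadget_cat size_take fi /= cats0.
  have rm1 : room ((w ++ gadget k t sat top (take i f)) ++
      [seq v <- rev (iota (top + k * i) k) | sat (nth [::] f i) || (v %% k != t)]).
    rewrite -catA -Et; move: rm; rewrite -{1}(cat_take_drop i.+1 f) gadget_cat catA.
    exact: room_cat.
  have r124' : r1 24 = size f - i by rewrite r124 -ij addKn.
  apply: wp_conseq (wp_emit_clause tk fi Hsat HR1 r121 r123 r124' rm1) _.
  move=> r2 n2 _ [HR2 r221 r223 r224 Hn2]; exists i.+1; split=> //.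
  + by rewrite -ij addnS.
  + by rewrite Et catA.
  + by rewrite r224 -ij addnS -addSn addKn.
  + have [s1 [s2 [_ _ Ep]]] := enc_split fi.
    have -> : enc_pos i.+1 - 2 = (enc_pos i - 2) + (enc_pos i.+1 - enc_pos i).
      by rewrite Ep /enc_pos; clear; lia.
    by rewrite mulnDr; move: Hn Hn2; clear; lia.
- by move=> r1 n [i []].
- exists 0; split=> //; first by rewrite take0 /= cats0.
  + by split; rewrite ?pos0 // muln0 addn0 frd // frc.
  + by rewrite frd // frc // frb.
- move=> r1 m [i [+ HR1 _ _ Hm]]; rewrite addn0 => fi; rewrite fi take_size posE in HR1 Hm.
  split=> //; have S2 : 2 <= size E by [].
  have : A * (size E - 2) + 2 * A = A * size E.
    by rewrite [2 * A]mulnC -mulnDr subnK.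
  by move=> <-; move: Hm A_ge; move: (A * _) => x; clear; lia.
Qed.

Lemma wp_store_cell tab w i j v b x r (Q : regs -> nat -> Prop) : v <= k * ell ->
  Rep tab w r -> r i = tl + (v.*2 + nat_of_bool b) -> r j = nat_of_bool x ->
  (forall r', Rep (fun v' b' => if (v' == v) && (b' == b) then x else tab v' b') w r' ->
     (forall y, y < nscal -> r' y = r y) -> Q r' 1) ->
  wp Bd (Atom (STORE i j)) Q r.
Proof.
move=> vl HR ri rj H; have tl32 : nscal <= tl by rewrite tlE wbE; move: B_ge; clear; lia.
apply: wp_atom; first by rewrite /= ri; move: tl32; clear; lia.
rewrite /= ri rj; apply: H; first exact: Rep_set_tab.
by move=> y y32; rewrite /upd ifN //; move: tl32 y32; clear; lia.
Qed.

(** * The binary counter over the assignments of a block *)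

Definition bits_tab t (bs : seq bool) : nat -> bool -> bool :=
  fun v b => litval ell t bs (v, b).

Lemma bits_tab_set t p x bs bs' v b : p < ell ->
  (forall u, u < ell -> nth false bs' u = if u == p then x else nth false bs u) ->
  bits_tab t bs' v b = if v == t * ell + p then b == x else bits_tab t bs v b.
Proof.
move=> pl H; rewrite /bits_tab /litval /=.
case: (v =P t * ell + p) => [->|vp].
  by rewrite leq_addr mulSnr ltn_add2l pl addKn H // eqxx eq_sym.
case: (boolP (t * ell <= v < t.+1 * ell)) => //= /andP[v1 v2].
congr (_ == b); rewrite H; last by rewrite ltn_subLR // -mulSnr.
by case: eqP => // Ep; case: vp; rewrite -Ep subnKC.
Qed.

(** The case [p = ell] matters: that cell lies outside block [t] and reads 0, which stops the carry
    after the last assignment. *)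
Lemma bits_tab_true t bs p : size bs = ell -> bits_tab t bs (t * ell + p) true = nth false bs p.
Proof.
move=> sb; rewrite /bits_tab /litval /= leq_addr mulSnr ltn_add2l addKn.
by case: ltnP => /= pl; [case: nth|rewrite nth_default // sb].
Qed.

(** The runs that close [q] nested right halves, innermost first. *)
Fixpoint up t q : seq nat :=
  if q is q'.+1 then up t q' ++ level_seq t true false q' else [::].

(** The runs that open [q] nested left halves, outermost first. *)
Fixpoint down t q : seq nat :=
  if q is q'.+1 then level_seq t false false q' ++ down t q' else [::].

Lemma frame_level t suffix full i : i != 11 -> i != 17 -> i != 18 -> i != 19 -> i != 20 ->
  ~~ writes (emit_level k t suffix full) i.
Proof.
move=> h11 /negbTE h17 /negbTE h18 /negbTE h19 /negbTE h20 /=.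
rewrite h17 h18 h19 h20 /= (negbTE (writes_group _ _ _ _ _ _)) ?h19 //= orbF.
case: (suffix); first by elim: (k) => //= n IH; rewrite h19.
by elim: (k.*2) => //= n IH; rewrite h19.
Qed.

Lemma cost_step i s1 s2 : A * (2 * i.+1 + (s1 + s2)) = A * (2 * i + s1) + A * (1 + s2) + A.
Proof. by clear; lia. Qed.

Lemma nth_carry i q (rest : seq bool) u : i < q ->
  nth false (nseq i.+1 false ++ nseq (q - i.+1) true ++ rest) u
  = if u == i then false else nth false (nseq i false ++ nseq (q - i) true ++ rest) u.
Proof.
move=> iq; have -> : q - i = (q - i.+1).+1 by lia.
have -> : nseq i.+1 false = nseq i false ++ [:: false].
  by rewrite -[i.+1]addn1 nseqD.
rewrite -catA 2!(nth_cat _ (nseq i false)) size_nseq; case: ltngtP => // [iu|->].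
  by have -> : u - i = (u - i).-1.+1 by lia.
by rewrite subnn.
Qed.

(** [rest] either starts with 0, an ordinary increment, or is empty, the overflow; both make the
    default-0 lookup end the loop. *)
Lemma wp_carry t q rest w r : t < k -> size (nseq q true ++ rest) = ell ->
  nth false rest 0 = false ->
  Rep (bits_tab t (nseq q true ++ rest)) w r -> r 14 = 0 -> r 15 = tl + (t * ell).*2 ->
  r 16 = nth false (nseq q true ++ rest) 0 -> room (w ++ up t q) ->
  wp Bd (carry_loop k t) (fun r' m =>
    [/\ Rep (bits_tab t (nseq q false ++ rest)) (w ++ up t q) r', r' 14 = q,
      r' 15 = tl + (t * ell + q).*2 & m <= A * (2 * q + size (up t q)) + 1]) r.
Proof.
move=> tk sbs rest0 HR r14 r15 r16 rm.
have qell : q <= ell by rewrite -sbs size_cat size_nseq leq_addr.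
pose bs i := nseq i false ++ nseq (q - i) true ++ rest.
have sb i : i <= q -> size (bs i) = ell.
  by move=> iq; rewrite /bs !size_cat !size_nseq addnA subnKC // -sbs size_cat size_nseq.
have room_up i : i <= q -> room (w ++ up t i).
  elim: (q) rm => [|q' IH] /= rm; first by rewrite leqn0 => /eqP ->.
  by rewrite leq_eqVlt => /orP[/eqP -> //|]; apply: IH; move: rm; rewrite catA; apply: room_cat.
have tke i : i <= ell -> t * ell + i <= k * ell.
  move=> ie; apply: (@leq_trans (t.+1 * ell)); first by rewrite mulSnr leq_add2l.
  by rewrite leq_mul2r tk orbT.
pose Inv j r' n := exists i, [/\ i + j = q, Rep (bits_tab t (bs i)) (w ++ up t i) r',
  r' 14 = i /\ r' 15 = tl + (t * ell + i).*2, r' 16 = nth false (bs i) i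
  & n <= A * (2 * i + size (up t i))].
apply: (@wp_while Bd 16 _ Inv q).
- move=> j r1 n jq [i [ij HR1 [r114 r115] r116 Hn]].
  have iq : i < q by rewrite -ij addnS ltnS leq_addr.
  have il : i < ell by apply: leq_trans qell.
  split.
    rewrite r116 /bs nth_cat size_nseq ltnn subnn nth_cat size_nseq subn_gt0 iq.
    by rewrite nth_nseq subn_gt0 iq.
  have rm1 : room ((w ++ up t i) ++ level_seq t true false i) by rewrite -catA; apply: (room_up i.+1).
  apply: wp_seq; apply: wp_conseq (wp_emit_level tk il HR1 r114 rm1) _ => r2 n2 fr2 [HR2 Hn2].
  have r215 : r2 15 = tl + (t * ell + i).*2 by rewrite fr2 ?frame_level.
  have r214 : r2 14 = i by rewrite fr2 ?frame_level.
  have VBd : V + 2 <= Bd by move: rm; rewrite /room; clear; lia.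
  have cellB : (t * ell + i).*2 + 2 <= (k * ell).*2 by have := tke i.+1 il; clear; lia.
  apply: wp_seq; apply: (wp_set (x := 17) (v := tl + ((t * ell + i).*2 + true)) _ HR2) => //=.
  + by rewrite r215 (rep1 HR2) -addnA.
  + by rewrite r215 (rep1 HR2); move: cellB VBd; rewrite VE; clear; lia.
  move=> r3 HR3 r317 fr3; have vle := tke i (ltnW il).
  apply: wp_seq; apply: (wp_store_cell (b := true) (x := false) vle HR3) => //.
    by rewrite (rep0 HR3).
  move=> r4 HR4 fr4.
  apply: wp_seq; apply: (wp_store_cell (b := false) (x := true) vle HR4).
  + by rewrite fr4 // fr3 // r215 addn0.
  + by rewrite (rep1 HR4).
  move=> r5 HR5 fr5.
  have {}HR5 : Rep (bits_tab t (bs i.+1)) (w ++ up t i.+1) r5.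
    rewrite /= catA; apply: Rep_tab HR5 => v b _ /=.
    rewrite (@bits_tab_set t i false (bs i) (bs i.+1) v b il); last first.
      by move=> u _; apply: nth_carry.
    by case: eqP => //=; case: (b).
  apply: wp_seq; apply: (wp_set (x := 14) (v := i.+1) _ HR5) => //=.
  + by rewrite (rep1 HR5) fr5 // fr4 // fr3 // r214 addn1.
  + rewrite (rep1 HR5) fr5 // fr4 // fr3 // r214.
    by move: il VBd; rewrite VE tlE wbE; clear; lia.
  move=> r6 HR6 r614 fr6.
  have r615 : r6 15 = tl + (t * ell + i).*2 by rewrite fr6 // fr5 // fr4 // fr3.
  apply: wp_seq; apply: (wp_set (x := 15) (v := tl + (t * ell + i).*2 + 1) _ HR6) => //=.
  + by rewrite r615 (rep1 HR6).
  + by rewrite r615 (rep1 HR6); move: cellB VBd; rewrite VE; clear; lia.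
  move=> r7 HR7 r715 fr7.
  apply: wp_seq; apply: (wp_set (x := 15) (v := tl + (t * ell + i.+1).*2) _ HR7) => //=.
  + by rewrite r715 (rep1 HR7); congr upd; clear; lia.
  + by rewrite r715 (rep1 HR7); move: cellB VBd; rewrite VE; clear; lia.
  move=> r8 HR8 r815 fr8.
  apply: wp_seq; apply: (wp_set (x := 17) (v := tl + ((t * ell + i.+1).*2 + true)) _ HR8) => //=.
  + by rewrite r815 (rep1 HR8) -addnA.
  + by rewrite r815 (rep1 HR8); move: cellB VBd; rewrite VE; clear; lia.
  move=> r9 HR9 r917 fr9.
  apply: wp_seq; apply: (wp_set (x := 16) (v := nth false (bs i.+1) i.+1) _ HR9) => //=.
    by rewrite r917 (rep_tab HR9 true) ?tke // bits_tab_true ?sb.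
  move=> r10 HR10 r1016 fr10; apply: wp_skip.
  exists i.+1; split=> //.
  + by rewrite -ij addnS.
  + by rewrite fr10 // fr9 // fr8 // fr7 // fr10 // fr9 // fr8.
  + rewrite /= size_cat cost_step; move: Hn Hn2 A_ge; move: (A * _) (A * _) => x y.
    by clear; lia.
- move=> r1 n [i [ij _ _ -> _]]; rewrite addn0 in ij.
  by rewrite ij /bs subnn cat0s nth_cat size_nseq ltnn subnn rest0.
- by exists 0; split; rewrite /= ?/bs ?subn0 ?cats0 ?addn0.
- move=> r1 m [i [+ HR1 [r114 r115] _ Hm]]; rewrite addn0 => iq; rewrite iq in HR1 r114 r115 Hm.
  have bq : bs q = nseq q false ++ rest by rewrite /bs subnn.
  by rewrite bq in HR1; split=> //; rewrite addn1 ltnS.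
Qed.

(* The emission so far and the part of [down] still due add up to a fixed sequence. *)
Lemma wp_refill tab t q w r : t < k -> q <= ell -> Rep tab w r -> r 14 = q ->
  room (w ++ down t q) ->
  wp Bd (refill_loop k t) (fun r' m =>
    Rep tab (w ++ down t q) r' /\ m <= A * (2 * q + size (down t q)) + 1) r.
Proof.
move=> tk qell HR r14 rm.
pose Inv j r' n := exists w', [/\ j <= q, w' ++ down t j = w ++ down t q, Rep tab w' r', r' 14 = j
  & n + A * (2 * j + size (down t j)) <= A * (2 * q + size (down t q))].
apply: (@wp_while Bd 14 _ Inv q).
- move=> j r1 n jq [w' [_ ww' HR1 r114 Hn]]; rewrite r114; split=> //.
  apply: wp_seq; apply: (wp_set (x := 14) (v := j) _ HR1) => //=.
    by rewrite r114 (rep1 HR1) subn1.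
  move=> r2 HR2 r214 fr2.
  have jl : j < ell by apply: leq_trans qell.
  have ww2 : (w' ++ level_seq t false false j) ++ down t j = w ++ down t q by rewrite -catA.
  have rm1 : room (w' ++ level_seq t false false j).
    by move: rm; rewrite -ww2; apply: room_cat.
  apply: wp_conseq (wp_emit_level tk jl HR2 r214 rm1) _ => r3 n3 fr3 [HR3 Hn3].
  exists (w' ++ level_seq t false false j); split=> //; first exact: ltnW.
    by rewrite fr3 ?frame_level.
  move: Hn; rewrite /= size_cat [size _ + size _]addnC cost_step; move: Hn3 A_ge.
  by move: (A * _) (A * _) (A * _) => x y z; clear; lia.
- by move=> r1 n [w' []].
- by exists w.
- move=> r1 m [w' [_ ww' HR1 _ Hm]]; rewrite -ww' /= cats0; split=> //.
  by rewrite addn1 ltnS; apply: leq_trans (leq_addr _ _) Hm.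
Qed.

Let g t bs := gadget k t (csat ell t bs) top f.

(** The traversal from the first leaf up to, but excluding, the last one, each leaf followed by the
    runs that lead to its successor. *)
Fixpoint inner t p hs : seq nat :=
  if p is q.+1 then
    inner t q (false :: hs) ++
    (g t (nseq q true ++ false :: hs) ++ up t q ++ level_seq t true true q
       ++ level_seq t false true q ++ down t q)
    ++ inner t q (true :: hs)
  else [::].

(** In-order traversal of the recursion tree: open all left halves, make one increment per leaf, and
    end with the last leaf and all closing runs. This is the loop form that the RAM executes. *)
Lemma sep_inner t p hs :
  sep k c top (g t) t p hs = down t p ++ inner t p hs ++ g t (nseq p true ++ hs) ++ up t p.
Proof.
elim: p hs => [|q IH] hs /=; first by rewrite cats0.
rewrite !IH -!catA.
by have -> : nseq q true ++ true :: hs = true :: nseq q true ++ hs by elim: (q) => //= n ->.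
Qed.

(** Work per leaf not charged to output: one pass over the input, up to [2 * ell] each for carrying
    and refilling, and a constant. *)
Definition unit_cost := size E + 4 * ell + 12.

Lemma sat_bits_tab t bs cl : csat ell t bs cl = has (fun l : literal => bits_tab t bs l.1 l.2) cl.
Proof. by apply: eq_has => -[v b]. Qed.

Lemma frame_gadget t i : all (fun j => i != j) [:: 11; 19; 21; 22; 23; 24; 25; 26] ->
  ~~ writes (emit_gadget k t) i.
Proof.
move=> /= /and5P[/negbTE h11 /negbTE h19 /negbTE h21 /negbTE h22 /and5P[/negbTE h23 /negbTE h24
  /negbTE h25 /negbTE h26 _]].
rewrite h21 h22 h23 h24 h25 h26 /= orbF /clause_emit.
by elim: (rev _) => //= s ss IH; case: ifP => _ /=; rewrite ?h19 ?h11 /= (negbTE IH).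
Qed.

Lemma cell_le t i : t < k -> i <= ell -> t * ell + i <= k * ell.
Proof.
move=> tk ie; apply: (@leq_trans (t.+1 * ell)); first by rewrite mulSnr leq_add2l.
by rewrite leq_mul2r tk orbT.
Qed.

Lemma nseq_snoc p (b : bool) hs : nseq p.+1 b ++ hs = nseq p b ++ b :: hs.
Proof. by elim: p => //= p ->. Qed.

Lemma wp_block_head t q rest w r : t < k -> size (nseq q true ++ rest) = ell ->
  nth false rest 0 = false ->
  Rep (bits_tab t (nseq q true ++ rest)) w r -> r 10 = tl + (t * ell).*2 ->
  room (w ++ g t (nseq q true ++ rest) ++ up t q) ->
  wp Bd (block_head k t) (fun r' m =>
    [/\ Rep (bits_tab t (nseq q false ++ rest)) (w ++ g t (nseq q true ++ rest) ++ up t q) r',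
      r' 14 = q, r' 15 = tl + (t * ell + q).*2
      & m <= A * (size E + 2 * q + size (up t q)) + 5]) r.
Proof.
move=> tk sbs rest0 HR r10; rewrite catA => rm.
have VBd : V + 2 <= Bd by move: rm; rewrite /room; clear; lia.
have c0 : (t * ell).*2 <= (k * ell).*2 by rewrite leq_double leq_mul2r ltnW ?orbT.
apply: wp_seq; apply: wp_conseq (wp_emit_gadget tk (sat_bits_tab _ _) HR (room_cat rm)) _.
move=> r1 n1 fr1 [HR1 Hn1].
have r110 : r1 10 = tl + (t * ell).*2 by rewrite fr1 ?frame_gadget.
apply: wp_seq; apply: wp_seq; apply: (wp_set (x := 14) (v := 0) _ HR1) => //=.
move=> r2 HR2 r214 fr2.
apply: wp_seq; apply: (wp_set (x := 15) (v := tl + (t * ell).*2) _ HR2) => //=.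
- by rewrite (rep0 HR2) fr2 // r110 addn0.
- by rewrite (rep0 HR2) fr2 // r110; move: VBd c0; rewrite VE; clear; lia.
move=> r3 HR3 r315 fr3.
apply: wp_seq; apply: (wp_set (x := 17) (v := tl + ((t * ell).*2 + true)) _ HR3) => //=.
- by rewrite r315 (rep1 HR3) -addnA.
- by rewrite r315 (rep1 HR3); move: VBd c0; rewrite VE; clear; lia.
move=> r4 HR4 r417 fr4.
apply: wp_seq; apply: (wp_set (x := 16) (v := nth false (nseq q true ++ rest) 0) _ HR4) => //=.
  rewrite r417 (rep_tab HR4 true); last by move: (cell_le tk (leq0n ell)); rewrite addn0.
  by rewrite -[X in bits_tab _ _ X]addn0 bits_tab_true.
move=> r5 HR5 r516 fr5; apply: wp_skip.
apply: wp_conseq (wp_carry tk sbs rest0 HR5 _ _ r516 rm) _.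
- by rewrite fr5 // fr4 // fr3.
- by rewrite fr5 // fr4.
move=> r6 n6 _ [HR6 r614 r615 Hn6]; split=> //.
have -> : A * (size E + 2 * q + size (up t q)) = A * size E + A * (2 * q + size (up t q)).
  by rewrite -mulnDr addnA.
by move: Hn1 Hn6; move: (A * _) (A * _) => x y; clear; lia.
Qed.

(** One increment: leave [q] right halves, cross the middle at level [q] through its two full runs,
    enter [q] left halves. *)
Definition turn t q hs : seq nat :=
  g t (nseq q true ++ false :: hs) ++ up t q ++ level_seq t true true q
    ++ level_seq t false true q ++ down t q.

Lemma wp_next_block t q hs w r : t < k -> q + (size hs).+1 = ell ->
  Rep (bits_tab t (nseq q true ++ false :: hs)) w r -> r 10 = tl + (t * ell).*2 ->
  room (w ++ turn t q hs) ->
  wp Bd (next_block k t) (fun r' m =>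
    [/\ Rep (bits_tab t (nseq q false ++ true :: hs)) (w ++ turn t q hs) r',
      r' 13 != 0 & m + 2 <= A * (unit_cost + size (turn t q hs))]) r.
Proof.
move=> tk sb HR r10 rm.
have ql : q < ell by rewrite -sb addnS ltnS leq_addr.
have sbs : size (nseq q true ++ false :: hs) = ell by rewrite size_cat size_nseq.
have Et : w ++ turn t q hs = ((((w ++ g t (nseq q true ++ false :: hs) ++ up t q)
    ++ level_seq t true true q) ++ level_seq t false true q) ++ down t q).
  by rewrite /turn -!catA.
have rm4 := rm; rewrite Et in rm4; have rm3 := room_cat rm4.
have rm2 := room_cat rm3; have rm1 := room_cat rm2.
apply: wp_seq; apply: wp_conseq (wp_block_head tk sbs (erefl _) HR r10 rm1) _.
move=> r1 n1 _ [HR1 r114 r115 Hn1].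
apply: wp_seq; apply: (wp_set (x := 13) (v := ell - q) _ HR1) => //=.
  by rewrite (rep5 HR1) r114.
move=> r2 HR2 r213 fr2.
apply: wp_if => r213'; last by move: r213' ql; rewrite r213; clear; lia.
have r214 : r2 14 = q by rewrite fr2.
apply: wp_seq; apply: wp_conseq (wp_emit_level tk ql HR2 r214 rm2) _ => r3 n3 fr3 [HR3 Hn3].
have r315 : r3 15 = tl + (t * ell + q).*2 by rewrite fr3 ?frame_level // fr2.
have vle := cell_le tk (ltnW ql).
apply: wp_seq; apply: wp_seq; apply: (wp_store_cell (b := false) (x := false) vle HR3).
- by rewrite r315 addn0.
- by rewrite (rep0 HR3).
move=> r4 HR4 fr4.
apply: wp_seq; apply: (wp_set (x := 17) (v := tl + ((t * ell + q).*2 + true)) _ HR4) => //=.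
- by rewrite fr4 // r315 (rep1 HR4) -addnA.
- rewrite fr4 // r315 (rep1 HR4); move: rm; rewrite /room VE.
  by move: (cell_le tk ql); clear; lia.
move=> r5 HR5 r517 fr5.
apply: wp_seq; apply: (wp_store_cell (b := true) (x := true) vle HR5) => //.
  by rewrite (rep1 HR5).
move=> r6 HR6 fr6; apply: wp_skip.
have {}HR6 : Rep (bits_tab t (nseq q false ++ true :: hs))
    ((w ++ g t (nseq q true ++ false :: hs) ++ up t q) ++ level_seq t true true q) r6.
  apply: Rep_tab HR6 => v b _ /=.
  rewrite (@bits_tab_set t q true (nseq q false ++ false :: hs) (nseq q false ++ true :: hs) v b ql); last first.
    move=> u _; rewrite !nth_cat size_nseq; case: (ltngtP u q) => [//|qu|->]; last by rewrite subnn.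
    by have -> : u - q = (u - q).-1.+1 by lia.
  by case: eqP => //=; case: (b).
have r614 : r6 14 = q by rewrite fr6 // fr5 // fr4 // fr3 ?frame_level.
apply: wp_seq; apply: wp_conseq (wp_emit_level tk ql HR6 r614 rm3) _ => r7 n7 fr7 [HR7 Hn7].
have r714 : r7 14 = q by rewrite fr7 ?frame_level.
apply: wp_conseq (wp_refill tk (ltnW ql) HR7 r714 rm4) _ => r8 n8 fr8 [HR8 Hn8].
split.
- by rewrite Et.
- have -> : r8 13 = r2 13.
    rewrite fr8 //; last exact: (@frame_level t false false 13 isT isT isT isT isT).
    by rewrite fr7 ?frame_level // fr6 // fr5 // fr4 // fr3 ?frame_level.
  by rewrite r213 subn_eq0 -ltnNge.
rewrite /turn /unit_cost !size_cat.
move: Hn1 Hn3 Hn7 Hn8.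
set s1 := size (g _ _); set s2 := size (up _ _); set s3 := size (level_seq _ _ _ _).
set s4 := size (level_seq _ _ _ _); set s5 := size (down _ _).
have : A * (size E + 2 * q + s2) + A * (1 + s3) + A * (1 + s4) + A * (2 * q + s5) + A * 10
    <= A * (size E + 4 * ell + 12 + (s1 + (s2 + (s3 + (s4 + s5))))).
  by rewrite -!mulnDr leq_mul2l; apply/orP; right; move: ql; clear; lia.
have : 40 <= A * 10 by move: A_ge; clear; lia.
move: (A * (size E + 2 * q + s2)) (A * (1 + s3)) (A * (1 + s4)) (A * (2 * q + s5)).
by move: (A * 10) (A * _) => x0 x1 x2 x3 x4 x5; clear; lia.
Qed.

Lemma wp_last_block t w r : t < k ->
  Rep (bits_tab t (nseq ell true)) w r -> r 10 = tl + (t * ell).*2 ->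
  room (w ++ g t (nseq ell true) ++ up t ell) ->
  wp Bd (next_block k t) (fun r' m =>
    [/\ Rep (bits_tab t (nseq ell false)) (w ++ g t (nseq ell true) ++ up t ell) r',
      r' 13 = 0 & m + 2 <= A * (unit_cost + size (up t ell))]) r.
Proof.
move=> tk; rewrite -[nseq ell true]cats0 => HR r10 rm.
have sbs : size (nseq ell true ++ [::]) = ell by rewrite cats0 size_nseq.
apply: wp_seq; apply: wp_conseq (wp_block_head tk sbs (erefl _) HR r10 rm) _.
move=> r1 n1 _ [HR1 r114 r115 Hn1].
apply: wp_seq; apply: (wp_set (x := 13) (v := 0) _ HR1) => //=.
  by rewrite (rep5 HR1) r114 subnn.
move=> r2 HR2 r213 fr2; apply: wp_if; first by rewrite r213.
move=> _; apply: wp_skip; split=> //; first by rewrite cats0 in HR2.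
rewrite /unit_cost; set s := size (up _ _) in Hn1 *.
have : A * (size E + 2 * ell + s) + A * 12 <= A * (size E + 4 * ell + 12 + s).
  by rewrite -!mulnDr leq_mul2l; apply/orP; right; clear; lia.
have : 40 <= A * 12 by move: A_ge; clear; lia.
by move: (A * (size E + 2 * ell + s)) (A * 12) (A * _) Hn1 => x y z; clear; lia.
Qed.

Lemma writes_seq c1 c2 i : writes (Seq c1 c2) i = writes c1 i || writes c2 i.
Proof. by []. Qed.

Lemma writes_if x c1 c2 i : writes (If x c1 c2) i = writes c1 i || writes c2 i.
Proof. by []. Qed.

Lemma writes_while x c1 i : writes (While x c1) i = writes c1 i.
Proof. by []. Qed.

Lemma frame_next_block t i : (i == 10) || (i == 12) -> ~~ writes (next_block k t) i.
Proof.
case/orP => /eqP ->.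
- have L suffix full := negbTE (@frame_level t suffix full 10 isT isT isT isT isT).
  have G := negbTE (@frame_gadget t 10 isT).
  by rewrite /next_block /block_head /block_tail /carry_loop /refill_loop
    !(G, L, writes_seq, writes_if, writes_while).
- have L suffix full := negbTE (@frame_level t suffix full 12 isT isT isT isT isT).
  have G := negbTE (@frame_gadget t 12 isT).
  by rewrite /next_block /block_head /block_tail /carry_loop /refill_loop
    !(G, L, writes_seq, writes_if, writes_while).
Qed.

Lemma cost_split u x a b d :
  A * (u * (x + 1 + x) + (a + (b + d))) = A * (u * x + a) + A * (u + b) + A * (u * x + d).
Proof. by clear; lia. Qed.

(** Left half, one increment across the middle, right half. The flag stays nonzero, since only the
    overflow at the very last leaf clears it. *)
Lemma iters_inner t p hs w r : t < k -> p + size hs = ell ->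
  Rep (bits_tab t (nseq p false ++ hs)) w r -> r 10 = tl + (t * ell).*2 -> r 13 != 0 ->
  room (w ++ inner t p hs) ->
  exists r' a, [/\ iters Bd 13 (next_block k t) a r r',
    Rep (bits_tab t (nseq p true ++ hs)) (w ++ inner t p hs) r',
    r' 10 = r 10 /\ r' 12 = r 12, r' 13 != 0
    & a <= A * (unit_cost * (2 ^ p).-1 + size (inner t p hs))].
Proof.
move=> tk; elim: p hs w r => [|q IH] hs w r /=.
  by move=> _ HR r10 r13 _; exists r, 0; split=> //; [apply: iters_nil|rewrite cats0].
rewrite -/(turn t q hs) => sh HR r10 r13 rm.
have sh1 : q + size (false :: hs) = ell by rewrite /= addnS.
have sh2 : q + size (true :: hs) = ell by rewrite /= addnS.
rewrite -[false :: nseq q false ++ hs]/(nseq q.+1 false ++ hs) nseq_snoc in HR.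
have Ew : w ++ inner t q (false :: hs) ++ turn t q hs ++ inner t q (true :: hs)
  = ((w ++ inner t q (false :: hs)) ++ turn t q hs) ++ inner t q (true :: hs) by rewrite -!catA.
rewrite Ew in rm *; have rm2 := room_cat rm; have rm1 := room_cat rm2.
have [r1 [a1 [I1 HR1 [r110 r112] r113 Ha1]]] := IH _ _ _ sh1 HR r10 r13 rm1.
rewrite r10 in r110.
have [r2 [a2 [E2 [HR2 r213 Ha2]]]] := wp_next_block tk sh1 HR1 r110 rm2.
have r210 : r2 10 = tl + (t * ell).*2 by rewrite (ev_frame E2) ?frame_next_block.
have r212 : r2 12 = r 12 by rewrite (ev_frame E2) ?frame_next_block.
have [r3 [a3 [I3 HR3 [r310 r312] r313 Ha3]]] := IH _ _ _ sh2 HR2 r210 r213 rm.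
exists r3, (a1 + (a2.+2 + a3)); split=> //.
- by apply: iters_cat I1 _; apply: iters_cons E2 I3.
- by rewrite -[true :: nseq q true ++ hs]/(nseq q.+1 true ++ hs) nseq_snoc.
- by rewrite r310 r312 r210 r10.
move: (turn t q hs) Ha2 => T Ha2; rewrite !size_cat expnS.
have : 0 < 2 ^ q by rewrite expn_gt0.
case: (2 ^ q) Ha1 Ha3 => // x Ha1 Ha3 _; rewrite succnK in Ha1 Ha3.
have -> : (2 * x.+1).-1 = x + 1 + x by clear; lia.
rewrite cost_split.
by move: Ha1 Ha2 Ha3; move: (A * _) (A * _) (A * _) => y1 y2 y3; clear; lia.
Qed.

(** * Whole sequences and the whole instance *)

Definition zero_tab : nat -> bool -> bool := fun _ _ => false.

(* Between initialisation and clearing, the bits of level at least [j] are set to 0. *)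
Definition high_tab t j : nat -> bool -> bool :=
  fun v b => (t * ell + j <= v < t.+1 * ell) && ~~ b.

Lemma high_tab_step t j (x : bool) v b : j < ell ->
  high_tab t (if x then j else j.+1) v b
  = if (v == t * ell + j) && (b == false) then x
    else high_tab t (if x then j.+1 else j) v b.
Proof.
move=> jl; rewrite /high_tab.
have : t * ell + j < t.+1 * ell by rewrite mulSnr ltn_add2l.
case: (b); first by rewrite !andbF.
by move: (t * ell) (t.+1 * ell) => a d; case: (x) => /=; case: (v =P a + j) => //=; clear; lia.
Qed.

Lemma bits_tab_high t v b : bits_tab t (nseq ell false) v b = high_tab t 0 v b.
Proof.
rewrite /bits_tab /litval /high_tab /= addn0 nth_nseq; congr andb.
by case: ifP; case: (b).
Qed.

Lemma wp_init t w r : t < k -> Rep zero_tab w r -> r 14 = ell ->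
  r 15 = tl + (t * ell + ell).*2 -> room (w ++ down t ell) ->
  wp Bd (init_loop k t) (fun r' m =>
    Rep (bits_tab t (nseq ell false)) (w ++ down t ell) r'
    /\ m <= A * (2 * ell + size (down t ell)) + 1) r.
Proof.
move=> tk HR r14 r15 rm.
pose Inv j r' n := exists w', [/\ j <= ell, w' ++ down t j = w ++ down t ell,
  Rep (high_tab t j) w' r', r' 14 = j /\ r' 15 = tl + (t * ell + j).*2
  & n + A * (2 * j + size (down t j)) <= A * (2 * ell + size (down t ell))].
apply: (@wp_while Bd 14 _ Inv ell).
- move=> j r1 n jl [w' [_ ww' HR1 [r114 r115] Hn]]; rewrite r114; split=> //.
  have vle := cell_le tk (ltnW jl).
  apply: wp_seq; apply: wp_seq; apply: (wp_set (x := 14) (v := j) _ HR1) => //=.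
    by rewrite r114 (rep1 HR1) subn1.
  move=> r2 HR2 r214 fr2.
  apply: wp_seq; apply: (wp_set (x := 15) (v := tl + (t * ell + j).*2 + 1) _ HR2) => //=.
    by rewrite fr2 // r115 (rep1 HR2); congr upd; clear; lia.
  move=> r3 HR3 r315 fr3.
  apply: wp_seq; apply: (wp_set (x := 15) (v := tl + (t * ell + j).*2) _ HR3) => //=.
    by rewrite r315 (rep1 HR3) addnK.
  move=> r4 HR4 r415 fr4.
  apply: wp_seq; apply: (wp_store_cell (b := false) (x := true) vle HR4).
  + by rewrite r415 addn0.
  + by rewrite (rep1 HR4).
  move=> r5 HR5 fr5; apply: wp_skip.
  have {}HR5 : Rep (high_tab t j) w' r5.
    by apply: Rep_tab HR5 => v b _; rewrite -(high_tab_step t true).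
  have r514 : r5 14 = j by rewrite fr5 // fr4 // fr3.
  have ww2 : (w' ++ level_seq t false false j) ++ down t j = w ++ down t ell by rewrite -catA.
  have rm1 : room (w' ++ level_seq t false false j).
    by move: rm; rewrite -ww2; apply: room_cat.
  apply: wp_conseq (wp_emit_level tk jl HR5 r514 rm1) _ => r6 n6 fr6 [HR6 Hn6].
  exists (w' ++ level_seq t false false j); split=> //; first exact: ltnW.
    by split; rewrite fr6 ?frame_level // fr5.
  move: Hn; rewrite /= size_cat [size _ + size _]addnC cost_step; move: Hn6 A_ge.
  by move: (A * _) (A * _) (A * _) => x y z; clear; lia.
- by move=> r1 n [w' [_ _ _ []]].
- exists w; split=> //; apply: Rep_tab HR => v b _.
  by rewrite /high_tab /zero_tab mulSnr; case: (b); rewrite ?andbF // andbT; clear; lia.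
- move=> r1 m [w' [_ ww' HR1 _ Hm]]; rewrite -ww' /= cats0; split=> //.
    by apply: Rep_tab HR1 => v b _; rewrite bits_tab_high.
  by rewrite addn1 ltnS; apply: leq_trans (leq_addr _ _) Hm.
Qed.

Lemma wp_clear t w r : t < k -> Rep (bits_tab t (nseq ell false)) w r ->
  r 15 = tl + (t * ell).*2 -> r 20 = ell -> V + 2 <= Bd ->
  wp Bd clear_loop (fun r' m => Rep zero_tab w r' /\ m = 6 * ell + 1) r.
Proof.
move=> tk HR r15 r20 VBd.
pose Inv j r' n := exists i, [/\ i + j = ell, Rep (high_tab t i) w r',
  r' 15 = tl + (t * ell + i).*2, r' 20 = j & n = 6 * i].
apply: (@wp_while Bd 20 _ Inv ell).
- move=> j r1 n jl [i [ij HR1 r115 r120 ->]]; rewrite r120; split=> //.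
  have il : i < ell by rewrite -ij addnS ltnS leq_addr.
  have vle := cell_le tk (ltnW il).
  have cellB : (t * ell + i).*2 + 2 <= (k * ell).*2 by have := cell_le tk il; clear; lia.
  apply: wp_seq; apply: (wp_store_cell (b := false) (x := false) vle HR1).
  + by rewrite r115 addn0.
  + by rewrite (rep0 HR1).
  move=> r2 HR2 fr2.
  have {}HR2 : Rep (high_tab t i.+1) w r2.
    by apply: Rep_tab HR2 => v b _; rewrite -(high_tab_step t false).
  apply: wp_seq; apply: (wp_set (x := 15) (v := tl + (t * ell + i).*2 + 1) _ HR2) => //=.
  + by rewrite (rep1 HR2) fr2 // r115.
  + by rewrite (rep1 HR2) fr2 // r115; move: cellB VBd; rewrite VE; clear; lia.
  move=> r3 HR3 r315 fr3.
  apply: wp_seq; apply: (wp_set (x := 15) (v := tl + (t * ell + i.+1).*2) _ HR3) => //=.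
  + by rewrite (rep1 HR3) r315; congr upd; clear; lia.
  + by rewrite (rep1 HR3) r315; move: cellB VBd; rewrite VE; clear; lia.
  move=> r4 HR4 r415 fr4.
  apply: wp_seq; apply: (wp_set (x := 20) (v := j) _ HR4) => //=.
    by rewrite (rep1 HR4) fr4 // fr3 // fr2 // r120 subn1.
  move=> r5 HR5 r520 fr5; apply: wp_skip.
  exists i.+1; split=> //; first by rewrite -ij addnS.
    by rewrite fr5.
  by clear; lia.
- by move=> r1 n [i []].
- exists 0; split=> //; last by rewrite addn0.
  by apply: Rep_tab HR => v b _; rewrite bits_tab_high.
- move=> r1 m [i [+ HR1 _ _ ->]]; rewrite addn0 => il; rewrite il in HR1 *.
  split; last by rewrite addn1.
  apply: Rep_tab HR1 => v b _.
  by rewrite /high_tab /zero_tab mulSnr; case: (b); rewrite ?andbF // andbT; clear; lia.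
Qed.

Lemma Rep_header tab w s r v : Rep tab (w ++ 0 :: s) r ->
  Rep tab (w ++ v :: s) (upd r (V.+1 + size w) v).
Proof.
case=> [H0 H1 H2 H4 H5 H6 H7 H8 H9 H27 H11 Hin Hw Htab Hmem HV].
have F j : j < V.+1 -> upd r (V.+1 + size w) v j = r j.
  by move=> jV; rewrite /upd; case: eqP => // Ej; move: jV; rewrite Ej; clear; lia.
split; try (rewrite F //; move: B_ge; rewrite VE tlE wbE; clear; lia).
- by rewrite F ?H11 ?size_cat //; move: B_ge; rewrite VE tlE wbE; clear; lia.
- by move=> j jS; rewrite F ?Hin //; move: S_le jS; rewrite VE tlE wbE; clear; lia.
- by move=> p pl; rewrite F ?Hw //; move: pl; rewrite VE tlE wbE; clear; lia.
- move=> u b ul; rewrite F ?Htab //; have := leq_b1 b; move: ul; rewrite VE tlE wbE.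
  by clear; lia.
- move=> j; rewrite /upd eqn_add2l; case: eqP => [->|jw].
    by rewrite nth_cat ltnn subnn.
  rewrite Hmem !nth_cat; case: (ltngtP j (size w)) => [//|wj|wj]; last by case: jw.
  by have -> : j - size w = (j - size w).-1.+1 by move: wj; clear; lia.
Qed.

Lemma lcis_seqE t : lcis_seq k ell f t
  = down t ell ++ inner t ell [::] ++ g t (nseq ell true) ++ up t ell.
Proof. by rewrite -[nseq ell true]cats0 -sep_inner /lcis_seq /g topE cE. Qed.

Lemma frame_init t i : (i == 10) || (i == 12) -> ~~ writes (init_loop k t) i.
Proof.
case/orP => /eqP ->.
- have L suffix full := negbTE (@frame_level t suffix full 10 isT isT isT isT isT).
  by rewrite /init_loop !(L, writes_seq, writes_while).
- have L suffix full := negbTE (@frame_level t suffix full 12 isT isT isT isT isT).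
  by rewrite /init_loop !(L, writes_seq, writes_while).
Qed.

Lemma wp_emit_sequence t w r : t < k -> Rep zero_tab w r ->
  room (w ++ size (lcis_seq k ell f t) :: lcis_seq k ell f t) ->
  wp Bd (emit_sequence k t) (fun r' m =>
    Rep zero_tab (w ++ size (lcis_seq k ell f t) :: lcis_seq k ell f t) r'
    /\ m <= A * (2 * (unit_cost * 2 ^ ell) + size (lcis_seq k ell f t))) r.
Proof.
move=> tk HR; rewrite lcis_seqE.
set s1 := down t ell; set s2 := inner t ell [::]; set s3 := g t _; set s4 := up t ell.
move=> rm0.
have rm : room ((((w ++ [:: 0]) ++ s1) ++ s2) ++ s3 ++ s4).
  by move: rm0; rewrite /room !size_cat /= !size_cat; clear; lia.
have rm3 := room_cat rm; have rm2 := room_cat rm3; have rm1 := room_cat rm2.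
have VBd : V.+1 + size w + 2 <= Bd by move: rm1; rewrite /room size_cat /=; clear; lia.
have c0 : (t * ell).*2 <= (k * ell).*2 by rewrite leq_double leq_mul2r ltnW ?orbT.
have c1 : (t * ell + ell).*2 <= (k * ell).*2 by rewrite leq_double cell_le.
apply: wp_seq; apply: wp_seq; apply: (wp_set (x := 12) (v := V.+1 + size w) _ HR) => //=.
- by rewrite (rep11 HR) (rep0 HR) addn0.
- by rewrite (rep11 HR) (rep0 HR); move: VBd; clear; lia.
move=> ra HRa ra12 fra.
apply: wp_seq; apply: (wp_set (x := 19) (v := 0) _ HRa) => //=.
move=> rb HRb rb19 frb; apply: wp_skip.
rewrite cats1 in rm1 rm2 rm3 rm.
apply: wp_seq; apply: wp_conseq (wp_emit_val HRb rb19 rm1) _ => rc nc frc [HRc ->].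
apply: wp_seq; apply: (wp_set (x := 10) (v := tl) _ HRc) => //=.
- by rewrite (rep7 HRc) (rep0 HRc) addn0.
- by rewrite (rep7 HRc) (rep0 HRc); move: VBd; rewrite VE; clear; lia.
move=> rd HRd rd10 frd.
have e10 : rd 10 + t.*2 * rd 5 = tl + (t * ell).*2 by rewrite rd10 (rep5 HRd) -!mul2n mulnA.
apply: wp_seq; apply: wp_conseq (wp_add_times (n := t.*2) (x := 10) (y := 5) _ _) _ => //.
  by rewrite e10; move: VBd c0; rewrite VE; clear; lia.
move=> re ne _ [-> re10 fre]; rewrite e10 in re10.
have HRe : Rep zero_tab (rcons w 0) re.
  by apply: Rep_agree HRd => i iR; apply: fre; apply: contraTneq iR => ->.
apply: wp_seq; apply: wp_seq; apply: (wp_set (x := 14) (v := ell) _ HRe) => //=.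
- by rewrite (rep5 HRe) (rep0 HRe) addn0.
- by rewrite (rep5 HRe) (rep0 HRe); move: VBd; rewrite VE tlE; clear; lia.
move=> rf HRf rf14 frf.
apply: wp_seq; apply: (wp_set (x := 15) (v := tl + (t * ell).*2 + ell) _ HRf) => //=.
- by rewrite (rep5 HRf) frf // re10.
- by rewrite (rep5 HRf) frf // re10; move: VBd c1; rewrite VE; clear; lia.
move=> rg HRg rg15 frg.
apply: wp_seq; apply: (wp_set (x := 15) (v := tl + (t * ell + ell).*2) _ HRg) => //=.
- by rewrite (rep5 HRg) rg15; congr upd; clear; lia.
- by rewrite (rep5 HRg) rg15; move: VBd c1; rewrite VE; clear; lia.
move=> rh HRh rh15 frh; apply: wp_skip.
have rh14 : rh 14 = ell by rewrite frh // frg.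
apply: wp_seq; apply: wp_conseq (wp_init tk HRh rh14 rh15 rm2) _ => ri ni fri [HRi Hni].
apply: wp_seq; apply: (wp_set (x := 13) (v := 1) _ HRi) => //=.
  by move: VBd; clear; lia.
move=> rj HRj rj13 frj.
have rj10 : rj 10 = tl + (t * ell).*2.
  by rewrite frj // fri ?frame_init // frh // frg // frf.
have rj12 : rj 12 = V.+1 + size w.
  by rewrite frj // fri ?frame_init // frh // frg // frf // fre // frd // frc // frb.
have HRj' : Rep (bits_tab t (nseq ell false ++ [::])) (rcons w 0 ++ s1) rj by rewrite cats0.
have [|rk [a [I HRk [rk10 rk12] rk13 Ha]]] := @iters_inner t ell [::] _ _ tk (addn0 _) HRj' rj10 _ rm3.
  by rewrite rj13.
rewrite cats0 in HRk; rewrite rj10 in rk10.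
have [rl [m [El [HRl rl13 Hm]]]] := wp_last_block tk HRk rk10 rm.
(* The increments up to the last leaf, followed by the overflow that clears the flag. *)
have I2 : iters Bd 13 (next_block k t) (a + (m.+2 + 0)) rj rl.
  by apply: iters_cat I _; apply: iters_cons El (iters_nil _ _ _ _).
have rl10 : rl 10 = tl + (t * ell).*2 by rewrite (ev_frame El) ?frame_next_block.
have rl12 : rl 12 = V.+1 + size w by rewrite (ev_frame El) ?frame_next_block // rk12.
apply: wp_seq; apply: (iters_while I2).
exists rl, 1; split; first exact: ev_while0.
apply: wp_seq; apply: wp_seq; apply: (wp_set (x := 15) (v := tl + (t * ell).*2) _ HRl) => //=.
- by rewrite (rep0 HRl) rl10 addn0.
- by rewrite (rep0 HRl) rl10; move: VBd c0; rewrite VE; clear; lia.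
move=> rn HRn rn15 frn.
apply: wp_seq; apply: (wp_set (x := 20) (v := ell) _ HRn) => //=.
- by rewrite (rep5 HRn) (rep0 HRn) addn0.
- by rewrite (rep5 HRn) (rep0 HRn); move: VBd; rewrite VE tlE; clear; lia.
move=> ro HRo ro20 fro; apply: wp_skip.
have ro15 : ro 15 = tl + (t * ell).*2 by rewrite fro.
have VBd' : V + 2 <= Bd by move: VBd; clear; lia.
apply: wp_seq; apply: wp_conseq (wp_clear tk HRo ro15 ro20 VBd') _ => rp np frp [HRp ->].
have rp12 : rp 12 = V.+1 + size w by rewrite frp // fro // frn.
pose L := size s1 + (size s2 + (size s3 + size s4)).
have Lsz : size (s1 ++ s2 ++ s3 ++ s4) = L by rewrite /L !size_cat.
apply: wp_seq; apply: (wp_set (x := 17) (v := L.+1) _ HRp) => //=.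
  rewrite (rep11 HRp) rp12; congr upd.
  by rewrite -!catA !size_cat size_rcons /L -/s2 -/s3 -/s4; clear; lia.
move=> rq HRq rq17 frq.
apply: wp_seq; apply: (wp_set (x := 17) (v := L) _ HRq) => //=.
  by rewrite rq17 (rep1 HRq) subn1.
move=> rs HRs rs17 frs.
have rs12 : rs 12 = V.+1 + size w by rewrite frs // frq.
apply: wp_seq; apply: wp_atom; first by rewrite /= rs12; move: B_ge; rewrite VE tlE wbE; clear; lia.
apply: wp_skip; rewrite Lsz; split.
  rewrite /= rs12 rs17; apply: Rep_header.
  by move: HRs; rewrite -!catA cat_rcons.
move: Hni Ha Hm; rewrite -/s1 -/s2 -/s4 => Hni Ha Hm.
have u12 : 4 * ell + 12 <= unit_cost by rewrite /unit_cost; clear; lia.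
have x0 : 0 < 2 ^ ell by rewrite expn_gt0.
have Hs : A * (2 * ell + size s1) + A * (unit_cost * (2 ^ ell).-1 + size s2) + A * (unit_cost + size s4) + A * ell + A * 1
    <= A * (2 * (unit_cost * 2 ^ ell) + L).
  rewrite -!mulnDr leq_mul2l; apply/orP; right; rewrite /L.
  have : unit_cost <= unit_cost * 2 ^ ell by rewrite leq_pmulr.
  have : unit_cost * (2 ^ ell).-1 + unit_cost = unit_cost * 2 ^ ell by rewrite -mulnSr prednK.
  by move: u12; move: unit_cost (size _) (size _) (size _) (size _) (2 ^ ell) (_.-1) => *; lia.
rewrite muln1 in Hs; have : 6 * ell <= A * ell by rewrite leq_mul2r; apply/orP; right; move: A_ge; clear; lia.
have : t.*2 + 40 <= A by move: A_ge tk; clear; lia.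
move: Hni Ha Hm Hs; move: (A * (2 * ell + size s1)) (A * (_ + size s2)) (A * (_ + size s4)) (A * ell) => y1 y2 y3 y4.
by move: (A * _) => y5; clear; lia.
Qed.

Lemma wp_emit_range a n w r : a + n <= k -> Rep zero_tab w r ->
  room (w ++ encode_LCIS [seq lcis_seq k ell f t | t <- iota a n]) ->
  wp Bd (cseq [seq emit_sequence k t | t <- iota a n]) (fun r' m =>
    Rep zero_tab (w ++ encode_LCIS [seq lcis_seq k ell f t | t <- iota a n]) r'
    /\ m <= A * (n * (2 * (unit_cost * 2 ^ ell))
                 + size (encode_LCIS [seq lcis_seq k ell f t | t <- iota a n]))) r.
Proof.
elim: n a w r => [|n IH] a w r an HR rm.
  by apply: wp_skip; rewrite cats0.
have tk : a < k by move: an; clear; lia.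
have Ee : encode_LCIS [seq lcis_seq k ell f t | t <- iota a n.+1]
  = (size (lcis_seq k ell f a) :: lcis_seq k ell f a)
     ++ encode_LCIS [seq lcis_seq k ell f t | t <- iota a.+1 n] by [].
rewrite Ee catA in rm *; have rm1 := room_cat rm.
apply: wp_seq; apply: wp_conseq (wp_emit_sequence tk HR rm1) _ => r1 n1 _ [HR1 Hn1].
have an' : a.+1 + n <= k by rewrite addSnnS.
apply: wp_conseq (IH _ _ _ an' HR1 rm) _ => r2 n2 _ [HR2 Hn2]; split=> //.
rewrite size_cat mulSn [size (_ :: _)]/=; move: Hn1 Hn2.
move: (size (lcis_seq _ _ _ _)) (size (encode_LCIS _)) => x y.
move: (2 * _) => u; move: (n * u) => nu.
have : A * (u + x) + A * (nu + y) <= A * (u + nu + (x.+1 + y)).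
  by rewrite -mulnDr leq_mul2l; apply/orP; right; clear; lia.
by move: (A * (u + x)) (A * (nu + y)) (A * _) => *; lia.
Qed.

Lemma wp_emit_all w r : Rep zero_tab w r ->
  room (w ++ encode_LCIS (lcis_instance k ell f)) ->
  wp Bd (emit_all k) (fun r' m => Rep zero_tab (w ++ encode_LCIS (lcis_instance k ell f)) r'
    /\ m <= A * (k * (2 * (unit_cost * 2 ^ ell)) + size (encode_LCIS (lcis_instance k ell f)))) r.
Proof. exact: wp_emit_range. Qed.

End Emission.

(** * Moving the input and filling the tables *)

Definition save_regs (a n : nat) : seq instr :=
  flatten [seq [:: ADD 0 0 1; STORE 0 j] | j <- iota a n].

(* On entry every register may hold input: doubling register 0, which holds the input size,
   gives an address beyond the input where the static registers can be saved. *)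
Definition prelude : seq instr :=
  nseq 6 (ADD 0 0 0) ++ [:: STORE 0 1; CONST 1 1] ++ save_regs 2 30
    ++ [:: CONST 2 30; SUB 2 0 2; CONST 0 0].

Definition copy_loop : cmd :=
  While 20 (atoms [:: LOAD 26 14; STORE 15 26; ADD 14 14 1; ADD 15 15 1; SUB 20 20 1]).

Definition table_loop : cmd :=
  While 20 (atoms [:: STORE 15 18; ADD 18 18 18; ADD 15 15 1; SUB 20 20 1]).

Definition setup (k : nat) : cmd :=
  Seq (atoms [:: CONST 14 32; ADD 15 2 14; SUB 15 15 1; SUB 20 2 14])
  (Seq copy_loop
  (Seq (atoms [:: LOAD 3 2; ADD 17 2 1; LOAD 4 17; CONST 5 1; CONST 18 k])
  (Seq (While 3 (atoms [:: SUB 3 3 18; ADD 5 5 1]))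
  (Seq (Atom (CONST 28 0))
  (Seq (atoms (nseq k (ADD 28 28 4)))
  (Seq (atoms [:: ADD 6 2 2; ADD 7 6 5; ADD 8 7 1; ADD 8 8 1])
  (Seq (atoms (nseq k.*2 (ADD 8 8 5)))
  (Seq (atoms [:: ADD 18 28 0; ADD 15 6 0; ADD 20 5 0])
  (Seq table_loop
  (Seq (Atom (CONST 9 0))
  (Seq (atoms (nseq k (ADD 9 9 18)))
  (Seq (Atom (ADD 27 9 0))
  (Seq (atoms (nseq k (SUB 27 27 28)))
    (atoms [:: ADD 27 27 4; ADD 11 8 1])))))))))))))).

Lemma wp_assign Bd x v i r (Q : regs -> nat -> Prop) :
  aexec i r = upd r x v -> aok Bd i r ->
  (forall r', r' x = v -> (forall y, y != x -> r' y = r y) -> Q r' 1) ->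
  wp Bd (Atom i) Q r.
Proof.
move=> E ok H; apply: wp_atom => //; rewrite E; apply: H; first by rewrite /upd eqxx.
by move=> y /negbTE yx; rewrite /upd yx.
Qed.

(** * Saving the static registers *)

Section Prelude.

Variables (Bd : nat) (inp : seq nat).
Hypotheses (inp2 : 2 <= size inp) (inp_Bd : 64 * size inp + 64 <= Bd)
  (val_Bd : all (geq Bd) inp).

(** Six doublings of the input length. The input has at least two entries, so [B >= 128] is clear of
    the static registers and of the input. *)
Let B := 64 * size inp.

(** Registers 1 to [j - 1] have been saved. On entry register [i.+1] holds entry [i], which accounts
    for the offsets. *)
Definition saved (j : nat) (r : regs) : Prop :=
  [/\ r 0 = B + (j - 2), r 1 = 1, forall i, i < j - 1 -> r (B + i) = nth 0 inp i
    & forall q, 2 <= q -> (q < B) || (B + (j - 1) <= q) -> r q = nth 0 inp q.-1].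

Lemma saved_step j r : 2 <= j < 32 -> saved j r ->
  aoks Bd [:: ADD 0 0 1; STORE 0 j] r /\ saved j.+1 (run_atoms [:: ADD 0 0 1; STORE 0 j] r).
Proof.
move=> j32 [H0 H1 Hi Hq]; have B128 : 128 <= B by rewrite /B; move: inp2; clear; lia.
rewrite /= H0 H1 /upd /= !andbT; split.
  apply/andP; split; first by move: inp_Bd j32; rewrite -/B; clear; lia.
  by move: B128; clear; lia.
have E0 a : (0 == B + a) = false by move: B128; clear; lia.
have E1 a : (1 == B + a) = false by move: B128; clear; lia.
have Ej : (j == 0) = false by move: j32; clear; lia.
have a1 : B + (j - 2) + 1 = B + (j.+1 - 2) by move: j32; clear; lia.
rewrite /saved a1 E0 E1 eqxx Ej; split=> //.
- move=> i ij; rewrite eqn_add2l (_ : (B + i == 0) = false); last by move: B128; clear; lia.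
  case: eqP => [->|iE]; last by apply: Hi; move: ij iE; clear; lia.
  rewrite Hq; last by move: j32 B128; clear; lia.
  + by congr nth; move: j32; clear; lia.
  + by move: j32; clear; lia.
- move=> q q2 qB; rewrite ifN; last by move: j32 qB; clear; lia.
  rewrite ifN; last by move: q2; clear; lia.
  by apply: Hq => //; move: qB; clear; lia.
Qed.

Lemma saved_iter n j r : 2 <= j -> j + n <= 32 -> saved j r ->
  aoks Bd (save_regs j n) r /\ saved (j + n) (run_atoms (save_regs j n) r).
Proof.
elim: n j r => [|n IH] j r j2 jn H; first by rewrite addn0.
have j32 : 2 <= j < 32 by rewrite j2; move: jn; clear; lia.
have [H1 H2] := saved_step j32 H.
have -> : save_regs j n.+1 = [:: ADD 0 0 1; STORE 0 j] ++ save_regs j.+1 n by [].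
rewrite aoks_cat run_atoms_cat H1 -addSnnS; apply: IH => //; first exact: ltnW.
by rewrite addSnnS.
Qed.

Lemma init_regsE q : 0 < q -> init_regs inp q = nth 0 inp q.-1.
Proof.
by case: q => // q _; rewrite /init_regs /=; case: leqP => // H; rewrite nth_default.
Qed.

Lemma init_regs_le a : init_regs inp a <= Bd.
Proof.
rewrite /init_regs; case: eqP => a0; first by move: inp_Bd; clear; lia.
case: ifP => // aS; have /(all_nthP 0)/(_ a.-1) := val_Bd; apply.
by move: a0 aS; clear; lia.
Qed.

Lemma double_zero n r : 2 ^ n * r 0 <= Bd ->
  aoks Bd (nseq n (ADD 0 0 0)) r /\
  forall q, run_atoms (nseq n (ADD 0 0 0)) r q = if q == 0 then 2 ^ n * r 0 else r q.
Proof.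
elim: n r => [|n IH] r; first by rewrite mul1n => _; split=> // q; case: eqP => // ->.
rewrite expnS => H /=; have [|H1 H2] := IH (upd r 0 (r 0 + r 0)).
  by rewrite /upd /=; move: H; clear; lia.
split.
  rewrite H1 andbT; apply: leq_trans H.
  by have : 0 < 2 ^ n by [rewrite expn_gt0]; move: (2 ^ n) => x; clear; nia.
by move=> q; rewrite H2 /upd /=; case: eqP => // _; move: (2 ^ n) => x; clear; lia.
Qed.

Definition after_prelude (r : regs) : Prop :=
  [/\ r 0 = 0, r 1 = 1, r 2 = B, forall i, i < 31 -> r (B + i) = nth 0 inp i
    & forall q, 32 <= q -> (q < B) || (B + 31 <= q) -> r q = nth 0 inp q.-1].

Lemma prelude_correct :
  aoks Bd prelude (init_regs inp) /\ after_prelude (run_atoms prelude (init_regs inp)).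
Proof.
have B128 : 128 <= B by rewrite /B; move: inp2; clear; lia.
have sv r : saved 2 r -> aoks Bd (save_regs 2 30) r /\ saved 32 (run_atoms (save_regs 2 30) r).
  exact: saved_iter.
have [|A1 D1] := @double_zero 6 (init_regs inp).
  by rewrite /init_regs /=; move: inp_Bd; clear; lia.
rewrite /prelude; move: (save_regs 2 30) (nseq 6 _) sv A1 D1 => s6 s0 sv A1 D1.
rewrite !(aoks_cat, run_atoms_cat) A1.
move: (run_atoms s0 _) D1 => r1 D1; rewrite /=.
have r10 : r1 0 = B by rewrite D1.
have S2 : saved 2 (upd (upd r1 (r1 0) (r1 1)) 1 1).
  rewrite r10 /saved /upd /=; split=> //.
  - by rewrite ifN ?r10 ?addn0 //; move: B128; clear; lia.
  - move=> i i1; have -> : i = 0 by move: i1; clear; lia.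
    rewrite addn0 eqxx ifN; last by move: B128; clear; lia.
    by rewrite D1 /= init_regsE.
  - move=> q q2 qB; rewrite ifN; last by move: q2; clear; lia.
    rewrite ifN; last by move: qB; clear; lia.
    rewrite D1 ifN; last by move: q2; clear; lia.
    by rewrite init_regsE //; move: q2; clear; lia.
have [A2 [H0 H1 Hi Hq]] := sv _ S2.
rewrite A2; move: (run_atoms s6 _) H0 H1 Hi Hq => r2 H0 H1 Hi Hq.
have r20 : r2 0 = B + 30 by rewrite H0.
rewrite /= r10; split.
  by move: B128 inp_Bd inp2; clear; lia.
rewrite /after_prelude /upd /= r20; split=> //; first by rewrite addnK.
- by move=> i i31; rewrite !ifN; [exact: Hi|move: B128; clear; lia..].
- move=> q q32 qB; rewrite !ifN; [|by move: q32; clear; lia..].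
  by apply: Hq qB; apply: leq_trans q32.
Qed.

End Prelude.

(** * Copying the input and computing the parameters *)

Section Setup.

Variables (Bd k N ell B wb tl V c top thr : nat) (f : cnf).
Let E := encode_cnf N f.
Hypotheses (k_ge3 : 3 <= k) (BE : B = 64 * size E).
Hypotheses (ellE : ell = 1 + (N + k.-1) %/ k).
Hypotheses (wbE : wb = B + B) (tlE : tl = wb + ell) (VE : V = tl + (k * ell).*2 + 2).
Hypotheses (cE : c = k * size f) (topE : top = k * (c * 2 ^ ell)).
Hypothesis thrE : thr = threshold k ell f.
Hypothesis room_Bd : V + top + top + size f + k + 2 <= Bd.

Definition core (r : regs) : Prop :=
  [/\ r 0 = 0, r 1 = 1, r 2 = B, forall i, i < B -> r (B + i) = nth 0 E i
    & forall q, B + B <= q -> r q = 0].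

Let E2 : 2 <= size E. Proof. by []. Qed.
Let B128 : 128 <= B. Proof. by rewrite BE; move: E2; move: (size E) => x; clear; lia. Qed.
Let EB : size E <= B. Proof. by rewrite BE; move: (size E) => x; clear; lia. Qed.

Lemma core_frame r r' : (forall y, (y < 3) || (32 <= y) -> r' y = r y) -> core r -> core r'.
Proof.
move=> H [H0 H1 H2 H3 H4]; split; rewrite ?H //.
- by move=> i iB; rewrite H ?H3 //; move: B128; clear; lia.
- by move=> q qB; rewrite H ?H4 //; move: B128 qB; clear; lia.
Qed.

(** Only [B] is still at hand, not the input length, so all cells from 32 to [B - 1] are copied;
    those past the input are zeros. *)
Lemma wp_copy r : after_prelude E r -> r 14 = 32 -> r 15 = B + 31 -> r 20 = B - 32 ->
  wp Bd copy_loop (fun r' m => core r' /\ m = 7 * (B - 32) + 1) r.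
Proof.
rewrite /after_prelude -BE => -[H0 H1 H2 Hi Hq] r14 r15 r20.
have BBd : B + B <= Bd by move: room_Bd; rewrite VE tlE wbE; clear; lia.
pose Inv j r' n := exists i, [/\ i + j = B - 32, [/\ r' 0 = 0, r' 1 = 1 & r' 2 = B],
  [/\ r' 14 = 32 + i, r' 15 = B + 31 + i & r' 20 = j],
  (forall u, u < 31 + i -> r' (B + u) = nth 0 E u)
  /\ (forall q, 32 <= q -> (q < B) || (B + 31 + i <= q) -> r' q = nth 0 E q.-1) & n = 7 * i].
apply: (@wp_while Bd 20 _ Inv (B - 32)).
- move=> j r1 n jB [i [ij [r10 r11 r12] [r114 r115 r120] [Hu Hw] ->]]; rewrite r120; split=> //.
  have iB : i < B - 32 by move: ij; clear; lia.
  apply: wp_seq; apply: (@wp_assign _ 26 (nth 0 E (31 + i))) => //=.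
    by rewrite r114 Hw //; move: iB; clear; lia.
  move=> r2 r226 fr2.
  apply: wp_seq; apply: wp_atom.
    by rewrite /= fr2 // r115; move: B128; clear; lia.
  rewrite /= r226 fr2 // r115; set r3 := upd r2 _ _.
  have r3s y : y < 32 -> r3 y = r2 y.
    by move=> y32; rewrite /r3 /upd ifN //; move: B128 y32; clear; lia.
  have r3u u : u < 31 + i.+1 -> r3 (B + u) = nth 0 E u.
    move=> ui; rewrite /r3 /upd -addnA eqn_add2l; case: eqP => [->//|un].
    by rewrite fr2 ?Hu //; move: ui un B128; clear; lia.
  have r3q q : 32 <= q -> (q < B) || (B + 31 + i.+1 <= q) -> r3 q = nth 0 E q.-1.
    move=> q32 qB; rewrite /r3 /upd ifN; last by move: q32 qB iB; clear; lia.
    by rewrite fr2 ?Hw //; move: qB q32; clear; lia.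
  move: r3 r3s r3u r3q => r3 r3s r3u r3q.
  have r31 : r3 1 = 1 by rewrite r3s // fr2.
  apply: wp_seq; apply: (@wp_assign _ 14 (32 + i.+1)) => //=.
  + by rewrite r3s // fr2 // r31 r114; congr upd; clear; lia.
  + by rewrite r3s // fr2 // r31 r114; move: iB BBd; clear; lia.
  move=> r4 r414 fr4.
  apply: wp_seq; apply: (@wp_assign _ 15 (B + 31 + i.+1)) => //=.
  + by rewrite !fr4 // r31 r3s // fr2 // r115; congr upd; clear; lia.
  + by rewrite !fr4 // r31 r3s // fr2 // r115; move: iB BBd; clear; lia.
  move=> r5 r515 fr5.
  apply: wp_seq; apply: (@wp_assign _ 20 j) => //=.
    by rewrite !fr5 // !fr4 // r31 r3s // fr2 // r120 subn1.
  move=> r6 r620 fr6; apply: wp_skip.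
  have fr y : y != 14 -> y != 15 -> y != 20 -> r6 y = r3 y.
    by move=> ? ? ?; rewrite fr6 // fr5 // fr4.
  exists i.+1; split=> //.
  + by rewrite -ij addnS.
  + by split; rewrite fr ?r3s ?fr2.
  + by split=> //; [rewrite fr6 // fr5 //|rewrite fr6].
  + split=> [u ui|q q32 qB]; first by rewrite !fr ?r3u //; move: B128; clear; lia.
    by rewrite !fr ?r3q //; move: q32; clear; lia.
  + by clear; lia.
- by move=> r1 n [i [_ _ []]].
- by exists 0; rewrite !addn0; split.
- move=> r1 m [i [+ [r10 r11 r12] _ [Hu Hw] ->]]; rewrite addn0 => iB.
  split; last by rewrite iB addn1.
  split=> // [u uB|q qB].
    case: (ltnP u (31 + i)) => [/Hu //|ui].
    have uE : size E <= u by move: ui BE iB E2; move: (size E) => x; clear; lia.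
    rewrite Hw; [|by move: B128 ui; clear; lia..].
    by rewrite !nth_default //; move: uE B128; clear; lia.
  rewrite Hw; [|by move: B128 qB iB; clear; lia..].
  by rewrite nth_default //; move: EB qB B128; move: (size E) => x; clear; lia.
Qed.

(** Truncated subtraction of [k] reaches 0 after [N / k] rounds, rounded up; starting the count at 1
    keeps [ell] positive even for [N = 0]. *)
Lemma wp_ell_loop r : core r -> r 3 = N -> r 5 = 1 -> r 18 = k -> N <= k * ell ->
  wp Bd (While 3 (atoms [:: SUB 3 3 18; ADD 5 5 1])) (fun r' m =>
    [/\ r' 5 = ell, forall y, y != 3 -> y != 5 -> r' y = r y & m <= 4 * ell + 1]) r.
Proof.
move=> [_ r1 _ _ _] r3 r5 r18 Nell.
have k0 : 0 < k by apply: leq_trans k_ge3.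
have ellBd : ell + 1 <= Bd by move: room_Bd; rewrite VE tlE; clear; lia.
pose Inv j r' n := exists i, [/\ i + j = ell.-1, r' 3 = N - k * i, r' 5 = 1 + i,
  forall y, y != 3 -> y != 5 -> r' y = r y & n = 4 * i].
apply: (@wp_while Bd 3 _ Inv ell.-1).
- move=> j s n jl [i [ij s3 s5 fs ->]].
  have iell : i < (N + k.-1) %/ k by move: ij; rewrite ellE /=; move: (_ %/ _) => x; clear; lia.
  have kiN : k * i < N.
    have := leq_mul iell (leqnn k); have := leq_divM (N + k.-1) k; move: (_ %/ _) => x.
    by rewrite mulSn mulnC; move: k0; clear; lia.
  split; first by rewrite s3; move: kiN; clear; lia.
  apply: wp_seq; apply: (@wp_assign _ 3 (N - k * i.+1)) => //=.
    by rewrite s3 fs // r18; congr upd; rewrite mulnS; clear; lia.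
  move=> t t3 ft.
  apply: wp_seq; apply: (@wp_assign _ 5 (1 + i.+1)) => //=.
  + by rewrite !ft // s5 fs // r1; congr upd; clear; lia.
  + rewrite !ft // s5 fs // r1.
    by move: ij ellBd; clear; lia.
  move=> u u5 fu; apply: wp_skip; exists i.+1; split=> //.
  + by rewrite -ij addnS.
  + by rewrite fu.
  + by move=> y y3 y5; rewrite fu // ft // fs.
  + by clear; lia.
- move=> s n [i [ij -> _ _ _]]; rewrite addn0 in ij; rewrite ij ellE /=.
  apply/eqP; rewrite subn_eq0.
  have := ltn_ceil (N + k.-1) k0; rewrite mulSn mulnC; move: k0; move: (_ * _) => x; clear; lia.
- by exists 0; split=> //; rewrite muln0 subn0.
- move=> s m [i [+ _ s5 fs ->]]; rewrite addn0 => il; split=> //.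
    by rewrite s5 il ellE.
  by rewrite il ellE /=; move: (_ %/ _) => x; clear; lia.
Qed.

Lemma wp_table r : core r -> r 15 = wb -> r 18 = c -> r 20 = ell ->
  wp Bd table_loop (fun r' m =>
    [/\ r' 18 = c * 2 ^ ell, forall p, p < ell -> r' (wb + p) = c * 2 ^ p,
      forall y, y != 15 -> y != 18 -> y != 20 -> (y < wb) || (wb + ell <= y) -> r' y = r y
      & m = 6 * ell + 1]) r.
Proof.
move=> [_ r1 _ _ _] r15 r18 r20.
have ellBd : V <= Bd by move: room_Bd; clear; lia.
have ctop i : i <= ell -> c * 2 ^ i <= top.
  move=> il; rewrite topE; apply: (@leq_trans (c * 2 ^ ell)).
    by rewrite leq_mul2l leq_exp2l // il orbT.
  by rewrite leq_pmull //; apply: leq_trans k_ge3.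
pose Inv j r' n := exists i, [/\ i + j = ell, [/\ r' 15 = wb + i, r' 18 = c * 2 ^ i & r' 20 = j],
  forall p, p < i -> r' (wb + p) = c * 2 ^ p,
  forall y, y != 15 -> y != 18 -> y != 20 -> (y < wb) || (wb + ell <= y) -> r' y = r y & n = 6 * i].
apply: (@wp_while Bd 20 _ Inv ell).
- move=> j s n jl [i [ij [s15 s18 s20] sp fs ->]]; rewrite s20; split=> //.
  have il : i < ell by move: ij; clear; lia.
  have s1 : s 1 = 1 by rewrite fs // wbE; move: B128; clear; lia.
  apply: wp_seq; apply: wp_atom; first by rewrite /= s15 wbE; move: B128; clear; lia.
  rewrite /= s15 s18; set t := upd s _ _.
  have ts y : y < 32 -> t y = s y.
    by move=> y32; rewrite /t /upd ifN // wbE; move: B128 y32; clear; lia.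
  have tp p : p < i.+1 -> t (wb + p) = c * 2 ^ p.
    by move=> pi; rewrite /t /upd eqn_add2l; case: eqP => [->//|pn]; apply: sp; move: pi pn; clear; lia.
  have tf y : y != 15 -> y != 18 -> y != 20 -> (y < wb) || (wb + ell <= y) -> t y = r y.
    by move=> ? ? ? yw; rewrite /t /upd ifN ?fs //; move: yw il; clear; lia.
  move: t ts tp tf => t ts tp tf.
  have t1 : t 1 = 1 by rewrite ts.
  apply: wp_seq; apply: (@wp_assign _ 18 (c * 2 ^ i.+1)) => //=.
  + by rewrite !ts // s18 expnS mulnCA mul2n addnn.
  + by rewrite !ts // s18 addnn -mul2n mulnCA -expnS; apply: leq_trans (ctop _ il) _; move: room_Bd; clear; lia.
  move=> u u18 fu.
  apply: wp_seq; apply: (@wp_assign _ 15 (wb + i.+1)) => //=.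
  + by rewrite !fu // t1 ts // s15 addn1 addnS.
  + by rewrite !fu // t1 ts // s15; move: il ellBd; rewrite VE tlE; clear; lia.
  move=> v v15 fv.
  apply: wp_seq; apply: (@wp_assign _ 20 j) => //=.
    by rewrite !fv // !fu // t1 ts // s20 subn1.
  move=> x x20 fx; apply: wp_skip; exists i.+1; split=> //.
  + by rewrite -ij addnS.
  + by split; rewrite // fx // fv.
  + by move=> p pi; rewrite fx ?fv ?fu ?tp //; rewrite wbE; move: B128; clear; lia.
  + by move=> y y15 y18 y20 yw; rewrite fx // fv // fu // tf.
  + by clear; lia.
- by move=> s n [i [_ [_ _ ->]]].
- by exists 0; split=> //; [split; rewrite // ?addn0 // muln1].
- move=> s m [i [+ [s15 s18 s20] sp fs ->]]; rewrite addn0 => il; rewrite il in s18 sp *.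
  by split=> //; rewrite addn1.
Qed.

Lemma wp_setup r : after_prelude E r -> N <= k * ell ->
  wp Bd (setup k) (fun r' m =>
    Rep k N ell B wb tl V c top thr f zero_tab [::] r' /\ m <= 8 * B + 20 * ell + 10 * k + 40) r.
Proof.
move=> HP Nell; have [p0 p1 p2 _ _] := HP.
have VBd : V + 2 <= Bd by move: room_Bd; clear; lia.
have BV : B + B + ell + 2 <= V by rewrite VE tlE wbE; clear; lia.
have ctop : c * 2 ^ ell <= top by rewrite topE leq_pmull //; apply: leq_trans k_ge3.
have ccx : c <= c * 2 ^ ell by rewrite leq_pmulr // expn_gt0.
have kctop : k * c <= top by rewrite topE leq_mul2l ccx orbT.
rewrite -BE in p2.
apply: wp_seq.
apply: wp_seq; apply: (@wp_assign _ 14 32) => //=; first by move: B128 BV VBd; clear; lia.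
move=> r1 r114 fr1.
apply: wp_seq; apply: (@wp_assign _ 15 (B + 32)) => //=.
- by rewrite r114 fr1 // p2.
- by rewrite r114 fr1 // p2; move: B128 BV VBd; clear; lia.
move=> r2 r215 fr2.
apply: wp_seq; apply: (@wp_assign _ 15 (B + 31)) => //=.
  by rewrite r215 fr2 // fr1 // p1; congr upd; clear; lia.
move=> r3 r315 fr3.
apply: wp_seq; apply: (@wp_assign _ 20 (B - 32)) => //=.
  by rewrite !fr3 // !fr2 // r114 fr1 // p2.
move=> r4 r420 fr4; apply: wp_skip.
have fr y : y != 14 -> y != 15 -> y != 20 -> r4 y = r y.
  by move=> ? ? ?; rewrite fr4 // fr3 // fr2 // fr1.
have HP4 : after_prelude E r4.
  have big y : 32 <= y -> r4 y = r y by move=> y32; apply: fr; move: y32; clear; lia.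
  have [q0 q1 q2 qi qq] := HP; split; rewrite ?fr //.
  - by move=> i i31; rewrite big ?qi //; move: B128; rewrite BE; clear; lia.
  - by move=> q q32 qB; rewrite big // qq.
have r414 : r4 14 = 32 by rewrite fr4 // fr3 // fr2.
have r415 : r4 15 = B + 31 by rewrite fr4.
apply: wp_seq; apply: wp_conseq (wp_copy HP4 r414 r415 r420) _ => ra na _ [Ha ->].
have [a0 a1 a2 ai aq] := Ha.
apply: wp_seq.
apply: wp_seq; apply: (@wp_assign _ 3 N) => //=.
  by rewrite a2 -[B]addn0 ai //; move: B128; clear; lia.
move=> rb b3 fb.
apply: wp_seq; apply: (@wp_assign _ 17 (B + 1)) => //=.
- by rewrite !fb // a2 a1.
- by rewrite !fb // a2 a1; move: BV VBd; clear; lia.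
move=> rc c17 fc.
apply: wp_seq; apply: (@wp_assign _ 4 (size f)) => //=.
  by rewrite c17 fc ?fb ?ai //; move: B128; clear; lia.
move=> rd d4 fd.
apply: wp_seq; apply: (@wp_assign _ 5 1) => //=; first by move: VBd; clear; lia.
move=> re e5 fe.
apply: wp_seq; apply: (@wp_assign _ 18 k) => //=; first by move: room_Bd; clear; lia.
move=> rg g18 fg; apply: wp_skip.
have Hg : core rg.
  by apply: core_frame Ha => y y3; rewrite fg ?fe ?fd ?fc ?fb //; move: y3; clear; lia.
have g3 : rg 3 = N by rewrite fg // fe // fd // fc.
have g5 : rg 5 = 1 by rewrite fg.
have g4 : rg 4 = size f by rewrite fg // fe.
apply: wp_seq; apply: wp_conseq (wp_ell_loop Hg g3 g5 g18 Nell) _.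
move=> rh nh _ [h5 fh Hnh].
have Hh : core rh by apply: core_frame Hg => y y3; apply: fh; move: y3; clear; lia.
have h4 : rh 4 = size f by rewrite fh.
apply: wp_seq; apply: (@wp_assign _ 28 0) => //=.
move=> ri i28 fi.
have ei : ri 28 + k * ri 4 = c by rewrite i28 fi // h4 add0n cE.
apply: wp_seq; apply: wp_conseq (wp_add_times (n := k) (x := 28) (y := 4) _ _) _ => //.
  by rewrite ei; move: ccx ctop room_Bd; clear; lia.
move=> rj nj _ [-> j28 fj]; rewrite ei in j28.
have Hj : core rj by apply: core_frame Hh => y y3; rewrite fj ?fi //; move: y3; clear; lia.
have [j0 j1 j2 _ _] := Hj.
have j5 : rj 5 = ell by rewrite fj // fi.
have j4 : rj 4 = size f by rewrite fj // fi.
apply: wp_seq; apply: wp_seq; apply: (@wp_assign _ 6 wb) => //=.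
- by rewrite j2 wbE.
- by rewrite j2; move: BV VBd; clear; lia.
move=> rk k6 fk.
apply: wp_seq; apply: (@wp_assign _ 7 tl) => //=.
- by rewrite k6 fk // j5 tlE.
- by rewrite k6 fk // j5 -tlE; move: VBd; rewrite VE; clear; lia.
move=> rl l7 fl.
apply: wp_seq; apply: (@wp_assign _ 8 (tl + 1)) => //=.
- by rewrite l7 fl // fk // j1.
- by rewrite l7 fl // fk // j1; move: VBd; rewrite VE; clear; lia.
move=> rm m8 fm.
apply: wp_seq; apply: (@wp_assign _ 8 (tl + 2)) => //=.
- by rewrite m8 fm // fl // fk // j1 -addnA.
- by rewrite m8 fm // fl // fk // j1; move: VBd; rewrite VE; clear; lia.
move=> rn n8 fn; apply: wp_skip.
have n5 : rn 5 = ell by rewrite fn // fm // fl // fk.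
have en : rn 8 + k.*2 * rn 5 = V by rewrite n8 n5 VE -!mul2n mulnA; clear; lia.
apply: wp_seq; apply: wp_conseq (wp_add_times (n := k.*2) (x := 8) (y := 5) _ _) _ => //.
  by rewrite en; move: VBd; clear; lia.
move=> ro no _ [-> o8 fo]; rewrite en in o8.
have Ho : core ro.
  by apply: core_frame Hj => y y3; rewrite fo ?fn ?fm ?fl ?fk //; move: y3; clear; lia.
have [o0 o1 o2 _ _] := Ho.
have o28 : ro 28 = c by rewrite fo // fn // fm // fl // fk.
have o6 : ro 6 = wb by rewrite fo // fn // fm // fl.
have o7 : ro 7 = tl by rewrite fo // fn // fm.
have o5 : ro 5 = ell by rewrite fo.
have o4 : ro 4 = size f by rewrite fo // fn // fm // fl // fk.
apply: wp_seq; apply: wp_seq; apply: (@wp_assign _ 18 c) => //=.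
- by rewrite o28 o0 addn0.
- by rewrite o28 o0; move: ccx ctop room_Bd; clear; lia.
move=> rp p18 fp.
apply: wp_seq; apply: (@wp_assign _ 15 wb) => //=.
- by rewrite !fp // o6 o0 addn0.
- by rewrite !fp // o6 o0; move: VBd BV; rewrite wbE; clear; lia.
move=> rq q15 fq.
apply: wp_seq; apply: (@wp_assign _ 20 ell) => //=.
- by rewrite !fq // !fp // o5 o0 addn0.
- by rewrite !fq // !fp // o5 o0; move: VBd BV; clear; lia.
move=> rs s20 fs; apply: wp_skip.
have Hs : core rs.
  by apply: core_frame Ho => y y3; rewrite fs ?fq ?fp //; move: y3; clear; lia.
have s15 : rs 15 = wb by rewrite fs.
have s18 : rs 18 = c by rewrite fs // fq.
apply: wp_seq; apply: wp_conseq (wp_table Hs s15 s18 s20) _ => rt nt _ [t18 tw ft ->].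
have wb32 : 32 <= wb by rewrite wbE; move: B128; clear; lia.
have tlow y : y < 32 -> y != 15 -> y != 18 -> y != 20 -> rt y = ro y.
  move=> y32 y15 y18 y20; rewrite ft //; last by move: y32 wb32; clear; lia.
  by rewrite fs // fq // fp.
apply: wp_seq; apply: (@wp_assign _ 9 0) => //=.
move=> ru u9 fu.
have eu : ru 9 + k * ru 18 = top by rewrite u9 fu // t18 topE.
apply: wp_seq; apply: wp_conseq (wp_add_times (n := k) (x := 9) (y := 18) _ _) _ => //.
  by rewrite eu; move: room_Bd; clear; lia.
move=> rv nv _ [-> v9 fv]; rewrite eu in v9.
apply: wp_seq; apply: (@wp_assign _ 27 top) => //=.
- by rewrite v9 fv // fu // tlow // o0 addn0.
- by rewrite v9 fv // fu // tlow // o0; move: room_Bd; clear; lia.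
move=> rw w27 fw.
apply: wp_seq; apply: wp_conseq (wp_sub_times _ k (x := 27) (y := 28) _ _) _ => //.
move=> rx nx _ [-> x27 fx].
rewrite w27 fw // fv // fu // tlow // o28 in x27.
(* Since [top = k * (c * 2 ^ ell)], subtracting [c] from it [k] times gives the separator part of
   the threshold. *)
have thr_e : top - k * c + size f = thr.
  rewrite thrE /threshold -cE topE; congr addn.
  by rewrite -mulnBr -{2}[c]muln1 -mulnBr subn1.
apply: wp_seq; apply: (@wp_assign _ 27 thr) => //=.
- by rewrite x27 fx // fw // fv // fu // tlow // o4 thr_e.
- by rewrite x27 fx // fw // fv // fu // tlow // o4; move: room_Bd; clear; lia.
move=> ry y27 fy.
have ryo y : y < 32 -> y \notin [:: 9; 15; 18; 20; 27] -> ry y = ro y.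
  rewrite !inE !negb_or => y32 /and5P[y9 y15 y18 y20 y27'].
  by rewrite fy // fx // fw // fv // fu // tlow.
have ryt y : 32 <= y -> ry y = rt y.
  by move=> y32; rewrite fy ?fx ?fw ?fv ?fu //; move: y32; clear; lia.
apply: wp_seq; apply: (@wp_assign _ 11 V.+1) => //=.
- by rewrite !ryo // o8 o1 addn1.
- by rewrite !ryo // o8 o1; move: VBd; clear; lia.
move=> rz z11 fz; apply: wp_skip.
have rzo y : y < 32 -> y \notin [:: 9; 11; 15; 18; 20; 27] -> rz y = ro y.
  rewrite !inE !negb_or => y32 /and5P[y9 y11 y15 y18 /andP[y20 y27']].
  by rewrite fz ?ryo // !inE !negb_or y9 y15 y18 y20 y27'.
have rzt y : 32 <= y -> rz y = rt y.
  by move=> y32; rewrite fz ?ryt //; move: y32; clear; lia.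
have rts y : 32 <= y -> (y < wb) || (wb + ell <= y) -> rt y = rs y.
  by move=> y32 yw; apply: ft => //; move: y32; clear; lia.
have [_ _ _ si sq] := Hs.
split; last first.
  by move: Hnh B128; clear; lia.
split; try by rewrite rzo.
- by rewrite fz // fy // fx // fw.
- by rewrite fz.
- by rewrite z11 addn0.
- move=> j jS; have jB : j < B := leq_trans jS EB.
  rewrite rzt; [rewrite rts|]; [by rewrite si|..]; rewrite ?wbE; move: B128 jB; clear; lia.
- by move=> p pl; rewrite rzt ?tw //; move: wb32; clear; lia.
- move=> v b vl; have := leq_b1 b; rewrite rzt ?rts ?sq //; move: wb32; rewrite tlE wbE; clear; lia.
- move=> i; rewrite nth_nil rzt ?rts ?sq //; move: wb32 BV; rewrite ?wbE; clear; lia.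
- by rewrite rzt ?rts ?sq //; move: wb32 BV; rewrite ?wbE; clear; lia.
Qed.

End Setup.

(** * The satisfiability program *)

(** The output length [11 - 8 - 1] goes to cell [V], that is, register 0 of the simulated machine,
    as [init_regs] prescribes. *)
Definition reduction_cmd (k : nat) : cmd :=
  Seq (setup k) (Seq (emit_all k) (atoms [:: SUB 17 11 8; SUB 17 17 1; STORE 8 17])).

Definition sim_start (k : nat) : nat := size prelude + csize (reduction_cmd k).

(** The truncated difference is 0 exactly when the answer reaches the threshold. After [CONST 0 1]
    execution runs off the end, which halts. *)
Definition compare_code (o : nat) : seq instr :=
  [:: LOAD 17 8; SUB 17 27 17; JZ 17 (o + 5); CONST 0 0; HALT; CONST 0 1].

Definition sat_program (k : nat) (P : program) : program :=
  prelude ++ compile (size prelude) (reduction_cmd k) ++ sim_code P (sim_start k)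
    ++ compare_code (sim_start k + 10 * size P).

(** * Well-formedness of the generated code *)

Lemma wf_cseq cs : wf (cseq cs) = all wf cs.
Proof. by elim: cs => //= c cs ->. Qed.

Lemma wf_group t full a n : wf (group t full a n).
Proof. by rewrite wf_cseq all_map; apply/allP => s _ /=; case: ifP. Qed.

Lemma wf_atoms is_ : wf (atoms is_) = all awf is_.
Proof. by rewrite wf_cseq all_map. Qed.

Lemma wf_level k t suffix full : wf (emit_level k t suffix full).
Proof.
rewrite /emit_level /= wf_group /= andbT.
by case: suffix; rewrite wf_atoms all_nseq orbT.
Qed.

Lemma wf_gadget k t : wf (emit_gadget k t).
Proof.
rewrite /emit_gadget /emit_clause /= !andbT wf_cseq all_map; apply/allP => s _ /=.
by case: ifP.
Qed.

Lemma wf_seq c1 c2 : wf (Seq c1 c2) = wf c1 && wf c2.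
Proof. by []. Qed.

Lemma wf_if x c1 c2 : wf (If x c1 c2) = (x < nscal) && wf c1 && wf c2.
Proof. by []. Qed.

Lemma wf_while x c1 : wf (While x c1) = (x < nscal) && wf c1.
Proof. by []. Qed.

Lemma wf_sequence k t : wf (emit_sequence k t).
Proof.
rewrite /emit_sequence /init_loop /next_block /block_head /block_tail /carry_loop /refill_loop.
by rewrite !(wf_gadget, wf_level, wf_atoms, wf_seq, wf_if, wf_while) all_nseq /= !orbT.
Qed.

Lemma wf_reduction k : wf (reduction_cmd k).
Proof.
rewrite /reduction_cmd /setup !(wf_atoms, wf_seq, wf_while) !all_nseq /emit_all wf_cseq all_map.
rewrite !orbT /= andbT; by apply/allP => t _; apply: wf_sequence.
Qed.

(** * Running the complete program *)

Section Reduction.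

Variables (k d N : nat) (f : cnf) (P : program).
Hypotheses (k_ge3 : 3 <= k) (f_dcnf : is_dcnf d N f).

Let E := encode_cnf N f.
Let ell := 1 + (N + k.-1) %/ k.
Let B := 64 * size E.
Let wb := B + B.
Let tl := wb + ell.
Let V := tl + (k * ell).*2 + 2.
Let c := k * size f.
Let top := k * (c * 2 ^ ell).
Let thr := threshold k ell f.
Let Xs := lcis_instance k ell f.
Let w := encode_LCIS Xs.
Let A := 10 * k + 40.
Let Bd := V + tl + 2 * top + B + 2 * N + size E + k + size w + size f + 200.
(** The final 80 pays for 71 instructions of the prelude, 3 that store the output length, and 6
    units for the comparison and the end of the simulation. *)
Let steps := 8 * B + 20 * ell + 10 * k + 40
  + A * (k * (2 * ((size E + 4 * ell + 12) * 2 ^ ell)) + size w) + 80.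

Lemma N_le_ell : N <= k * ell.
Proof.
have k0 : 0 < k by apply: leq_trans k_ge3.
have := ltn_ceil (N + k.-1) k0; rewrite /ell add1n mulnC.
by move: k0; move: (_ * _) => x; clear; lia.
Qed.

Lemma dcnf_lt : all (all (fun l : literal => l.1 < N)) f.
Proof. by apply: sub_all f_dcnf => cl /andP[]. Qed.

Lemma encode_le : all (geq (2 * N + size E)) E.
Proof.
have Hf := dcnf_lt.
have Hs : size E = (size (flatten [seq encode_clause cl | cl <- f])).+2 by [].
have Hm : size f <= size (flatten [seq encode_clause cl | cl <- f]).
  elim: (f) => //= cl f' IH; rewrite size_cat ltnS; apply: leq_trans IH _; apply: leq_addl.
rewrite Hs /=; apply/and3P; split; [by clear; lia|by move: Hm; clear; lia|].
have gen f' S : all (all (fun l : literal => l.1 < N)) f' ->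
    size (flatten [seq encode_clause cl | cl <- f']) <= S ->
    all (geq (2 * N + S.+2)) (flatten [seq encode_clause cl | cl <- f']).
  elim: f' => //= cl f' IH /andP[Hcl Hf'].
  rewrite size_cat size_map => HS; rewrite all_cat.
  apply/and3P; split.
  - apply: (@leq_trans S); last by clear; lia.
    by apply: leq_trans (leq_trans _ (leqnSn _)) HS; apply: leq_addr.
  - rewrite all_map; apply/allP => -[v b] /(allP Hcl) /= vN.
    by have := leq_b1 b; move: vN; clear; lia.
  - by apply: IH => //; apply: leq_trans (leq_trans _ (leqnSn _)) HS; apply: leq_addl.
exact: gen.
Qed.

Lemma reduction_run fuel rP cP : rP 0 <= Bd ->
  exec P fuel 0 (init_regs w) 0 = Some (rP, cP) ->
  exists fuel' r' cost, [/\ exec (sat_program k P) fuel' 0 (init_regs E) 0 = Some (r', cost),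
    r' 0 = (thr <= rP 0) & cost <= steps * tau Bd + 250 * (bitlen Bd * cP)].
Proof.
move=> rPB HP; set Q := sat_program k P.
have E2 : 2 <= size E by [].
have inpBd : 64 * size E + 64 <= Bd by rewrite /Bd -/B; clear; lia.
have valBd : all (geq Bd) E.
  apply: sub_all encode_le => x; rewrite -[geq _ _]/(x <= _) -[geq Bd x]/(x <= Bd) /Bd.
  by clear; lia.
have [Aok Apost] := prelude_correct E2 inpBd.
have C0 : code_at Q 0 Q by exists [::], [::]; rewrite cats0.
have [C1 C'] := code_at_cat C0; have [C2 C''] := code_at_cat C'.
have [C3 C4] := code_at_cat C''.
rewrite add0n in C2; rewrite add0n size_compile -/(sim_start k) in C3 C4.
rewrite size_sim_code in C4.
have sizeQ : size Q = sim_start k + 10 * size P + 6.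
  have sz (a b e h : program) : size (a ++ b ++ e ++ h) = size a + size b + size e + size h.
    by rewrite !size_cat !addnA.
  by rewrite /Q /sat_program sz size_compile size_sim_code.
clearbody Q.
have S1 := star_atoms (init_regs E) C1 isT.
have [cost1 bnd1] := atoms_cost_le (is_ := prelude) isT Aok (init_regs_le inpBd valBd).
move: (run_atoms prelude _) (atoms_cost prelude _) Apost S1 cost1 bnd1 => r1 n1 Apost S1 cost1 bnd1.
have EB : size E <= B by rewrite /B; move: (size E) E2 => x; clear; lia.
have B128 : 128 <= B by rewrite /B; move: (size E) E2 => x; clear; lia.
have roomBd : V + top + top + size f + k + 2 <= Bd by rewrite /Bd; clear; lia.
have topBd : top + top + B <= Bd by rewrite /Bd; clear; lia.
have EBd : V + N.*2 + size (encode_cnf N f) + tl + k <= Bd by rewrite /Bd -/E; clear; lia.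
have Wset := wp_setup k_ge3 (erefl B) (erefl ell) (erefl wb) (erefl tl) (erefl V)
  (erefl c) (erefl top) (erefl thr) roomBd Apost N_le_ell.
have red : wp Bd (reduction_cmd k) (fun r' m =>
    [/\ forall a, r' (V + a) = init_regs w a, r' 8 = V, r' 0 = 0, r' 27 = thr
      & m + 80 <= steps + 3]) r1.
  apply: wp_seq; apply: wp_conseq Wset _ => r2 n2 _ [HR2 Hn2].
  have rmw : room Bd V ([::] ++ encode_LCIS (lcis_instance k ell f)).
    by rewrite /room /= -/Xs -/w /Bd; clear; lia.
  have Wall := wp_emit_all k_ge3 B128 EB (erefl wb) (erefl tl) (erefl V) (erefl c) (erefl top)
    topBd (leqnn A) N_le_ell dcnf_lt EBd HR2 rmw.
  apply: wp_seq; apply: wp_conseq Wall _ => r3 n3 _ [HR3 Hn3].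
  rewrite /= -/Xs -/w in HR3 Hn3.
  have V32 : 32 <= V by rewrite /V /tl /wb; move: B128; clear; lia.
  have Va a : V + a < 32 = false by move: V32; clear; lia.
  apply: wp_seq; apply: (@wp_assign _ 17 (size w).+1) => //=.
    by rewrite (rep11 HR3) (rep8 HR3); congr upd; clear; lia.
  move=> r4 r417 fr4.
  apply: wp_seq; apply: (@wp_assign _ 17 (size w)) => //=.
    by rewrite r417 fr4 // (rep1 HR3) subn1.
  move=> r5 r517 fr5.
  have fr y : y != 17 -> r5 y = r3 y by move=> y17; rewrite fr5 // fr4.
  apply: wp_seq; apply: wp_atom; first by rewrite /= fr // (rep8 HR3).
  apply: wp_skip; rewrite /= fr // (rep8 HR3) r517.
  have fs y : y < 32 -> upd r5 V (size w) y = r5 y.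
    by move=> y32; rewrite /upd ifN //; move: y32 V32; clear; lia.
  split; rewrite ?fs ?fr ?(rep8 HR3) ?(rep0 HR3) ?(rep27 HR3) //.
  - case=> [|a]; first by rewrite addn0 /upd eqxx.
    rewrite init_regsE // /upd ifN; last by clear; lia.
    by rewrite addnS -addSn fr ?(rep_mem HR3) //; move: V32; clear; lia.
  - by move: Hn2 Hn3; rewrite /unit_cost /steps -/E; move: (A * _) => x; clear; lia.
have [r2 [n2 [E2' [m2 H8 H0 H27 Hn2]]]] := red.
have [a0 _ _ _ _] := Apost.
have [d2 [D2 S2]] := compile_correct E2' (wf_reduction k) bnd1 a0 C2.
have V32 : nscal <= V by rewrite /V /tl /wb; move: B128; clear; lia.
(* From [V] on, memory is exactly the initial state of [P] on input [w]. *)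
have rel : sim_rel V r2 (init_regs w) r2 by split.
have [r3 [d3 [S3 [m3 G8 G0 G27] D3]]] := sim_exec V32 C3 HP rel.
rewrite {1}/sim_target min0n muln0 addn0 /sim_target minnn in S3.
set o := sim_start k + 10 * size P in S3 C4.
have r30 : r3 V = rP 0 by rewrite -[V]addn0 m3.
rewrite H27 in G27.
have bV : bitlen V <= bitlen Bd by apply: leq_bitlen; rewrite /Bd; clear; lia.
have bL : bitlen (rP 0) <= bitlen Bd by apply: leq_bitlen.
have thr_top : thr <= top + size f.
  rewrite /thr /threshold leq_add2r leq_mul2l leq_mul2l leq_pred.
  by rewrite !orbT.
have bT : bitlen thr <= bitlen Bd.
  by apply: leq_bitlen; apply: leq_trans thr_top _; rewrite /Bd; clear; lia.
have bTL : bitlen (thr - rP 0) <= bitlen Bd by apply: leq_trans (bitlen_sub _ _) bT.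
pose is1 := [:: LOAD 17 8; SUB 17 27 17].
have [C5 C6] := code_at_cat (c1 := is1) C4.
rewrite -[o + size is1]/(o + 2) in C6.
have S4 := star_atoms r3 C5 isT; rewrite -[o + size is1]/(o + 2) in S4.
have c4 : atoms_cost is1 r3 <= 40 + 5 * bitlen Bd.
  rewrite /= /upd /= G8 r30 G27.
  have -> : bitlen 17 = 5 by []. have -> : bitlen 8 = 4 by []. have -> : bitlen 27 = 5 by [].
  by move: bV bL bT; clear; lia.
have r417 : run_atoms is1 r3 17 = thr - rP 0 by rewrite /= /upd /= G8 r30 G27.
move: (run_atoms is1 r3) (atoms_cost is1 r3) S4 c4 r417 => r4 d4 S4 c4 r417.
have [C7 C8] := code_at_cons C6; have [o1 o2] := code_at_nth C7.
have [C9 C10] := code_at_cons C8; have [C11 C12] := code_at_cons C10.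
have [C13 _] := code_at_cons (code_at_cons C10).2.
have S5 : star Q (o + 2) r4 (1 + bitlen 17 + bitlen (thr - rP 0))
    (if thr - rP 0 == 0 then o + 5 else (o + 2).+1) r4.
  by apply: star1; rewrite /step leqNgt o1 /= o2 r417.
have total d5 : d5 <= 3 ->
  0 + (n1 + (d2 + (d3 + (d4 + ((1 + bitlen 17 + bitlen (thr - rP 0)) + d5)))))
    <= steps * tau Bd + 250 * (bitlen Bd * cP).
  move=> d53; have -> : bitlen 17 = 5 by [].
  rewrite subn0 in D3.
  have D3' : bitlen V * cP <= bitlen Bd * cP by rewrite leq_mul2r bV orbT.
  have sz : size prelude = 71 by [].
  have stn : (71 + n2 + 6) * tau Bd <= steps * tau Bd.
    by rewrite leq_mul2r; apply/orP; right; move: Hn2; clear; lia.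
  have TE : tau Bd = 16 + 2 * bitlen Bd by [].
  rewrite sz in cost1; move: stn cost1 D2 D3 D3' c4 bTL d53 TE.
  move: (steps * tau Bd) (tau Bd) (bitlen V * cP) (bitlen Bd * cP) (bitlen Bd) (bitlen (_ - _)).
  by clear; move=> S T x y b e; rewrite !mulnDl; move: (n2 * T) => z; lia.
case: (leqP thr (rP 0)) S5 => [le|lt] S5.
- have z : (thr - rP 0 == 0) by rewrite subn_eq0.
  rewrite z in S5; have [p1 p2] := code_at_nth C13.
  have S6 : star Q (o + 5) r4 (1 + bitlen 0 + bitlen 1) (o + 6) (upd r4 0 1).
    apply: star1; have e5 : (o + 2).+3 = o + 5 by clear; lia.
    by rewrite e5 in p1 p2; rewrite /step leqNgt p1 /= p2 -addnS.
  have St := star_trans S1 (star_trans S2 (star_trans S3 (star_trans S4 (star_trans S5 S6)))).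
  have Stop : step Q (o + 6) (upd r4 0 1) = None.
    by rewrite /step sizeQ leqnn.
  have [fuel' Ex] := star_exec 0 Stop St.
  by do 3 eexists; split; [exact: Ex|rewrite /upd eqxx|apply: total].
- have z : (thr - rP 0 == 0) = false by rewrite subn_eq0 leqNgt lt.
  rewrite z in S5; have [p1 p2] := code_at_nth C9.
  have S6 : star Q (o + 2).+1 r4 (1 + bitlen 0 + bitlen 0) (o + 2).+2 (upd r4 0 0).
    by apply: star1; rewrite /step leqNgt p1 /= p2.
  have St := star_trans S1 (star_trans S2 (star_trans S3 (star_trans S4 (star_trans S5 S6)))).
  have Stop : step Q (o + 2).+2 (upd r4 0 0) = None.
    by have [q1 q2] := code_at_nth C11; rewrite /step leqNgt q1 /= q2.
  have [fuel' Ex] := star_exec 0 Stop St.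
  by do 3 eexists; split; [exact: Ex|rewrite /upd eqxx|apply: total].
Qed.

(** * Estimates of sizes and costs *)

Let q := size E * ell.+1.
Let z := 2 ^ ell * q.
(** Costs are stated in three units: [q] is the polynomial factor, and contains [ell] because [N] is
    not bounded by the input length; [z] adds the exponential [2 ^ ell]; powers of [K] absorb [k]
    and the numerical constants. *)
Let K := 100 * k.

Lemma size_instance_le X : X \in Xs -> size X <= 2 ^ ell * (k * size f * (1 + 2 * k * ell)).
Proof. by case/mapP => t _ ->; apply: size_lcis_seq. Qed.

Lemma size_encode_LCIS (M : nat) (Ys : seq (seq nat)) :
  (forall Y, Y \in Ys -> size Y <= M) -> size (encode_LCIS Ys) <= size Ys * M.+1.
Proof.
elim: Ys => // Y Ys IH H; rewrite /encode_LCIS /= size_cat mulSn -addSn leq_add //.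
  by rewrite ltnS H ?mem_head.
by apply: IH => Y' Y'in; apply: H; rewrite inE Y'in orbT.
Qed.

Lemma monomials : [/\ 0 < z, size E <= z, ell <= z & size f * 2 ^ ell <= z] /\
  [/\ 2 ^ ell <= z, size E * 2 ^ ell <= z, ell * 2 ^ ell <= z, size f * 2 ^ ell * ell <= z & size f <= z].
Proof.
have E0 : 0 < size E by [].
have x0 : 0 < 2 ^ ell by rewrite expn_gt0.
have fE : size f <= size E.
  have Hs : size E = (size (flatten [seq encode_clause cl | cl <- f])).+2 by [].
  rewrite Hs; apply: leq_trans (leq_trans _ (leqnSn _)) (leqnSn _).
  elim: (f) => //= cl f' IH; rewrite size_cat ltnS; apply: leq_trans IH _; apply: leq_addl.
have q_s : size E <= q by rewrite leq_pmulr.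
have q_h : ell.+1 <= q by rewrite leq_pmull.
have q_z : q <= z by rewrite leq_pmull.
have sx : size E * 2 ^ ell <= z by rewrite mulnC leq_mul2l q_s orbT.
have ex : ell.+1 * 2 ^ ell <= z by rewrite mulnC leq_mul2l q_h orbT.
split; split.
- by apply: leq_trans q_z; apply: leq_trans q_s.
- exact: leq_trans q_z.
- by apply: leq_trans q_z; apply: leq_trans q_h.
- by apply: leq_trans sx; rewrite leq_mul2r fE orbT.
- by apply: leq_trans ex; rewrite leq_pmull.
- by [].
- by apply: leq_trans ex; rewrite leq_mul2r leqnSn orbT.
- by rewrite [size f * _]mulnC -mulnA leq_mul2l; apply/orP; right; apply: leq_mul.
- by apply: leq_trans fE _; apply: leq_trans q_z.
Qed.

Lemma size_w_le : size w <= k * z + k * (k * z) + 2 * (k * (k * (k * z))).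
Proof.
have [[z0 _ _ fx] [_ _ _ fxe _]] := monomials.
apply: leq_trans (size_encode_LCIS size_instance_le) _.
rewrite size_map size_iota.
have -> : k * (2 ^ ell * (k * size f * (1 + 2 * k * ell))).+1
  = k * 1 + k * (k * (size f * 2 ^ ell)) + 2 * (k * (k * (k * (size f * 2 ^ ell * ell)))).
  by move: (2 ^ ell) (size f) ell => a b e; clear; lia.
by rewrite !leq_add // !leq_mul2l ?z0 ?fx ?fxe !orbT.
Qed.

Lemma k_monomials : [/\ z <= k * z, k * z <= k * (k * z), k * (k * z) <= k * (k * (k * z)),
  k * (k * (k * z)) <= k * (k * (k * (k * z))) & k <= k * z].
Proof.
have [[z0 _ _ _] _] := monomials.
have k0 : 0 < k by apply: leq_trans k_ge3.
have kP a : a <= k * a by rewrite leq_pmull.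
by split; rewrite ?kP // leq_pmulr.
Qed.

Lemma top_le : top <= k * (k * z).
Proof.
have [[_ _ _ fx] _] := monomials.
by rewrite /top /c -mulnA !leq_mul2l fx !orbT.
Qed.

Lemma Bd_le : Bd <= K ^ 3 * z.
Proof.
have [[z0 Ez ez fx] [_ _ _ _ fz]] := monomials.
have [k1 k2 k3 k4 kz] := k_monomials.
have kell : k * ell <= k * z by rewrite leq_mul2l ez orbT.
have -> : K ^ 3 * z = 100 * (100 * (100 * (k * (k * (k * z))))) by rewrite /K !expnS expn0; clear; lia.
move: size_w_le top_le N_le_ell z0 Ez ez fz k1 k2 k3 kz kell; rewrite /Bd /V /tl /wb /B.
move: (size w) top (size E) (size f) (k * ell) ell z => a1 a2 a3 a4 a5 a6 a7.
move: (k * (k * (k * a7))) (k * (k * a7)) (k * a7) => b3 b2 b1.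
by clear; lia.
Qed.

Lemma K_ge : 300 <= K.
Proof. by rewrite /K; move: k_ge3; clear; lia. Qed.

Lemma q_facts : [/\ 0 < q, size E <= q & ell.+1 <= q].
Proof. by split; rewrite ?leq_pmulr ?leq_pmull. Qed.

(** Apart from [2 ^ ell], each factor of the bound on [Bd] is estimated by [n < 2 ^ n]. This is
    crude, but the bit length enters only the polynomial part of the running time. *)
Lemma bitlen_Bd_le : bitlen Bd <= K ^ 4 * q.
Proof.
have [q0 qs qh] := q_facts; have K300 := K_ge.
apply: (@leq_trans (K ^ 3 + ell + (size E + ell.+1))).
  apply: bitlen_le; first by move: (K ^ 3) => a; clear; lia.
  apply: leq_ltn_trans Bd_le _.
  have lt2 n : n < 2 ^ n by apply: ltn_expl.
  have -> : K ^ 3 * z = (K ^ 3 * 2 ^ ell) * q by rewrite /z mulnA.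
  apply: (@leq_ltn_trans (K ^ 3 * 2 ^ ell * (2 ^ size E * 2 ^ ell.+1))).
    by rewrite leq_mul2l; apply/orP; right; apply: leq_mul; apply: ltnW.
  rewrite (expnD 2 (K ^ 3 + ell)) (expnD 2 (K ^ 3)) (expnD 2 (size E)).
  have x0 n : 0 < 2 ^ n by rewrite expn_gt0.
  have p0 : 0 < 2 ^ size E * 2 ^ ell.+1 by rewrite (muln_gt0 (2 ^ size E)) !x0.
  by rewrite ltn_mul2r p0 ltn_mul2r x0 lt2.
rewrite [K ^ 4]expnS; have : 0 < K ^ 3 by rewrite expn_gt0; apply/orP; left; move: K300; clear; lia.
move: (K ^ 3) => a a0; apply: (@leq_trans (4 * a * q)).
  have : q <= a * q by rewrite leq_pmull.
  have : a <= a * q by rewrite leq_pmulr.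
  by move: qs qh; move: (q) (size E) (ell) => u v e; clear; lia.
by apply: leq_mul => //; apply: leq_mul => //; apply: leq_trans K300.
Qed.

Lemma tau_le : tau Bd <= K ^ 5 * q.
Proof.
have [q0 _ _] := q_facts; have K300 := K_ge; have := bitlen_Bd_le.
rewrite /tau [K ^ 5]expnS -mulnA.
have : 0 < K ^ 4 * q by rewrite muln_gt0 expn_gt0 q0 andbT; apply/orP; left; move: K300; clear; lia.
move: (K ^ 4 * q) => a a0 H; apply: (@leq_trans (18 * a)); first by move: a0 H; clear; lia.
by rewrite leq_mul2r; apply/orP; right; move: K300; clear; lia.
Qed.

Lemma steps_le : steps <= K ^ 4 * z.
Proof.
have [[z0 Ez ez _] [xz sx ex _ _]] := monomials.
have [k1 k2 k3 k4 kz] := k_monomials; have W := size_w_le.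
have -> : K ^ 4 * z = 100 * (100 * (100 * (100 * (k * (k * (k * (k * z))))))).
  by rewrite /K !expnS expn0; clear; lia.
have inner : k * (2 * ((size E + 4 * ell + 12) * 2 ^ ell)) + size w <= 38 * (k * (k * (k * z))).
  have : k * (2 * ((size E + 4 * ell + 12) * 2 ^ ell)) <= 34 * (k * z).
    have -> : k * (2 * ((size E + 4 * ell + 12) * 2 ^ ell))
      = k * (2 * (size E * 2 ^ ell + 4 * (ell * 2 ^ ell) + 12 * 2 ^ ell)).
      by move: (size E) (2 ^ ell) (ell) => a x e; clear; lia.
    have -> : 34 * (k * z) = k * (34 * z) by rewrite mulnCA.
    by rewrite leq_mul2l; apply/orP; right; move: xz sx ex; clear; lia.
  by move: W k1 k2 k3; move: (k * (2 * _)) (size w) (k * (k * (k * z))) (k * (k * z)) (k * z) => *; lia.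
have outer : A * (k * (2 * ((size E + 4 * ell + 12) * 2 ^ ell)) + size w)
    <= 2000 * (k * (k * (k * (k * z)))).
  apply: (@leq_trans (A * (38 * (k * (k * (k * z)))))); first by rewrite leq_mul2l inner orbT.
  by rewrite /A mulnDl; move: k4; move: (k * (k * (k * z))) => y; clear; lia.
move: outer; rewrite /steps /B; set Y := A * _; move: Y => Y outer.
by move: outer Ez ez z0 k1 k2 k3 k4 kz; move: (size E) (z) => a u; clear; lia.
Qed.

Lemma total_le cP : steps * tau Bd + 250 * (bitlen Bd * cP) <= K ^ 9 * (z * q + q * cP).
Proof.
rewrite mulnDr; apply: leq_add.
  have -> : K ^ 9 * (z * q) = (K ^ 4 * z) * (K ^ 5 * q) by rewrite -[9]/(4 + 5) expnD mulnACA.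
  by apply: leq_mul; [apply: steps_le|apply: tau_le].
rewrite (mulnA 250) (mulnA (K ^ 9)); apply: leq_mul => //.
apply: (@leq_trans (K * (K ^ 4 * q))).
  by apply: leq_mul bitlen_Bd_le; apply: leq_trans K_ge.
rewrite (mulnA K) -expnS; apply: leq_mul => //; apply: leq_pexp2l => //.
by apply: leq_trans K_ge.
Qed.

Lemma max_len_le : (max_len Xs).+1 <= K ^ 3 * z.
Proof.
have [[z0 _ _ fx] [_ _ _ fxe _]] := monomials.
have [k1 k2 k3 _ _] := k_monomials.
have -> : K ^ 3 * z = 100 * (100 * (100 * (k * (k * (k * z))))) by rewrite /K !expnS expn0; clear; lia.
have : max_len Xs <= k * (k * z) + 2 * (k * (k * (k * z))).
  apply/bigmax_leqP_seq => X XX _; apply: leq_trans (size_instance_le XX) _.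
  have -> : 2 ^ ell * (k * size f * (1 + 2 * k * ell))
    = k * (size f * 2 ^ ell) + 2 * (k * (k * (size f * 2 ^ ell * ell))).
    by move: (2 ^ ell) (size f) ell => a b e; clear; lia.
  apply: (@leq_trans (k * z + 2 * (k * (k * z)))).
    by rewrite !leq_add // !leq_mul2l ?fx ?fxe !orbT.
  by move: k2 k3; clear; lia.
by move: k1 k2 k3 z0; move: (max_len _) (z) => m u; clear; lia.
Qed.

Lemma lcis_le_Bd L : is_LCIS_length Xs L -> L <= Bd.
Proof.
case=> [[Z [[_ /allP HZ] <-]] _].
have X0 : lcis_seq k ell f 0 \in Xs.
  by apply/mapP; exists 0; rewrite // mem_iota; apply: leq_trans k_ge3.
apply: leq_trans (size_subseq (HZ _ X0)) _.
apply: (@leq_trans (size w)); last by rewrite /Bd; clear; lia.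
rewrite /w; elim: Xs X0 => //= Y Ys IH; rewrite inE /encode_LCIS /= size_cat => /orP[/eqP ->|/IH H].
  by apply: leq_trans (leq_addr _ _) (leqnSn _).
by apply: leq_trans H _; apply: leq_trans (leq_addl _ _) (leqnSn _).
Qed.

Lemma lcis_instanceP : LCIS_instance k Xs.
Proof. exact: (lcis_instance_valid _ k_ge3). Qed.

Lemma reduction_sound fuel rP cP :
  is_LCIS_length Xs (rP 0) -> exec P fuel 0 (init_regs w) 0 = Some (rP, cP) ->
  exists fuel' r' cost, [/\ exec (sat_program k P) fuel' 0 (init_regs E) 0 = Some (r', cost),
    (r' 0 = 1 <-> satisfiable f) /\ (r' 0 = 0 <-> ~ satisfiable f)
    & cost <= K ^ 9 * (z * q + q * cP)].
Proof.
move=> HL HP.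
have [fuel' [r' [cost [Ex r0 Hc]]]] := reduction_run (lcis_le_Bd HL) HP.
exists fuel', r', cost; split=> //; last exact: leq_trans Hc (total_le cP).
have complete := lcis_complete k_ge3 (isT : 0 < ell) N_le_ell f_dcnf HL.
have sound := lcis_sound k_ge3 (isT : 0 < ell) HL.
rewrite r0; case: (boolP (thr <= rP 0)) => H; split; split=> //=.
- by move=> _; apply: sound.
- by move=> nf; case: nf; apply: sound.
- by move=> /complete; rewrite -/thr (negbTE H).
- by move=> _ /complete; rewrite -/thr (negbTE H).
Qed.

End Reduction.

(** * Running time *)
Section TimeBound.

Local Open Scope R_scope.

Lemma exp_pow y (a : nat) : (exp y ^ a)%R = exp (INR a * y).
Proof.
elim: a => [|a IH]; first by rewrite Rmult_0_l exp_0.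
by rewrite -[(_ ^ _)%R]/(exp y * exp y ^ a)%R IH -exp_plus S_INR; congr exp; ring.
Qed.

(** This pays for polynomial factors in [N]. A linear function lies below an exponential of small
    rate, and raising to the power [a] multiplies that rate by [a]. *)
Lemma poly_le_exp (a : nat) (delta : R) : 0 < delta ->
  exists D, 0 < D /\ forall N : nat, ((INR N + 1) ^ a)%R <= D * Rpower 2 (delta * INR N).
Proof.
move=> d0; have l2 : 0 < ln 2 by rewrite -ln_1; apply: ln_increasing; lra.
have a1 : 0 < INR a + 1 by have := pos_INR a; lra.
(* The denominator [a + 1] leaves room for the power [a] and is nonzero also for [a = 0]. *)
pose g := delta * ln 2 / (INR a + 1).
have g0 : 0 < g by apply: Rdiv_lt_0_compat => //; apply: Rmult_lt_0_compat.
have gi : 0 < / g by apply: Rinv_0_lt_compat.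
exists ((1 + / g) ^ a)%R; split; first by apply: pow_lt; lra.
move=> N; have N0 := pos_INR N.
have H1 : INR N + 1 <= (1 + / g) * exp (g * INR N).
  have H := exp_ineq1_le (g * INR N).
  apply: (Rle_trans _ ((1 + / g) * (1 + g * INR N))).
    have -> : (1 + / g) * (1 + g * INR N) = 1 + / g + g * INR N + INR N.
      by field; lra.
    by have := Rmult_le_pos _ _ (Rlt_le _ _ g0) N0; lra.
  by apply: Rmult_le_compat_l => //; lra.
apply: (Rle_trans _ (((1 + / g) * exp (g * INR N)) ^ a)%R); first by apply: pow_incr; lra.
rewrite Rpow_mult_distr; apply: Rmult_le_compat_l; first by apply: pow_le; lra.
rewrite exp_pow /Rpower.
have E : INR a * (g * INR N) <= delta * INR N * ln 2.
  rewrite /g; have -> : INR a * (delta * ln 2 / (INR a + 1) * INR N)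
    = (delta * INR N * ln 2) * (INR a / (INR a + 1)) by field; lra.
  rewrite -[X in _ <= X]Rmult_1_r; apply: Rmult_le_compat_l.
    by apply: Rmult_le_pos; [apply: Rmult_le_pos|]; lra.
  by apply: (Rmult_le_reg_r (INR a + 1)) => //; field_simplify; lra.
case: E => [/exp_increasing|->]; lra.
Qed.

Lemma INR_leq (m n : nat) : (m <= n)%N -> INR m <= INR n.
Proof. by move=> H; apply: le_INR; lia. Qed.

Lemma INR_expn (m n : nat) : INR (m ^ n)%N = (INR m ^ n)%R.
Proof. by elim: n => // n IH; rewrite expnS mult_INR IH. Qed.

(** The exponent exceeds [N / k] by at most 2, one for rounding and one for the added 1; hence the
    factor 4. *)
Lemma expn_ceil_le (k N : nat) : (3 <= k)%N ->
  INR (2 ^ (1 + (N + k.-1) %/ k))%N <= 4 * Rpower 2 (INR N / INR k).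
Proof.
move=> k3; have kk : 3 <= INR k by have := INR_leq k3; rewrite [INR 3]/=; lra.
set e := (1 + _)%N; have He : (e * k <= N + k + k)%N.
  have := leq_divM (N + k.-1) k; rewrite /e mulnDl mul1n; move: (_ * _)%N => x; lia.
have He' : INR e <= INR N / INR k + 2.
  apply: (Rmult_le_reg_r (INR k)); first by lra.
  have -> : (INR N / INR k + 2) * INR k = INR N + INR k + INR k by field; lra.
  by have := INR_leq He; rewrite mult_INR !plus_INR.
rewrite INR_expn -[INR 2]/2 -Rpower_pow; last by lra.
have -> : 4 = Rpower 2 2 by rewrite -[X in Rpower _ X]/(INR 2) Rpower_pow /=; lra.
by rewrite -Rpower_plus; apply: Rle_Rpower; lra.
Qed.

Lemma ceil_le (k N : nat) : (3 <= k)%N -> INR (1 + (N + k.-1) %/ k).+1 <= 2 * (INR N + 1).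
Proof.
move=> k3; have H : ((N + k.-1) %/ k <= N)%N.
  by rewrite -ltnS ltn_divLR; [nia|lia].
have := INR_leq H; rewrite add1n !S_INR; have := pos_INR N; lra.
Qed.

(** With [n] about [2 ^ (N / k)], the power [k - e] of [n] becomes [2 ^ (N * (1 - e / k))]. What is
    left is a power of [q], whose part in [N] is absorbed by half of the saving [e / k]. *)
Lemma time_bound (k : nat) (eps C : R) : (3 <= k)%N -> 0 < eps ->
  exists (C' : R) (a : nat), forall N s n cP cost : nat,
    let ell := (1 + (N + k.-1) %/ k)%N in
    let q := (s * ell.+1)%N in let z := (2 ^ ell * q)%N in
    (0 < s)%N -> (0 < n <= (100 * k) ^ 3 * z)%N ->
    INR cP <= C * Rpower (INR n) (INR k - eps) ->
    (cost <= (100 * k) ^ 9 * (z * q + q * cP))%N ->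
    INR cost <= C' * Rpower 2 ((1 - Rmin eps 1 / (2 * INR k)) * INR N) * (INR s.+1 ^ a)%R.
Proof.
move=> k3 e0; have kk : 3 <= INR k by have := INR_leq k3; rewrite [INR 3]/=; lra.
(* The cap at 1 keeps [k - e] positive, so powers are monotone in the base, and gives
   [1 / k <= 1 - e / k], so the time of the reduction itself fits. *)
set e := Rmin eps 1; have e1 : e <= 1 by apply: Rmin_r.
have ee : e <= eps by apply: Rmin_l.
have ep : 0 < e by apply: Rmin_pos; lra.
pose d := e / (2 * INR k).
have dp : 0 < d by apply: Rdiv_lt_0_compat; lra.
have [D [D0 HD]] := poly_le_exp (k + 2) dp.
(* The given constant may be negative; a nonnegative one allows multiplying inequalities. *)
pose C1 := Rmax C 0; have C10 : 0 <= C1 by apply: Rmax_r.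
have CC1 : C <= C1 by apply: Rmax_l.
pose A3 := INR ((100 * k) ^ 3)%N * 4.
pose C2 := C1 * Rpower A3 (INR k - e).
have A30 : 0 < A3.
  apply: Rmult_lt_0_compat; last by lra.
  by apply: lt_0_INR; have : (0 < (100 * k) ^ 3)%N by [rewrite expn_gt0; apply/orP; left; lia]; lia.
have C20 : 0 <= C2 by apply: Rmult_le_pos => //; apply/Rlt_le/exp_pos.
pose K9 := INR ((100 * k) ^ 9)%N; have K90 : 0 <= K9 by apply: pos_INR.
exists (K9 * (4 + C2) * (2 ^ (k + 2))%R * D), (k + 2)%N => N s n cP cost ell q z s0 /andP[n0 nz] HcP Hcost.
pose X := Rpower 2 (INR N / INR k); pose G := Rpower 2 (INR N * (1 - e / INR k)).
have N0 := pos_INR N.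
have x4 : INR (2 ^ ell)%N <= 4 * X by apply: expn_ceil_le.
have XG : X <= G.
  apply: Rle_Rpower; first by lra.
  rewrite /Rdiv; apply: Rmult_le_compat_l => //.
  apply: (Rmult_le_reg_r (INR k)); first by lra.
  by have -> : (1 - e * / INR k) * INR k = INR k - e by [field; lra]; rewrite Rinv_l; lra.
have X0 : 0 < X by apply: exp_pos.
have q1 : 1 <= INR q.
  by apply: (INR_leq (m := 1)); rewrite /q muln_gt0 s0.
have qp j i : (j <= i)%N -> (INR q ^ j <= INR q ^ i)%R.
  by move=> ji; apply: Rle_pow => //; lia.
have zE : INR z <= 4 * X * INR q by rewrite mult_INR; apply: Rmult_le_compat_r; lra.
have n1 : 1 <= INR n by apply: (INR_leq (m := 1)).
have nA : INR n <= A3 * X * INR q.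
  apply: (Rle_trans _ (INR ((100 * k) ^ 3 * z)%N)); first exact: INR_leq.
  rewrite mult_INR /A3; have -> : INR ((100 * k) ^ 3) * 4 * X * INR q
    = INR ((100 * k) ^ 3) * (4 * X * INR q) by ring.
  by apply: Rmult_le_compat_l => //; apply: pos_INR.
have cPb : INR cP <= C2 * G * (INR q ^ k)%R.
  apply: (Rle_trans _ _ _ HcP).
  apply: (Rle_trans _ (C1 * Rpower (INR n) (INR k - eps))).
    by apply: Rmult_le_compat_r => //; apply/Rlt_le/exp_pos.
  rewrite /C2 !Rmult_assoc; apply: Rmult_le_compat_l => //.
  apply: (Rle_trans _ (Rpower (INR n) (INR k - e))).
    have [n1'|n1'] : 1 < INR n \/ INR n = 1 by lra.
      by apply: Rle_Rpower; lra.
    by rewrite n1' /Rpower ln_1 !Rmult_0_r; lra.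
  apply: (Rle_trans _ (Rpower (A3 * (X * INR q)) (INR k - e))).
    by apply: Rle_Rpower_l; [lra|split; [lra|rewrite -Rmult_assoc]].
  have Xq : 0 < X * INR q by apply: Rmult_lt_0_compat; lra.
  rewrite -Rpower_mult_distr // -Rpower_mult_distr //; last by lra.
  apply: Rmult_le_compat_l; first by apply/Rlt_le/exp_pos.
  have -> : Rpower X (INR k - e) = G.
    by rewrite /X Rpower_mult /G; congr Rpower; field; lra.
  apply: Rmult_le_compat_l; first by apply/Rlt_le/exp_pos.
  rewrite -Rpower_pow; last by lra.
  have [q1'|q1'] : 1 < INR q \/ INR q = 1 by lra.
    by apply: Rle_Rpower; lra.
  by rewrite q1' /Rpower ln_1 !Rmult_0_r; lra.
have G0 : 0 < G by apply: exp_pos.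
(* The exponent [k + 2] dominates both [q ^ 2] from the reduction and [q ^ k.+1] from the
   simulation. *)
have main : INR cost <= K9 * ((4 + C2) * G * (INR q ^ (k + 2))%R).
  apply: (Rle_trans _ (INR ((100 * k) ^ 9 * (z * q + q * cP))%N)); first exact: INR_leq.
  rewrite (mult_INR ((100 * k) ^ 9)) plus_INR (mult_INR z) (mult_INR q) -/K9; apply: Rmult_le_compat_l => //.
  have -> : (4 + C2) * G * (INR q ^ (k + 2))%R
    = 4 * G * (INR q ^ (k + 2))%R + C2 * G * (INR q ^ (k + 2))%R by ring.
  apply: Rplus_le_compat.
    apply: (Rle_trans _ (4 * X * INR q * INR q)).
      by apply: Rmult_le_compat_r; [lra|].
    have -> : 4 * X * INR q * INR q = 4 * X * (INR q ^ 2)%R by ring.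
    apply: Rmult_le_compat; try lra; first by apply: pow_le; lra.
    by apply: qp; lia.
  apply: (Rle_trans _ (INR q * (C2 * G * (INR q ^ k)%R))).
    by apply: Rmult_le_compat_l; lra.
  have -> : INR q * (C2 * G * (INR q ^ k)%R) = C2 * G * (INR q ^ k.+1)%R by rewrite /=; ring.
  apply: Rmult_le_compat_l; first by apply: Rmult_le_pos; lra.
  by apply: qp; lia.
apply: (Rle_trans _ _ _ main).
have qb : INR q <= INR s.+1 * (2 * (INR N + 1)).
  rewrite mult_INR; apply: Rmult_le_compat; try exact: pos_INR.
    by apply: INR_leq; lia.
  exact: ceil_le.
have qpow : (INR q ^ (k + 2))%R <= (INR s.+1 ^ (k + 2))%R * ((2 ^ (k + 2))%R * (D * Rpower 2 (d * INR N))).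
  apply: (Rle_trans _ ((INR s.+1 * (2 * (INR N + 1))) ^ (k + 2))%R).
    by apply: pow_incr; split; [apply: pos_INR|].
  rewrite !Rpow_mult_distr; apply: Rmult_le_compat_l; first by apply: pow_le; apply: pos_INR.
  by apply: Rmult_le_compat_l; [apply: pow_le; lra|apply: HD].
(* Spending [d], half of [e / k], on the polynomial in [N] leaves the saving [d]. *)
have GE : G * Rpower 2 (d * INR N) = Rpower 2 ((1 - d) * INR N).
  by rewrite /G -Rpower_plus; congr Rpower; rewrite /d; field; lra.
rewrite -/d -GE.
apply: (Rle_trans _ (K9 * ((4 + C2) * G * ((INR s.+1 ^ (k + 2))%R * ((2 ^ (k + 2))%R * (D * Rpower 2 (d * INR N))))))).
  apply: Rmult_le_compat_l => //; apply: Rmult_le_compat_l => //.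
  by apply: Rmult_le_pos; lra.
by apply: Req_le; ring.
Qed.

End TimeBound.

Theorem theorem5 :
  SETH ->
  forall (k : nat) (eps : R), 3 <= k -> (0 < eps)%R ->
    ~ exists P : program, solves_kLCIS_in_time k eps P.
Proof.
move=> seth k eps k3 e0 [P [C HP]]; apply: seth.
have kk : (3 <= INR k)%R by have := INR_leq k3; rewrite [INR 3]/=; lra.
(* One saving must serve all clause widths; this one is determined by [eps] and [k]. *)
exists (Rmin eps 1 / (2 * INR k))%R; split.
  by apply: Rdiv_lt_0_compat; [apply: Rmin_pos; lra|lra].
move=> d d3; exists (sat_program k P).
have [C' [a bound]] := time_bound C k3 e0.
exists C', a => N f Hf.
have [out [[fuel [r [cP [Ex [cPb rout]]]]] HL]] := HP _ (lcis_instanceP N f k3).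
rewrite -rout in HL.
have [fuel' [r' [cost [Ex' [sat unsat] Hcost]]]] := reduction_sound k3 Hf HL Ex.
exists (r' 0); split; last by [].
exists fuel', r', cost; split=> //; split=> //.
have nb := max_len_le N f k3.
by apply: bound cPb Hcost; rewrite // nb.
Qed.
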